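(* Let $\mathcal{L}$ be an operator with fundamental solution $\Gamma$ satisfying the standing assumptions given in the context. Let $f:\mathbb{R}^n\to\mathbb{R}$ be a compactly supported continuous function, and define $$u_f(x):=\int_{\mathbb{R}^n}\Gamma(x,y)f(y)\,dy,\qquad x\in\mathbb{R}^n.$$ Then $u_f\in\mathcal{A}(\mathbb{R}^n,\mathcal{L})$ and $$\mathcal{L}_a u_f(x)=-f(x)\quad\text{for every }x\in\mathbb{R}^n.$$
   Context: Standing assumptions. $\mathcal{L}$ is the partial differential operator on $\mathbb{R}^n$ $$\mathcal{L}=\sum_{i,j=1}^n\partial_{x_i}\bigl(a_{ij}(x)\,\partial_{x_j}\bigr),$$ where $A(x)=(a_{ij}(x))_{i,j=1,\dots,n}$ is, for every $x\in\mathbb{R}^n$, a real symmetric nonnegative definite matrix, the functions $a_{ij}$ are smooth ($C^\infty$) on $\mathbb{R}^n$, and $\sum_{i=1}^n a_{ii}(x)>0$ for every $x\in\mathbb{R}^n$. Moreover $\mathcal{L}$ is hypoelliptic in $\mathbb{R}^n$ (every distribution $u$ on an open set with $\mathcal{L}u$ smooth there is itself smooth there), and $\mathcal{L}$ is endowed with a fundamental solution $\Gamma:\{(x,y)\in\mathbb{R}^n\times\mathbb{R}^n: x\ne y\}\to\mathbb{R}$, smooth on its domain, such that (i) $\Gamma(x,y)=\Gamma(y,x)>0$ for all $x\neq y$; (ii) $\lim_{x\to y}\Gamma(x,y)=\infty$ for every $y\in\mathbb{R}^n$; (iii) $\lim_{x\to\infty}\bigl(\sup_{y\in K}\Gamma(x,y)\bigr)=0$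 for every compact set $K\subseteq\mathbb{R}^n$; (iv) $\Gamma(x,\cdot)\in L^1_{\rm loc}(\mathbb{R}^n)$ for every $x\in\mathbb{R}^n$. That $\Gamma$ is a fundamental solution of $\mathcal{L}$ means: for every $\varphi\in C_0^\infty(\mathbb{R}^n,\mathbb{R})$ and every $x\in\mathbb{R}^n$, $\int_{\mathbb{R}^n}\Gamma(x,y)\,\mathcal{L}\varphi(y)\,dy=-\varphi(x)$. Set $\Gamma(x,x):=+\infty$. $\mathcal{L}$-balls and averages. For $x\in\mathbb{R}^n$ and $r>0$, $\Omega_r(x):=\{y\in\mathbb{R}^n:\Gamma(x,y)>1/r\}$. Fix a real number $\alpha>-1$. For a continuous function $u:\mathbb{R}^n\to\mathbb{R}$ define $$M_r(u)(x):=\frac{\alpha+1}{r^{\alpha+1}}\int_{\Omega_r(x)}u(y)\,K(x,y)\,dy,\qquad K(x,y):=\frac{\langle A(y)\nabla_y\Gamma(x,y),\nabla_y\Gamma(x,y)\rangle}{(\Gamma(x,y))^{\alpha+2}},$$ and $$Q_r(x):=\frac{\alpha+1}{r^{\alpha+1}}\int_0^r\rho^\alpha\left(\int_{\Omega_\rho(x)}\Bigl(\Gamma(x,y)-\frac1\rho\Bigr)dy\right)d\rho.$$ Asymptotic average operator. $\mathcal{A}(\mathbb{R}^n,\mathcal{L})$ is the set of continuous functions $u:\mathbb{R}^n\to\mathbb{R}$ such that the limit $$\mathcal{L}_a u(x):=\lim_{r\to0^+}\frac{M_r(u)(x)-u(x)}{Q_r(x)}$$ exists in $\mathbb{R}$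 at every point $x\in\mathbb{R}^n$. *)

(* Defs.v *)
From HB Require Import structures.
From mathcomp Require Import all_boot all_order all_algebra.
From mathcomp Require Import all_classical all_reals all_analysis.

Set Implicit Arguments.
Unset Strict Implicit.
Unset Printing Implicit Defensive.
Import Order.TTheory GRing.Theory Num.Theory.
Import numFieldNormedType.Exports.

Local Open Scope classical_set_scope.
Local Open Scope ring_scope.

(** R^n is ['rV[R]_n].  Its sigma-algebra is the product one, i.e. the smallest
    that makes the coordinates measurable, as in the library's instance for
    [n.-tuple T]; it coincides with the Borel sigma-algebra. *)
Section measurable_rV.
Context {R : realType} (n : nat).

Definition coord_rV (i : 'I_n) (x : 'rV[R]_n) : measurableTypeR R := x ord0 i.

Let rV_set0 : g_sigma_preimage coord_rV set0.
Proof. exact: sigma_algebra0. Qed.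

Let rV_setC B : g_sigma_preimage coord_rV B ->
  g_sigma_preimage coord_rV (~` B).
Proof. exact: sigma_algebraC. Qed.

Let rV_bigcup (F : (set 'rV[R]_n)^nat) :
  (forall i, g_sigma_preimage coord_rV (F i)) ->
  g_sigma_preimage coord_rV (\bigcup_i F i).
Proof. exact: sigma_algebra_bigcup. Qed.

HB.instance Definition _ := @isMeasurable.Build default_measure_display
  'rV[R]_n (g_sigma_preimage coord_rV) rV_set0 rV_setC rV_bigcup.

End measurable_rV.

Section lebesgue_rV.
Context {R : realType}.

Lemma measurable_coord_rV n (i : 'I_n) :
  measurable_fun [set: 'rV[R]_n] (coord_rV i).
Proof.
move=> _ Y mY; rewrite setTI; apply: sub_sigma_algebra => /=.
rewrite -bigcup_seq/=; exists i => /=; first by rewrite mem_index_enum.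
by exists Y => //; rewrite setTI.
Qed.

Lemma measurable_fun_rV d (T : measurableType d) n (f : T -> 'rV[R]_n) :
  (forall i, measurable_fun [set: T] (coord_rV i \o f)) ->
  measurable_fun [set: T] f.
Proof.
move=> mf _ B mB; rewrite setTI.
suff sub : g_sigma_preimage (fun i => coord_rV i \o f) `<=` measurable.
  by apply: sub; rewrite g_sigma_preimage_comp; exists B => //; rewrite setTI.
apply: smallest_sub; first exact: sigma_algebra_measurable.
rewrite -bigcup_seq; apply: bigcup_sub => i _ C [D mD <-].
exact: mf.
Qed.

Definition cons_rV n (p : 'rV[R]_n * measurableTypeR R) : 'rV[R]_n.+1 :=
  row_mx (p.2)%:M p.1.

Lemma measurable_cons_rV n : measurable_fun setT (@cons_rV n).
Proof.
apply: measurable_fun_rV => i.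
case: (split_ordP (i : 'I_(1 + n))) => j ij.
- rewrite [_ \o _](_ : _ = snd) //; apply/funext => p /=.
  rewrite /coord_rV /cons_rV ij; apply: etrans (row_mxEl _ _ _ _) _.
  by rewrite !ord1 !mxE eqxx mulr1n.
- rewrite [_ \o _](_ : _ = coord_rV j \o fst); last first.
    apply/funext => p /=; rewrite /coord_rV /cons_rV ij.
    exact: row_mxEr.
  apply: measurableT_comp => //; exact: measurable_coord_rV.
Qed.

Definition lebesgue_cons n (m : {measure set 'rV[R]_n -> \bar R}) :
    set 'rV[R]_n.+1 -> \bar R :=
  pushforward (m \x lebesgue_measure)%E (@cons_rV n).

Section lebesgue_cons_measure.
Context n (m : {measure set 'rV[R]_n -> \bar R}).

Let lebesgue_cons0 : lebesgue_cons m set0 = 0%E.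
Proof. by rewrite /lebesgue_cons /pushforward preimage_set0 measure0. Qed.

Let lebesgue_cons_ge0 B : (0 <= lebesgue_cons m B)%E.
Proof. by rewrite /lebesgue_cons /pushforward; exact: measure_ge0. Qed.

Let lebesgue_cons_sigma_additive : semi_sigma_additive (lebesgue_cons m).
Proof.
move=> F mF tF mUF; rewrite /lebesgue_cons /pushforward preimage_bigcup.
apply: measure_semi_sigma_additive.
- by move=> k; rewrite -[X in measurable X]setTI; exact: measurable_cons_rV.
- apply/trivIsetP => /= i j _ _ ij; rewrite -preimage_setI.
  by move/trivIsetP : tF => /(_ _ _ _ _ ij) ->//; rewrite preimage_set0.
- rewrite -preimage_bigcup -[X in measurable X]setTI.
  exact: measurable_cons_rV.
Qed.

HB.instance Definition _ := isMeasure.Build _ _ _ (lebesgue_cons m)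
  lebesgue_cons0 lebesgue_cons_ge0 lebesgue_cons_sigma_additive.

End lebesgue_cons_measure.

Fixpoint lebesgue_rV_rec n : {measure set 'rV[R]_n -> \bar R} :=
  match n with
  | 0 => \d_(0 : 'rV[R]_0)
  | k.+1 => lebesgue_cons (lebesgue_rV_rec k)
  end.

Definition lebesgue_rV n : set 'rV[R]_n -> \bar R := lebesgue_rV_rec n.

HB.instance Definition _ n := Measure.on (@lebesgue_rV n).

End lebesgue_rV.
Arguments lebesgue_rV {R} n.

Section smooth.
Context {R : realType} {n : nat}.
Implicit Types (f g phi : 'rV[R]_n -> R) (U K : set 'rV[R]_n).

Definition partial (i : 'I_n) f : 'rV[R]_n -> R :=
  fun x => 'D_(delta_mx ord0 i) f x.

Definition partials (s : seq 'I_n) f : 'rV[R]_n -> R := foldr partial f s.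

(** Meant for an open [U], on which [partials s f] depends on [f] in [U] only. *)
Definition smooth_on U f : Prop := forall (s : seq 'I_n) x, U x ->
  {for x, continuous (partials s f)} /\
  forall i, derivable (partials s f) x (delta_mx ord0 i).

Definition supp f : set 'rV[R]_n := closure [set x | f x != 0].

Definition test_function U phi : Prop :=
  [/\ smooth_on setT phi, compact (supp phi) & supp phi `<=` U].

Definition grad f (x : 'rV[R]_n) : 'cV[R]_n := \col_i partial i f x.

End smooth.

(** A distribution on [U] is a functional of which only the values on the test
    functions of [U] are relevant; its continuity is expressed by the usual
    C^N-norm estimates on compact sets. *)
Section distributions.
Context {R : realType} {n : nat}.
Local Notation functional := (('rV[R]_n -> R) -> R).
Implicit Types (T : functional) (phi psi g : 'rV[R]_n -> R).
Implicit Types (U K : set 'rV[R]_n).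

Definition Cnorm (N : nat) phi : R :=
  sup [set `|partials s phi x| |
       s in [set s : seq 'I_n | (size s <= N)%N] & x in [set: 'rV[R]_n]].

Definition is_distribution U T : Prop :=
  (forall (c : R) phi psi, test_function U phi -> test_function U psi ->
     T (fun x => c * phi x + psi x) = c * T phi + T psi) /\
  (forall K, compact K -> K `<=` U -> exists C N, forall phi,
     test_function U phi -> supp phi `<=` K -> `|T phi| <= C * Cnorm N phi).

Definition dist_partial (i : 'I_n) T : functional :=
  fun phi => - T (partial i phi).

Definition dist_mul (a : 'rV[R]_n -> R) T : functional :=
  fun phi => T (fun x => a x * phi x).

Definition dist_smooth U T : Prop := exists2 g, smooth_on U g &
  forall phi, test_function U phi ->
    T phi = \int[lebesgue_rV n]_(x in U) (g x * phi x).

End distributions.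

Section operator.
Context {R : realType} {n : nat}.
Variable A : 'rV[R]_n -> 'M[R]_n.

Definition div_op (phi : 'rV[R]_n -> R) : 'rV[R]_n -> R := fun x =>
  \sum_i \sum_j partial i (fun z => A z i j * partial j phi z) x.

Definition dist_div_op (T : ('rV[R]_n -> R) -> R) : ('rV[R]_n -> R) -> R :=
  fun phi => \sum_i \sum_j
    dist_partial i (dist_mul (fun x => A x i j) (dist_partial j T)) phi.

Definition hypoelliptic : Prop :=
  forall (U : set 'rV[R]_n) (T : ('rV[R]_n -> R) -> R),
    open U -> is_distribution U T ->
    dist_smooth U (dist_div_op T) -> dist_smooth U T.

(** [coef_trace] excludes [n = 0]. *)
Record admissible_operator : Prop := {
  coef_symmetric : forall x, (A x)^T = A x ;
  coef_nonneg : forall x (v : 'cV[R]_n), 0 <= (v^T *m A x *m v) ord0 ord0 ;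
  coef_smooth : forall i j, smooth_on setT (fun x => A x i j) ;
  coef_trace : forall x, 0 < \tr (A x) ;
  op_hypoelliptic : hypoelliptic }.

End operator.

(** [Gamma] is a total function whose values on the diagonal are irrelevant:
    [Gammabar] is its extension by [+oo] to the diagonal.  In integrals over [y],
    the point [y = x] is Lebesgue-null. *)
Section fundamental_solution.
Context {R : realType} {n : nat}.
Variable A : 'rV[R]_n -> 'M[R]_n.
Variable Gamma : 'rV[R]_n -> 'rV[R]_n -> R.

Definition Gammabar (x y : 'rV[R]_n) : \bar R :=
  if x == y then +oo%E else (Gamma x y)%:E.

Definition infty_nbhs : set_system 'rV[R]_n :=
  filter_from [set: R] (fun M => [set x : 'rV[R]_n | M < `|x|]).

Record fundamental_solution : Prop := {
  fs_smooth : smooth_on [set z : 'rV[R]_(n + n) | lsubmx z != rsubmx z]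
                (fun z => Gamma (lsubmx z) (rsubmx z)) ;
  fs_sym : forall x y, x != y -> Gamma x y = Gamma y x ;
  fs_gt0 : forall x y, x != y -> 0 < Gamma x y ;
  fs_pole : forall y, Gamma x y @[x --> y^'] --> +oo ;
  fs_infty : forall K : set 'rV[R]_n, compact K -> K !=set0 ->
    ereal_sup [set Gammabar x y | y in K] @[x --> infty_nbhs] --> 0%E ;
  fs_L1loc : forall x (K : set 'rV[R]_n), compact K ->
    (lebesgue_rV n).-integrable K (fun y => (Gamma x y)%:E) ;
  fs_eq : forall (phi : 'rV[R]_n -> R) x, test_function setT phi ->
    \int[lebesgue_rV n]_y (Gamma x y * div_op A phi y) = - phi x }.

End fundamental_solution.

Section averages.
Context {R : realType} {n : nat}.
Variables (alpha : R) (A : 'rV[R]_n -> 'M[R]_n).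
Variable Gamma : 'rV[R]_n -> 'rV[R]_n -> R.
Implicit Types (x y : 'rV[R]_n) (u f : 'rV[R]_n -> R) (r : R).

Definition Omega r x : set 'rV[R]_n :=
  [set y | ((r^-1)%:E < Gammabar Gamma x y)%E].

Definition kernelK x y : R :=
  ((A y *m grad (Gamma x) y)^T *m grad (Gamma x) y) ord0 ord0
  / Gamma x y `^ (alpha + 2).

Definition average r u x : R :=
  (alpha + 1) / r `^ (alpha + 1) *
  \int[lebesgue_rV n]_(y in Omega r x) (u y * kernelK x y).

Definition Qavg r x : R :=
  (alpha + 1) / r `^ (alpha + 1) *
  \int[lebesgue_measure]_(rho in `]0, r[)
    (rho `^ alpha *
     \int[lebesgue_rV n]_(y in Omega rho x) (Gamma x y - rho^-1)).

Definition average_quotient u x r : R := (average r u x - u x) / Qavg r x.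

Definition asymptotic_class u : Prop :=
  continuous u /\ forall x, cvg (average_quotient u x r @[r --> 0^'+]).

Definition asymptotic_op u x : R := lim (average_quotient u x r @[r --> 0^'+]).

Definition potential f x : R := \int[lebesgue_rV n]_y (Gamma x y * f y).

End averages.

(* Main.v *)
From HB Require Import structures.
Require Import Defs.
From mathcomp Require Import all_boot all_order all_algebra.
From mathcomp Require Import all_classical all_reals all_analysis.
From mathcomp Require Import measurable_realfun ring lra.

(** Write [G] for the fundamental solution, [Gx] for [G x], and [E] for the energy
    density <A grad Gx, grad Gx>.  For a function [F] of one variable the chain
    rule gives [L (F \o Gx) = F'' (Gx) * E] off the pole [x], because [Gx] is
    harmonic there ([gam_harmonic]).  If [F] vanishes near 0 and is constant near
    infinity, then [F \o Gx] is a test function, and the equation satisfied by the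
    fundamental solution with pole [z] reads
      [F (G x z) = - \int G z y * F'' (Gx y) * E y dy]
    ([integral_gam_null_density]).  So no regularity of potentials is involved:
    the test functions are explicit.

    Write [F] as the average of the truncations [min t (1/s)] with a weight
    [m s ds]; then [m] has integral zero.  This constraint is lifted by
    subtracting from [m] a multiple of a hump that moves out to infinity
    ([integral_gam_density]), and a monotone limit reaches the weight
    proportional to [s^alpha] on the interval from 0 to [r], for which
    [- F'' (Gx) * E] is the kernel of the average
    ([integral_gam_power_density]).  Hence the average over [Omega r x] of [G z]
    is the average of [min (G x z) (1/s)] with this weight.

    By Fubini, [M_r (u_f) x - u_f x] is then minus the integral of [f] against
    the average of the positive part of [G x z - 1/s] ([average_potential]),
    while [Q_r x] is the integral of the same nonnegative function
    ([QavgE]).  As this function is carried by [Omega r x], which shrinks to [x],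
    the quotient tends to [- f x].

    The continuity of [u_f] rests on the continuity of [G x] in local mean with
    respect to [x] ([gam_mean_continuous]): near a given point, a positive multiple
    of some function whose potential is a test function dominates. *)

Set Implicit Arguments.
Unset Strict Implicit.
Unset Printing Implicit Defensive.
Import Order.TTheory GRing.Theory Num.Theory.
Import numFieldNormedType.Exports.
Local Open Scope classical_set_scope.
Local Open Scope ring_scope.

(** * Functions with continuous iterated directional derivatives *)

Section directional_derivatives.
Context {R : realType} {V : normedModType R}.
Implicit Types (f g : V -> R) (U : set V).

(** Directional derivatives are derivatives along a line, so that the
    one-dimensional chain rule applies to them. *)
Lemma is_derive_restr f (x v : V) (df : R) :
  is_derive x v f df <-> is_derive (0 : R) 1 (fun h : R => f (h *: v + x)) df.
Proof.
have E : 'D_v f x = 'D_1 (fun h : R => f (h *: v + x)) (0 : R).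
  rewrite /derive; set F := fun h => _; set G := fun h => _.
  suff -> : F = G by [].
  apply/funext => h; rewrite /F /G /=.
  by rewrite /= addr0 scale0r add0r [(h *: 1)%R]mulr1.
split=> -[d1 d2].
  by split; [exact: (proj1 (derivable1P _ _ _) d1)|rewrite -E].
by split; [exact: (proj2 (derivable1P _ _ _) d1)|rewrite E].
Qed.

Lemma is_derive_chain (F : R -> R) f (x v : V) (df dF : R) :
  is_derive x v f df -> is_derive (f x) 1 F dF ->
  is_derive x v (F \o f) (dF * df).
Proof.
move=> /is_derive_restr hf hF; apply/is_derive_restr.
apply: (@is_derive1_comp _ F (fun h : R => f (h *: v + x))) => //.
by rewrite scale0r add0r.
Qed.

Lemma is_derive_near f g (x v : V) df :
  (\forall y \near x, f y = g y) -> is_derive x v f df -> is_derive x v g df.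
Proof.
move=> fg [d1 d2]; split; first exact: near_eq_derivable d1.
by rewrite -d2; apply: near_eq_derive; near do symmetry; exact: fg.
Unshelve. all: end_near. Qed.

Lemma is_derive_mul f g (x v : V) df dg :
  is_derive x v f df -> is_derive x v g dg ->
  is_derive x v (fun y => f y * g y) (df * g x + f x * dg).
Proof.
move=> [f1 f2] [g1 g2]; split; first exact: (derivableM f1 g1).
by rewrite (deriveM f1 g1) f2 g2 /GRing.scale /= addrC mulrC.
Qed.

Lemma is_derive_add f g (x v : V) df dg :
  is_derive x v f df -> is_derive x v g dg ->
  is_derive x v (fun y => f y + g y) (df + dg).
Proof. by move=> [f1 f2] [g1 g2]; split; [exact: derivableD|rewrite deriveD // f2 g2]. Qed.

Lemma is_derive_const (c : R) (x v : V) : is_derive x v (fun _ : V => c) 0.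
Proof. by split; [exact: derivable_cst|rewrite derive_cst]. Qed.

Lemma continuous_near f g (x : V) :
  (\forall y \near x, f y = g y) -> {for x, continuous f} ->
  {for x, continuous g}.
Proof.
move=> fg; rewrite /prop_for /continuous_at => cf.
rewrite -(nbhs_singleton fg); apply: cvg_trans cf.
exact: near_eq_cvg.
Qed.

End directional_derivatives.

Section Ck.
Context {R : realType} {V : normedModType R} {I : Type} (e : I -> V).
Implicit Types (f g : V -> R) (U : set V) (k : nat).

(** The derivatives of order at most [k] in the directions [e i] exist and are
    continuous on [U].  The recursion peels off the derivative that is taken
    first, which is what makes product and chain rules inductive. *)
Fixpoint Ck k U f : Prop :=
  (forall x, U x -> {for x, continuous f}) /\
  if k is k'.+1 then
    forall i, (forall x, U x -> derivable f x (e i)) /\ Ck k' U ('D_(e i) f)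
  else True.

Definition Coo U f := forall k, Ck k U f.

Lemma Ck_cont k U f x : Ck k U f -> U x -> {for x, continuous f}.
Proof. by case: k => [|k] [cf _]; exact: cf. Qed.

Lemma Ck_derive k U f x i : Ck k.+1 U f -> U x ->
  is_derive x (e i) f ('D_(e i) f x).
Proof. by move=> -[_ /(_ i)[df _]] Ux; apply: DeriveDef => //; exact: df. Qed.

Lemma CkD k U f i : Ck k.+1 U f -> Ck k U ('D_(e i) f).
Proof. by move=> -[_ /(_ i)[]]. Qed.

Lemma Ck_eq k U f g : open U -> {in U, f =1 g} -> Ck k U f -> Ck k U g.
Proof.
move=> oU; elim: k f g => [|k IH] f g fg.
  move=> [cf _]; split=> // x Ux; apply: continuous_near (cf _ Ux).
  near=> y; apply: fg; rewrite inE; near: y; exact: open_nbhs_nbhs.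
have nfg x : U x -> \forall y \near x, f y = g y.
  move=> Ux; near=> y; apply: fg; rewrite inE; near: y.
  exact: open_nbhs_nbhs.
move=> [cf df]; split=> [x Ux|i].
  by apply: continuous_near (cf _ Ux); exact: nfg.
have [dfi Dfi] := df i; split=> [x Ux|].
  exact: near_eq_derivable (nfg _ Ux) (dfi _ Ux).
apply: (IH _ _ _ Dfi) => x; rewrite inE => Ux.
exact: near_eq_derive (nfg _ Ux).
Unshelve. all: end_near. Qed.

Lemma CkS_intro k U f (g : I -> V -> R) : open U ->
  (forall x, U x -> {for x, continuous f}) ->
  (forall i x, U x -> is_derive x (e i) f (g i x)) ->
  (forall i, Ck k U (g i)) -> Ck k.+1 U f.
Proof.
move=> oU cf fg cg; split=> // i; split=> [x Ux|]; first by case: (fg i x Ux).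
apply: (Ck_eq oU _ (cg i)) => x; rewrite inE => Ux.
by case: (fg i x Ux).
Qed.

Lemma CkW k U f : Ck k.+1 U f -> Ck k U f.
Proof.
elim: k f => [|k IH] f [cf df]; split=> // i.
by have [? ?] := df i; split=> //; exact: IH.
Qed.

Lemma Ck_sub k U W f : W `<=` U -> Ck k U f -> Ck k W f.
Proof.
move=> WU; elim: k f => [|k IH] f [cf df]; split=> //; first by move=> x /WU; exact: cf.
  by move=> x /WU; exact: cf.
move=> i; have [d1 d2] := df i; split; first by move=> x /WU; exact: d1.
exact: IH.
Qed.

(** Being of class C^k is a local property: functions are glued from pieces on
    open sets. *)
Lemma Ck_setU k U W f : Ck k U f -> Ck k W f -> Ck k (U `|` W) f.
Proof.
elim: k f => [|k IH] f [cf df] [cg dg].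
  by split=> // x [/cf|/cg].
split=> [x [/cf|/cg]//|i].
have [d1 d2] := df i; have [e1 e2] := dg i.
by split=> [x [/d1|/e1]//|]; exact: IH.
Qed.

Lemma Ck_cst k U c : open U -> Ck k U (fun=> c).
Proof.
move=> oU; elim: k c => [|k IH] c; first by split=> // x _; exact: cst_continuous.
apply: (CkS_intro (g := fun _ _ => 0)) => //.
  by move=> x _; exact: cst_continuous.
Qed.

Lemma Ck_add k U f g : open U -> Ck k U f -> Ck k U g ->
  Ck k U (fun x => f x + g x).
Proof.
move=> oU; elim: k f g => [|k IH] f g hf hg.
  split=> // x Ux; exact: (cvgD (Ck_cont hf Ux) (Ck_cont hg Ux)).
apply: (CkS_intro (g := fun i x => 'D_(e i) f x + 'D_(e i) g x)) => //.
- move=> x Ux; exact: (cvgD (Ck_cont hf Ux) (Ck_cont hg Ux)).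
- by move=> i x Ux; exact: is_derive_add (Ck_derive i hf Ux) (Ck_derive i hg Ux).
- by move=> i; apply: IH; exact: CkD.
Qed.

Lemma Ck_mul k U f g : open U -> Ck k U f -> Ck k U g ->
  Ck k U (fun x => f x * g x).
Proof.
move=> oU; elim: k f g => [|k IH] f g hf hg.
  split=> // x Ux; exact: (cvgM (Ck_cont hf Ux) (Ck_cont hg Ux)).
apply: (CkS_intro (g := fun i x => 'D_(e i) f x * g x + f x * 'D_(e i) g x)) => //.
- move=> x Ux; exact: (cvgM (Ck_cont hf Ux) (Ck_cont hg Ux)).
- by move=> i x Ux; exact: is_derive_mul (Ck_derive i hf Ux) (Ck_derive i hg Ux).
- move=> i; apply: Ck_add => //; apply: IH.
  + exact: CkD.
  + exact: CkW.
  + exact: CkW.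
  + exact: CkD.
Qed.

Lemma Ck_sum k U (J : Type) (s : seq J) (P : pred J) (F : J -> V -> R) :
  open U -> (forall j, Ck k U (F j)) ->
  Ck k U (fun x => \sum_(j <- s | P j) F j x).
Proof.
move=> oU hF; elim: s => [|j s IH].
  by apply: (Ck_eq oU _ (Ck_cst k 0 oU)) => x _; rewrite big_nil.
case Pj: (P j); last by apply: (Ck_eq oU _ IH) => x _; rewrite big_cons Pj.
apply: (Ck_eq oU _ (Ck_add oU (hF j) IH)) => x _.
by rewrite big_cons Pj.
Qed.

End Ck.

Definition dir1 {R : realType} (_ : unit) : R := 1.
Notation Ck1 := (Ck dir1).
Notation Coo1 := (Coo dir1).

Section Ck_comp.
Context {R : realType} {V : normedModType R} {I : Type} (e : I -> V).

(** The derivative of [F \o f] is a product of a composition of the same kind,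
    one order lower, and of a derivative of [f]: hence the induction on [k] with
    [F] generalized. *)
Lemma Ck_comp k (U : set V) (W : set R) (F : R -> R) (f : V -> R) : open U ->
  (forall x, U x -> W (f x)) -> Ck1 k W F -> Ck e k U f -> Ck e k U (F \o f).
Proof.
move=> oU UW; elim: k F f UW => [|k IH] F f UW hF hf.
  split=> // x Ux; apply: continuous_comp; first exact: Ck_cont hf Ux.
  by apply: Ck_cont hF _; exact: UW.
apply: (CkS_intro (g := fun i x => 'D_1 F (f x) * 'D_(e i) f x)) => //.
- move=> x Ux; apply: continuous_comp; first exact: Ck_cont hf Ux.
  by apply: Ck_cont hF _; exact: UW.
- move=> i x Ux; apply: is_derive_chain; first exact: Ck_derive hf Ux.
  by apply: (Ck_derive tt hF); exact: UW.
- move=> i; apply: Ck_mul => //; last exact: CkD.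
  apply: (IH ('D_1 F)) => //; last exact: CkW.
  exact: (CkD tt hF).
Qed.

End Ck_comp.

Section smooth_on_Ck.
Context {R : realType} {n : nat}.
Local Notation ee := (fun i : 'I_n => delta_mx ord0 i : 'rV[R]_n).

Lemma partialsS (s : seq 'I_n) i (f : 'rV[R]_n -> R) :
  partials (rcons s i) f = partials s (partial i f).
Proof. by rewrite /partials foldr_rcons. Qed.

(** The bridge to iterated partial derivatives listed by sequences: [partials]
    applies the last index of the sequence first, as [Ck] does. *)
Lemma smooth_onP (U : set 'rV[R]_n) (f : 'rV[R]_n -> R) :
  smooth_on U f <-> Coo ee U f.
Proof.
split.
- move=> + k; elim: k f => [|k IH] f hf.
    by split=> // x Ux; case: (hf [::] x Ux).
  split=> [x Ux|i]; first by case: (hf [::] x Ux).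
  split=> [x Ux|]; first by have [_] := hf [::] x Ux; exact.
  by apply: IH => s x Ux; rewrite -[partials s _]partialsS; exact: hf.
- move=> hf s x Ux; move: hf; elim/last_ind: s f => [|s i IH] f hf.
    by split=> [|i]; [exact: Ck_cont (hf 0%N) Ux|case: (Ck_derive i (hf 1%N) Ux)].
  rewrite partialsS; apply: IH => k; exact: CkD (hf k.+1).
Qed.

End smooth_on_Ck.

(** * Borel structure of R^n *)

Section borel_rV.
Context {R : realType} {n : nat}.
Implicit Types (x y : 'rV[R]_n) (U : set 'rV[R]_n).

(** The norm is the sup norm: balls are open cubes, which suit the product
    sigma-algebra and the product measure. *)
Lemma ball_rVP x e y : 0 < e ->
  ball x e y <-> forall i, `|x ord0 i - y ord0 i| < e.
Proof.
move=> e0; split=> [[_ xy] i|xy]; first exact: xy.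
by split=> // i j; rewrite (ord1 i); exact: xy.
Qed.

Lemma ball_rVE x e : 0 < e ->
  ball x e = \bigcap_(i in [set: 'I_n]) (@coord_rV R n i @^-1` ball (x ord0 i) e).
Proof.
move=> e0; apply/seteqP; split => y.
  by move=> /(ball_rVP _ _ e0) xy i _; exact: xy.
by move=> xy; apply/(ball_rVP _ _ e0) => i; exact: xy.
Qed.

Lemma measurable_ball_rV x e : measurable (ball x e).
Proof.
have [e0|e0] := ltP 0 e; last first.
  rewrite [X in measurable X](_ : _ = set0) //.
  by apply/seteqP; split=> // y [e1 _]; move: (lt_le_trans e1 e0); rewrite ltxx.
rewrite ball_rVE //; apply: fin_bigcap_measurable => // i _.
rewrite -[X in measurable X]setTI; apply: measurable_coord_rV => //.
exact: measurable_ball.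
Qed.

(** The cubes with rational centre and side form a countable basis. *)
Lemma open_measurable_rV U : open U -> measurable U.
Proof.
move=> oU; pose ratx (q : 'rV[rat]_n) : 'rV[R]_n := \row_i ratr (q ord0 i).
pose F (p : 'rV[rat]_n * rat) :=
  if asbool (ball (ratx p.1) (ratr p.2) `<=` U) then ball (ratx p.1) (ratr p.2)
  else set0 : set 'rV[R]_n.
rewrite [X in measurable X](_ : _ = \bigcup_p F p); last first.
  apply/seteqP; split => x; last first.
    case=> p _.
    by rewrite /F; case: asboolP => // + xp; exact.
  move=> Ux.
  have /nbhs_ballP[e /= e0 xeU] : nbhs x U by apply: open_nbhs_nbhs.
  have e2 : 0 < e / 2 by rewrite divr_gt0.
  have [r] := rat_in_itvoo e2.
  rewrite in_itv /= => /andP[r0 re].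
  have qx i : {q : rat | `|ratr q - x ord0 i| < ratr r}.
    apply: cid.
    have xr : x ord0 i - ratr r < x ord0 i + ratr r by lra.
    have [q] := rat_in_itvoo xr.
    by rewrite in_itv /= => qx; exists q; rewrite ltr_norml; lra.
  pose q : 'rV[rat]_n := \row_i sval (qx i).
  have qE i : `|ratx q ord0 i - x ord0 i| < ratr r.
    by rewrite !mxE; case: (qx i).
  exists (q, r) => //; rewrite /F; case: asboolP => [_|[]] /=.
    exact/ball_rVP.
  move=> y /ball_rVP-/(_ r0) qy; apply: xeU; apply/ball_rVP => // i.
  have := qE i; have := qy i; rewrite !ltr_norml; lra.
apply: countable_bigcupT_measurable; first exact: countableP.
by move=> p; rewrite /F; case: ifP => _ //; exact: measurable_ball_rV.
Qed.

Lemma closed_measurable_rV U : closed U -> measurable U.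
Proof.
by move=> cU; rewrite -[U]setCK; apply: measurableC; apply: open_measurable_rV; exact: closed_openC.
Qed.

Lemma measurable_set1_rV x : measurable [set x].
Proof. by apply: closed_measurable_rV; apply: accessible_closed_set1; apply: hausdorff_accessible; exact: norm_hausdorff. Qed.

Lemma measurable_fun_open (U : set 'rV[R]_n) (f : 'rV[R]_n -> R) : open U ->
  (forall x, U x -> {for x, continuous f}) -> measurable_fun U f.
Proof.
move=> oU cf mU; apply: (measurability _ (RGenOpens.measurableE R)) => //.
move=> _ [_ [a [b ->] <-]].
apply: open_measurable_rV; rewrite openE => x [Ux fx].
near=> y; split; first by near: y; exact: open_nbhs_nbhs.
near: y; apply: (cf x Ux); apply: open_nbhs_nbhs; split=> //.

Unshelve. all: end_near. Qed.

Lemma continuous_measurable_rV (f : 'rV[R]_n -> R) :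
  continuous f -> measurable_fun setT f.
Proof. by move=> cf; apply: measurable_fun_open => [|x _]; [exact: openT|exact: cf]. Qed.

(** Whatever is built from the fundamental solution with pole [x0] is
    continuous off [x0] only; one point does not affect measurability. *)
Lemma measurable_fun_off (x0 : 'rV[R]_n) (f : 'rV[R]_n -> R) :
  (forall x, x != x0 -> {for x, continuous f}) -> measurable_fun setT f.
Proof.
move=> cf; rewrite -(setvU [set x0]); apply/measurable_funU.
- by apply: measurableC; exact: measurable_set1_rV.
- exact: measurable_set1_rV.
split; last exact: measurable_fun_set1.
apply: measurable_fun_open => [|x /eqP]; last exact: cf.
apply: closed_openC; apply: accessible_closed_set1.
by apply: hausdorff_accessible; exact: norm_hausdorff.
Qed.

End borel_rV.

(** * Lebesgue measure of cubes, points and open sets *)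

Section lebesgue_rV_properties.
Context {R : realType}.
Local Notation mu := (@lebesgue_measure R).

Definition tl_rV n (x : 'rV[R]_n.+1) : 'rV[R]_n := \row_i x ord0 (lift ord0 i).

Lemma cons_rV0 n (p : 'rV[R]_n * measurableTypeR R) : cons_rV p ord0 ord0 = p.2.
Proof.
have -> : (ord0 : 'I_n.+1) = lshift n (ord0 : 'I_1) by apply/val_inj.
by rewrite /cons_rV; apply: etrans (row_mxEl _ _ _ _) _; rewrite !mxE eqxx mulr1n.
Qed.

Lemma cons_rVS n (p : 'rV[R]_n * measurableTypeR R) i :
  cons_rV p ord0 (lift ord0 i) = p.1 ord0 i.
Proof.
have -> : lift (ord0 : 'I_n.+1) i = rshift 1 i by apply/val_inj.
by rewrite /cons_rV; apply: etrans (row_mxEr _ _ _ _) _.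
Qed.

Lemma cons_rV_eta n (x : 'rV[R]_n.+1) : cons_rV (tl_rV x, x ord0 ord0) = x.
Proof.
apply/rowP => i; have [j ->|->] := unliftP ord0 i.
  by rewrite cons_rVS mxE.
by rewrite cons_rV0.
Qed.

Lemma ball_cons_rV n (x : 'rV[R]_n.+1) e : 0 < e ->
  @cons_rV R n @^-1` ball x e = ball (tl_rV x) e `*` ball (x ord0 ord0) e.
Proof.
move=> e0; apply/seteqP; split => -[p t] /=.
  move/(ball_rVP _ _ e0) => H; split.
    by apply/(ball_rVP _ _ e0) => i; have := H (lift ord0 i); rewrite cons_rVS !mxE.
  by have := H ord0; rewrite cons_rV0.
move=> [/(ball_rVP _ _ e0) Hp Ht]; apply/(ball_rVP _ _ e0) => i.
have [j ->|->] := unliftP ord0 i.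
  by rewrite cons_rVS; have := Hp j; rewrite mxE.
by rewrite cons_rV0.
Qed.

(** By induction on the dimension, a cube being the product of a cube and an
    interval. *)
Lemma lebesgue_rV_ball n (x : 'rV[R]_n) e : 0 < e ->
  (0 < lebesgue_rV n (ball x e) < +oo)%E.
Proof.
move=> e0; elim: n x => [|n IH] x.
  have -> : ball x e = setT.
    by apply/seteqP; split => // y _; apply/(ball_rVP _ _ e0) => -[].
  by rewrite /lebesgue_rV /= diracT lte01 ltry.
rewrite /lebesgue_rV /= /lebesgue_cons /pushforward ball_cons_rV //.
rewrite (product_measure1E (lebesgue_rV_rec n) mu); last 2 first.
- exact: measurable_ball_rV.
- exact: measurable_ball.
have /andP[I1 I2] := IH (tl_rV x).
rewrite [X in (_ * X)%E]lebesgue_measure_ball; last exact: ltW.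
apply/andP; split; first by apply: mule_gt0 => //; rewrite lte_fin mulrn_wgt0.
have fI : lebesgue_rV_rec n (ball (tl_rV x) e) \is a fin_num.
  by rewrite ge0_fin_numE.
by rewrite -(fineK fI) -EFinM ltry.
Qed.

Lemma sigma_finite_lebesgue_rV n : sigma_finite setT (@lebesgue_rV R n).
Proof.
exists (fun k => ball (0 : 'rV[R]_n) k.+1%:R).
  apply/esym/seteqP; split => // x _.
  exists (Num.truncn `|x|) => //=.
  by rewrite -ball_normE /= sub0r normrN truncnS_gt.
move=> k; split; first exact: measurable_ball_rV.
by have /andP[] := lebesgue_rV_ball (0 : 'rV[R]_n) (ltr0Sn R k).
Qed.

HB.instance Definition _ n := Measure_isSigmaFinite.Build _ _ _
  (@lebesgue_rV R n) (@sigma_finite_lebesgue_rV n).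

Lemma lebesgue_rVS n (B : set 'rV[R]_n.+1) :
  lebesgue_rV n.+1 B = (lebesgue_rV n \x mu)%E (@cons_rV R n @^-1` B).
Proof. by []. Qed.

Lemma lebesgue_rV_set1 n (x : 'rV[R]_n.+1) : lebesgue_rV n.+1 [set x] = 0%E.
Proof.
rewrite lebesgue_rVS.
have -> : @cons_rV R n @^-1` [set x] = [set tl_rV x] `*` [set x ord0 ord0].
  apply/seteqP; split => -[p t] /=.
    move=> <-; rewrite cons_rV0; split=> //.
    by apply/rowP => i; rewrite mxE cons_rVS.
  by move=> [-> ->]; rewrite cons_rV_eta.
rewrite (product_measure1E (lebesgue_rV n) mu).
- by rewrite [X in (_ * X)%E]lebesgue_measure_set1 mule0.
- exact: measurable_set1_rV.
- exact: measurable_set1.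
Qed.

Lemma lebesgue_rV_open n (U : set 'rV[R]_n) : open U -> U !=set0 ->
  (0 < lebesgue_rV n U)%E.
Proof.
move=> oU [x Ux].
have /nbhs_ballP[e /= e0 xeU] : nbhs x U by apply: open_nbhs_nbhs.
have /andP[h _] := lebesgue_rV_ball x e0.
apply: lt_le_trans h _; apply: le_measure; rewrite ?inE //.
  exact: measurable_ball_rV.
exact: open_measurable_rV.
Qed.

Lemma lebesgue_rV_bounded n (B : set 'rV[R]_n) (M : R) : measurable B ->
  (forall x, B x -> `|x| <= M) -> (lebesgue_rV n B < +oo)%E.
Proof.
move=> mB BM; have M0 : 0 < `|M| + 1 by rewrite ltr_wpDl.
have /andP[_] := lebesgue_rV_ball (0 : 'rV[R]_n) M0.
apply: le_lt_trans; apply: le_measure; rewrite ?inE //.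
  exact: measurable_ball_rV.
move=> x /BM xM; rewrite -ball_normE /= sub0r normrN.
by apply: le_lt_trans xM _; rewrite (le_lt_trans (ler_norm M)) // ltrDl.
Qed.

Lemma integrable_bounded n (B : set 'rV[R]_n) (M C : R) (f : 'rV[R]_n -> R) :
  measurable B -> (forall x, B x -> `|x| <= M) -> measurable_fun B f ->
  (forall x, B x -> `|f x| <= C) ->
  (lebesgue_rV n).-integrable B (EFin \o f).
Proof.
move=> mB BM mf fC; apply: measurable_bounded_integrable => //.
  exact: lebesgue_rV_bounded BM.
by exists C; split; [exact: num_real|move=> c Cc x /fC; move/le_trans; apply; exact: ltW].
Qed.

End lebesgue_rV_properties.

(** * Integrals of partial derivatives *)

Section integrate_derivatives.
Context {R : realType}.
Local Notation mu := (@lebesgue_measure R).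

Lemma norm_rV_coord n (x : 'rV[R]_n) i : `|x ord0 i| <= `|x|.
Proof.
apply/ler_addgt0Pr => e e0.
have xe : ball (0 : 'rV[R]_n) (`|x| + e) x.
  by rewrite -ball_normE /= sub0r normrN ltrDl.
have xe0 : 0 < `|x| + e by rewrite ltr_wpDl.
by move/(ball_rVP _ _ xe0) : xe => /(_ i); rewrite mxE sub0r normrN => /ltW.
Qed.

Lemma cons_rV_continuous1 n (t : R) :
  continuous (fun p : 'rV[R]_n => cons_rV (p, t)).
Proof.
move=> p; apply/(@cvgrPdist_lt _ _ _ (nbhs p) (nbhs_filter p)) => e e0.
apply: filterS (nbhsx_ballx p e e0) => q pq.
have : ball (cons_rV (p, t)) e (cons_rV (q, t)).
  apply/(ball_rVP _ _ e0) => i; have [j ->|->] := unliftP ord0 i.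
    rewrite !cons_rVS /=; move: j; exact/(ball_rVP _ _ e0).
  by rewrite !cons_rV0 subrr normr0.
by rewrite -ball_normE.
Qed.

Lemma cons_rV_continuous2 n (p : 'rV[R]_n) :
  continuous (fun t : R => cons_rV (p, t)).
Proof.
move=> t; apply/cvgrPdist_lt => e e0.
apply: filterS (@nbhsx_ballx _ R^o t e e0) => s ts.
have : ball (cons_rV (p, t)) e (cons_rV (p, s)).
  apply/(ball_rVP _ _ e0) => i; have [j ->|->] := unliftP ord0 i.
    by rewrite !cons_rVS subrr normr0.
  by rewrite !cons_rV0.
by rewrite -ball_normE.
Qed.

Lemma cons_rV_shift0 n (p : 'rV[R]_n) (t h : R) :
  h *: delta_mx ord0 ord0 + cons_rV (p, t) = cons_rV (p, h + t).
Proof.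
apply/rowP => i; rewrite [LHS]mxE [X in X + _]mxE [X in _ * X + _]mxE; have [j ->|->] := unliftP ord0 i.
  by rewrite !cons_rVS /= mulr0 add0r.
by rewrite !cons_rV0 /= mulr1.
Qed.

Lemma cons_rV_shiftS n (p : 'rV[R]_n) (t h : R) j :
  h *: delta_mx ord0 (lift ord0 j) + cons_rV (p, t) =
  cons_rV (h *: delta_mx ord0 j + p, t).
Proof.
apply/rowP => i; rewrite [LHS]mxE [X in X + _]mxE [X in _ * X + _]mxE; have [k ->|->] := unliftP ord0 i.
  by rewrite !cons_rVS /= !mxE /= (inj_eq lift_inj).
by rewrite !cons_rV0 /= mulr0 add0r.
Qed.

Lemma is_derive_supp n (phi g : 'rV[R]_n -> R) v (M : R) :
  (forall x, is_derive x v phi (g x)) -> (forall x, M < `|x| -> phi x = 0) ->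
  forall x, M < `|x| -> g x = 0.
Proof.
move=> dg phi0 x Mx.
suff [_ <-] : is_derive x v phi 0 by case: (dg x) => _ ->.
apply: is_derive_near (is_derive_const 0 x v).
near=> y; apply/esym/phi0; near: y.
apply: (cvgr_gt `|x|) => //; exact: norm_continuous.
Unshelve. all: end_near. Qed.

Lemma continuous_bounded_on n (K : set 'rV[R]_n) (f : 'rV[R]_n -> R) :
  compact K -> {within K, continuous f} ->
  exists2 C, 0 < C & forall x, K x -> `|f x| <= C.
Proof.
move=> cK cf; have /compact_bounded[C [_ HC]] := continuous_compact cf cK.
exists (`|C| + 1) => [|x Kx]; first by rewrite ltr_wpDl.
by apply: HC; [rewrite (le_lt_trans (ler_norm C)) // ltrDl|exists x].
Qed.

Lemma compact_norm_le n (M : R) : compact [set x : 'rV[R]_n | `|x| <= M].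
Proof.
apply: bounded_closed_compact.
  by exists M; split; [exact: num_real|move=> c Mc x /= xM; exact: le_trans (ltW Mc)].
rewrite [X in closed X](_ : _ = (fun x : 'rV[R]_n => `|x|) @^-1` [set r | r <= M]) //.
apply: closed_comp => [x _|]; first exact: norm_continuous.
exact: closed_le.
Qed.

Lemma integrable_supp d (T : measurableType d)
  (m : {measure set T -> \bar R}) (B : set T) (f : T -> R) : measurable B ->
  (forall x, ~ B x -> f x = 0) -> m.-integrable B (EFin \o f) ->
  m.-integrable setT (EFin \o f).
Proof.
move=> mB f0 /(integrable_mkcond _ mB); congr (_.-integrable _ _).
apply/funext => x; rewrite patchE; case: ifPn => //=.
by rewrite notin_setE => /f0 ->.
Qed.

Lemma integral_supp d (T : measurableType d)
  (m : {measure set T -> \bar R}) (B : set T) (f : T -> \bar R) : measurable B ->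
  (forall x, ~ B x -> f x = 0%E) ->
  (\int[m]_x f x = \int[m]_(x in B) f x)%E.
Proof.
move=> mB f0; rewrite [RHS]integral_mkcond; apply: eq_integral => x _.
by rewrite patchE; case: ifPn => //; rewrite notin_setE => /f0.
Qed.

Lemma integrable_continuous_supp n (f : 'rV[R]_n -> R) (M : R) :
  continuous f -> (forall x, M < `|x| -> f x = 0) ->
  (lebesgue_rV n).-integrable setT (EFin \o f).
Proof.
move=> cf f0; set B := [set x : 'rV[R]_n | `|x| <= M].
have cB : compact B := @compact_norm_le n M.
have [||C _ fC] := @continuous_bounded_on _ B f => //.
  exact: continuous_subspaceT.
have mB : measurable B.
  by apply: closed_measurable_rV; apply: compact_closed cB; exact: norm_hausdorff.
apply: (integrable_supp mB) => [x|].
  by move/negP; rewrite -ltNge; exact: f0.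
apply: (integrable_bounded (M := M) (C := C)) => //.
by apply: measurable_funTS; exact: continuous_measurable_rV.
Qed.

Lemma integral_derivative_R (phi g : R -> R) (M : R) :
  (forall t : R, is_derive t 1 phi (g t)) -> continuous g ->
  (forall t, M < `|t| -> phi t = 0) ->
  (forall t, M < `|t| -> g t = 0) ->
  (\int[mu]_t (g t)%:E = 0)%E.
Proof.
move=> dphi cg phi0 g0; set N := `|M| + 1.
have MN : M < N by rewrite (le_lt_trans (ler_norm M)) // ltrDl.
have N0 : 0 < N by rewrite ltr_wpDl.
have NN : - N < N by rewrite gtrN.
rewrite (@integral_supp _ _ mu `[- N, N]%classic) //; last first.
  move=> t /= tN; rewrite g0 //; apply: lt_le_trans MN _.
  rewrite leNgt; apply/negP => tN'; apply: tN.
  by rewrite /= in_itv /= -ler_norml ltW.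
have cphi : continuous phi.
  by move=> t; apply/differentiable_continuous/derivable1_diffP; case: (dphi t).
rewrite (@continuous_FTC2 _ g phi) //.
- by rewrite !phi0 ?subee // ?normrN (gtr0_norm N0).
- exact: continuous_subspaceT.
- split.
  + by move=> t _; case: (dphi t).
  + by apply: cvg_at_right_filter; exact: cphi.
  + by apply: cvg_at_left_filter; exact: cphi.
- by move=> t _; rewrite derive1E; case: (dphi t).
Qed.

Lemma integrable_cons n (f : 'rV[R]_n.+1 -> R) :
  (lebesgue_rV n.+1).-integrable setT (EFin \o f) ->
  (lebesgue_rV n \x mu)%E.-integrable setT (EFin \o (f \o @cons_rV R n)).
Proof.
move=> /integrableP[mf fi]; have mc := @measurable_cons_rV R n.
apply/integrableP; split; first exact: measurableT_comp mf mc.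
move: fi; rewrite (_ : lebesgue_rV n.+1 =
  pushforward (lebesgue_rV n \x mu)%E (@cons_rV R n)) //.
rewrite ge0_integral_pushforward //.
by apply: measurableT_comp => //.
Qed.

Lemma integral_cons n (f : 'rV[R]_n.+1 -> R) :
  (lebesgue_rV n.+1).-integrable setT (EFin \o f) ->
  (\int[lebesgue_rV n.+1]_x (f x)%:E =
   \int[lebesgue_rV n \x mu]_z (f (cons_rV z))%:E)%E.
Proof.
move=> fi; have mc := @measurable_cons_rV R n.
rewrite (_ : lebesgue_rV n.+1 =
  pushforward (lebesgue_rV n \x mu)%E (@cons_rV R n)) //.
rewrite (integral_pushforward mc) //.
- by case/integrableP : fi.
- exact: integrable_cons.
Qed.

(** By induction on the dimension: the coordinate in which one differentiates
    is integrated out first, which Fubini allows. *)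
Lemma integral_partial0 n (i : 'I_n) (phi g : 'rV[R]_n -> R) (M : R) :
  (forall x, is_derive x (delta_mx ord0 i : 'rV[R]_n) phi (g x)) ->
  continuous g -> (forall x, M < `|x| -> phi x = 0) ->
  (\int[lebesgue_rV n]_x (g x)%:E = 0)%E.
Proof.
elim: n i phi g => [[]//|n IH] i phi g dphi cg phi0.
have g0 := is_derive_supp dphi phi0.
have gi := integrable_continuous_supp cg g0.
have gic := integrable_cons gi.
rewrite integral_cons //; have [j ij|i0] := unliftP ord0 i.
- rewrite -(integral12_prod_meas1 gic) [LHS](Fubini gic) /=.
  rewrite integral0_eq // => t _.
  apply: (IH j (fun p => phi (cons_rV (p, t)))).
  + move=> p; apply/is_derive_restr.
    have /is_derive_restr := dphi (cons_rV (p, t)).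
    rewrite ij; congr is_derive; apply/funext => h.
    by rewrite cons_rV_shiftS.
  + move=> p; apply: continuous_comp; first exact: cons_rV_continuous1.
    exact: cg.
  + move=> p Mp; apply: phi0; apply: lt_le_trans Mp _.
    rewrite leNgt; apply/negP => lt.
    have c0 : 0 < `|p| by exact: le_lt_trans lt.
    suff : ball (0 : 'rV[R]_n) `|p| p by rewrite -ball_normE /= sub0r normrN ltxx.
    apply/(ball_rVP _ _ c0) => k; rewrite mxE sub0r normrN.
    apply: le_lt_trans lt.
    by have := norm_rV_coord (cons_rV (p, t)) (lift ord0 k); rewrite cons_rVS.
- rewrite -(integral12_prod_meas1 gic) integral0_eq // => p _.
  have le t : `|t| <= `|cons_rV (p, t)|.
    by have := norm_rV_coord (cons_rV (p, t)) ord0; rewrite cons_rV0.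
  apply: (@integral_derivative_R (fun t => phi (cons_rV (p, t)))
    (fun t => g (cons_rV (p, t))) M).
  + move=> t; apply/is_derive_restr.
    have /is_derive_restr := dphi (cons_rV (p, t)).
    rewrite i0; congr is_derive; apply/funext => h.
    by rewrite cons_rV_shift0 [(h *: 1)%R]mulr1.
  + by move=> t; apply: (@continuous_comp _ _ _ (fun t : R => cons_rV (p, t)) g);
      [exact: cons_rV_continuous2|exact: cg].
  + by move=> t Mt; apply: phi0; exact: lt_le_trans (le t).
  + by move=> t Mt; apply: g0; exact: lt_le_trans (le t).
Qed.

End integrate_derivatives.

(** * A smooth function flat at the origin *)

Section flat_function.
Context {R : realType}.
Implicit Types t : R.

(** The functions [t^-j exp(-1/t)] span a space that is closed under
    differentiation, and all of them are O(t^2) at the origin: this makes each of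
    them smooth. *)
Definition flat (j : nat) t : R :=
  if 0 < t then t^-1 ^+ j * expR (- t^-1) else 0.

Lemma is_derive_quadratic (f : R -> R) (C : R) :
  (forall h, `|f h| <= C * h ^+ 2) -> is_derive (0 : R) 1 f 0.
Proof.
move=> fC; have f0 : f 0 = 0.
  by apply/eqP; rewrite -normr_le0; have := fC 0; rewrite expr0n mulr0.
have C0 : 0 <= C by have := fC 1; rewrite expr1n mulr1; exact: le_trans.
suff H : (fun h : R => h^-1 *: ((f \o shift (0 : R)) (h *: (1 : R)) - f 0)) @ 0^' --> (0 : R).
  apply: DeriveDef; first by apply/cvg_ex; exists 0.
  by apply/cvg_lim.
apply/cvgr0Pnorm_le => e e0; have C1 : 0 < C + 1 by rewrite ltr_wpDl.
have d0 : 0 < e / (C + 1) by rewrite divr_gt0.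
near=> h; rewrite /= f0 subr0 addr0 [h *: _]mulr1 normrZ normfV.
have h0 : h != 0 by near: h; exact: nbhs_dnbhs_neq.
have hd : `|h| <= e / (C + 1).
  by near: h; exact: (@dnbhs0_le _ R^o).
rewrite ler_pdivrMl ?normr_gt0 //; apply: le_trans (fC h) _.
rewrite -real_normK ?num_real // expr2 mulrA [leRHS]mulrC.
rewrite ler_wpM2r // (le_trans (ler_wpM2l C0 hd)) //.
by rewrite mulrA ler_pdivrMr //; nra.
Unshelve. all: end_near. Qed.

(** A lower bound of [exp(1/t)] by one term of its power series. *)
Lemma flat_le j t : `|flat j t| <= (j.+2)`!%:R * t ^+ 2.
Proof.
rewrite /flat; case: ifPn => [t0|_]; last by rewrite normr0 mulr_ge0 ?sqr_ge0.
have x0 : 0 < t^-1 by rewrite invr_gt0.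
have x1 := ltW x0; rewrite ger0_norm ?mulr_ge0 ?exprn_ge0 ?expR_ge0 //.
rewrite expRN ler_pdivrMr ?expR_gt0 //.
have := expR_ge1Dxn j.+1 (ltW x0).
have F0 : 0 < (j.+2)`!%:R :> R by rewrite ltr0n fact_gt0.
move=> H; rewrite -mulrA -ler_pdivrMl // mulrC.
apply: le_trans (_ : t ^+ 2 * (t^-1 ^+ j.+2 / (j.+2)`!%:R) <= _).
  rewrite mulrA [t ^+ 2 * _](_ : _ = t^-1 ^+ j) // -(addn2 j) exprD mulrCA -exprMn.
  by rewrite divff ?gt_eqF // expr1n mulr1.
rewrite ler_wpM2l ?sqr_ge0 //; apply: le_trans H; lra.
Qed.

Lemma is_derive_flat j t :
  is_derive t 1 (flat j) (flat j.+2 t - j%:R * flat j.+1 t).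
Proof.
have [t0|t0|<-] := ltgtP 0 t.
- have near_t : \forall s \near t, s^-1 ^+ j * expR (- s^-1) = flat j s.
    near=> s; rewrite /flat ifT //; near: s; exact: lt_nbhsr.
  apply: is_derive_near near_t _; rewrite /flat t0.
  have d1 : is_derive t 1 (fun s : R => s^-1) (- t ^- 2).
    by have := @is_deriveV R id t 1 1 _ _; rewrite [_ *: 1]mulr1; apply; rewrite gt_eqF.
  have d2 : is_derive t 1 (fun s : R => s^-1 ^+ j) (j%:R * t^-1 ^+ j.-1 * - t ^- 2).
    have -> : (fun s : R => s^-1 ^+ j) = (fun s : R => s^-1) ^+ j.
      by apply/funext => s; rewrite exprfctE.
    exact: (@is_deriveX R R^o (fun s : R => s^-1) j t 1 _ d1).
  have d3 : is_derive t 1 (fun s : R => expR (- s^-1)) (expR (- t^-1) * t ^- 2).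
    have d4 : is_derive t 1 (fun s : R => - s^-1) (t ^- 2).
      by have := is_deriveN d1; rewrite opprK.
    exact: (is_derive_chain (F := expR) d4 (is_derive_expR _)).
  have := is_derive_mul d2 d3; congr is_derive.
  have -> : t ^- 2 = t^-1 ^+ 2 by rewrite exprVn.
  by move: (t^-1) (expR _) => w e; case: j {d2} => [|j] /=; rewrite !exprS; ring.
- apply: (is_derive_near (f := fun=> 0)).
    near=> s; rewrite /flat ifN // -leNgt; apply: ltW; near: s; exact: lt_nbhsl.
  have f0 k : flat k t = 0 by rewrite /flat ifN // -leNgt ltW.
  by rewrite !f0 mulr0 subr0; exact: is_derive_const.
- rewrite /flat ltxx mulr0 subr0; exact: is_derive_quadratic (flat_le j).
Unshelve. all: end_near. Qed.

Lemma flat_continuous j : continuous (flat j).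
Proof.
move=> t; apply/differentiable_continuous/derivable1_diffP.
by case: (is_derive_flat j t).
Qed.

Lemma flat_Coo : Coo1 setT (flat 0).
Proof.
move=> k; elim: k 0%N => [|k IH] j; first by split => // t _; exact: flat_continuous.
apply: (CkS_intro (g := fun _ t => flat j.+2 t + (- j%:R) * flat j.+1 t)).
- exact: openT.
- by move=> t _; exact: flat_continuous.
- by move=> i t _; rewrite mulNr; exact: is_derive_flat.
- move=> i; apply: Ck_add => //; first exact: openT.
  apply: Ck_mul => //; first exact: openT.
  by apply: Ck_cst; exact: openT.
Qed.

Definition flat0 := flat 0.

Lemma flat0E t : flat0 t = if 0 < t then expR (- t^-1) else 0.
Proof. by rewrite /flat0 /flat expr0 mul1r. Qed.

Lemma flat0_ge0 t : 0 <= flat0 t.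
Proof. by rewrite flat0E; case: ifP => // _; exact: expR_ge0. Qed.

Lemma flat0_gt0 t : 0 < t -> 0 < flat0 t.
Proof. by move=> t0; rewrite flat0E t0 expR_gt0. Qed.

Lemma flat0_le0 t : t <= 0 -> flat0 t = 0.
Proof. by move=> t0; rewrite flat0E ltNge t0. Qed.

Lemma flat0_mono s t : s <= t -> flat0 s <= flat0 t.
Proof.
move=> st; have [s0|s0] := leP s 0; first by rewrite flat0_le0 ?flat0_ge0.
have t0 := lt_le_trans s0 st.
by rewrite !flat0E s0 t0 ler_expR lerN2 lef_pV2 ?posrE.
Qed.

Lemma is_derive_flat0 t : 0 < t ->
  is_derive t 1 flat0 (t ^- 2 * expR (- t^-1)).
Proof.
by move=> t0; have := is_derive_flat 0 t; rewrite mul0r subr0 /flat t0 exprVn.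
Qed.

Lemma flat0_cvg1 : flat0 t @[t --> +oo] --> (1 : R).
Proof.
have H : expR (- t^-1) @[t --> +oo%R] --> (1 : R).
  rewrite -[X in _ --> X]expR0; apply: continuous_cvg; first exact: continuous_expR.
  rewrite -oppr0; apply: cvgN.
  have /gtr0_cvgV0[_] : \forall t \near +oo%R, 0 < (t : R).
    exact: nbhs_pinfty_gt.
  by apply; exact: cvg_id.
apply: cvg_trans H; apply: near_eq_cvg; near=> t.
by rewrite flat0E ifT //; near: t; exact: nbhs_pinfty_gt.
Unshelve. all: end_near. Qed.

End flat_function.

(** * Bump functions and test functions *)

Notation ee := (fun i => delta_mx ord0 i).

Lemma is_derive_ext (R : realType) (V : normedModType R) (f g : V -> R)
  (x v : V) df : f =1 g -> is_derive x v f df -> is_derive x v g df.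
Proof. by move=> /funext ->. Qed.

Lemma is_derive_bigsum (R : realType) (V : normedModType R) (J : Type) (s : seq J)
  (F : J -> V -> R) (dF : J -> R) (x v : V) :
  (forall j, is_derive x v (F j) (dF j)) ->
  is_derive x v (fun y => \sum_(j <- s) F j y) (\sum_(j <- s) dF j).
Proof.
move=> H; elim: s => [|j s IH].
  rewrite big_nil; apply: is_derive_ext (is_derive_const 0 x v).
  by move=> y; rewrite big_nil.
rewrite big_cons; apply: is_derive_ext (is_derive_add (H j) IH).
by move=> y; rewrite big_cons.
Qed.

Section coordinate_calculus.
Context {R : realType} {n : nat}.
Implicit Types (x y : 'rV[R]_n) (U K : set 'rV[R]_n) (f g u w : 'rV[R]_n -> R).

Lemma partialE i f x df :
  is_derive x (delta_mx ord0 i : 'rV[R]_n) f df -> partial i f x = df.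
Proof. by case. Qed.

Lemma Ck_partial k U f x i : Ck ee k.+1 U f -> U x ->
  is_derive x (delta_mx ord0 i : 'rV[R]_n) f (partial i f x).
Proof. exact: Ck_derive. Qed.

Lemma CkP k U f i : Ck ee k.+1 U f -> Ck ee k U (partial i f).
Proof. exact: CkD. Qed.

Lemma is_derive_coord i j x :
  is_derive x (delta_mx ord0 i : 'rV[R]_n) (fun y => y ord0 j) (i == j)%:R.
Proof.
apply/is_derive_restr.
apply: (is_derive_ext (f := fun h : R => h * (i == j)%:R + x ord0 j)).
  by move=> h; rewrite [RHS]mxE [X in _ = X + _]mxE [X in _ = _ * X + _]mxE eqxx eq_sym.
have := is_derive_add (is_derive_mul (is_derive_id (0 : R) (1 : R))
  (is_derive_const (i == j)%:R (0 : R) (1 : R))) (is_derive_const (x ord0 j) (0 : R) (1 : R)).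
by rewrite mul1r mulr0 !addr0.
Qed.

Lemma Coo_coord j : Coo ee setT (fun y : 'rV[R]_n => y ord0 j).
Proof.
move=> [|k]; first by split=> // x _; exact: coord_continuous.
apply: (CkS_intro (g := fun i _ => (i == j)%:R)).
- exact: openT.
- by move=> x _; exact: coord_continuous.
- by move=> i x _; exact: is_derive_coord.
- by move=> i; apply: Ck_cst; exact: openT.
Qed.

(** The Euclidean distance, unlike the one given by the norm, has a smooth
    square. *)
Definition sqdist (x0 y : 'rV[R]_n) : R := \sum_i (y ord0 i - x0 ord0 i) ^+ 2.

Lemma is_derive_sqdist i x0 x :
  is_derive x (delta_mx ord0 i : 'rV[R]_n) (sqdist x0) (2 * (x ord0 i - x0 ord0 i)).
Proof.
have H j : is_derive x (delta_mx ord0 i : 'rV[R]_n)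
    (fun y => (y ord0 j - x0 ord0 j) ^+ 2)
    (2 * (x ord0 j - x0 ord0 j) * (i == j)%:R).
  have d1 : is_derive x (delta_mx ord0 i : 'rV[R]_n) (fun y => y ord0 j - x0 ord0 j) (i == j)%:R.
    by have := is_derive_add (is_derive_coord i j x)
      (is_derive_const (- x0 ord0 j) x (delta_mx ord0 i)); rewrite addr0.
  have -> : 2 * (x ord0 j - x0 ord0 j) * (i == j)%:R =
    (i == j)%:R * (x ord0 j - x0 ord0 j) + (x ord0 j - x0 ord0 j) * (i == j)%:R.
    by ring.
  apply: is_derive_ext (is_derive_mul d1 d1).
  by move=> y; rewrite expr2.
have := is_derive_bigsum (index_enum 'I_n) H.
rewrite (bigD1 i) //= eqxx mulr1 big1 ?addr0 // => j; rewrite eq_sym => /negbTE ->.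
by rewrite mulr0.
Qed.

Lemma Coo_sqdist x0 : Coo ee setT (sqdist x0).
Proof.
move=> k; apply: Ck_sum; first exact: openT.
move=> j; apply: (Ck_eq openT (f := fun y : 'rV[R]_n =>
  (y ord0 j + - x0 ord0 j) * (y ord0 j + - x0 ord0 j))).
  by move=> y _; rewrite expr2.
have H : Ck ee k setT (fun y : 'rV[R]_n => y ord0 j + - x0 ord0 j).
  by apply: Ck_add; [exact: openT|exact: Coo_coord|apply: Ck_cst; exact: openT].
by apply: Ck_mul => //; exact: openT.
Qed.

Lemma sqdist_ge0 x0 y : 0 <= sqdist x0 y.
Proof. by apply: sumr_ge0 => i _; exact: sqr_ge0. Qed.

Lemma sqdistxx x0 : sqdist x0 x0 = 0.
Proof. by rewrite /sqdist big1 // => i _; rewrite subrr expr0n. Qed.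

Lemma sqdist_ge (d : R) x0 y : 0 <= d -> d <= `|y - x0| -> d ^+ 2 <= sqdist x0 y.
Proof.
move=> d0 dy; rewrite leNgt; apply/negP => sd.
have d1 : 0 < d.
  rewrite lt_neqAle d0 andbT; apply/negP => /eqP d00.
  by move: sd; rewrite -d00 expr0n ltNge sqdist_ge0.
have : ball x0 d y.
  apply/(ball_rVP _ _ d1) => i; rewrite distrC -ltr_sqr ?nnegrE ?normr_ge0 //.
  apply: le_lt_trans sd; rewrite real_normK ?num_real // /sqdist (bigD1 i) //=.
  by rewrite lerDl sumr_ge0 // => j _; exact: sqr_ge0.
by rewrite -ball_normE /= distrC ltNge dy.
Qed.

Definition ball_bump (x0 : 'rV[R]_n) (d : R) y : R := flat0 (d ^+ 2 - sqdist x0 y).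

Lemma Coo_ball_bump x0 d : Coo ee setT (ball_bump x0 d).
Proof.
move=> k; apply: (Ck_comp openT (W := setT) _ (@flat_Coo R k)) => //.
apply: (Ck_eq openT (f := fun y : 'rV[R]_n => d ^+ 2 + (-1) * sqdist x0 y)).
  by move=> y _; rewrite mulN1r.
apply: Ck_add; [exact: openT|by apply: Ck_cst; exact: openT|].
by apply: Ck_mul; [exact: openT|apply: Ck_cst; exact: openT|exact: Coo_sqdist].
Qed.

Lemma ball_bump_ge0 x0 d y : 0 <= ball_bump x0 d y.
Proof. exact: flat0_ge0. Qed.

Lemma ball_bump_center x0 d : 0 < d -> 0 < ball_bump x0 d x0.
Proof. by move=> d0; rewrite /ball_bump sqdistxx subr0 flat0_gt0 // exprn_gt0. Qed.

Lemma ball_bump_eq0 x0 d y : 0 <= d -> d <= `|y - x0| -> ball_bump x0 d y = 0.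
Proof. by move=> d0 dy; rewrite /ball_bump flat0_le0 // subr_le0 sqdist_ge. Qed.

Lemma test_function_intro (M : R) f : Coo ee setT f ->
  (forall x, M < `|x| -> f x = 0) -> test_function setT f.
Proof.
move=> cf f0; split=> //; first exact/smooth_onP.
apply: (subclosed_compact _ (@compact_norm_le R n M)); first exact: closed_closure.
set B := [set x : 'rV[R]_n | `|x| <= M].
have cB : closed B.
  by apply: compact_closed (@compact_norm_le R n M); exact: norm_hausdorff.
have sB : [set x | f x != 0] `<=` B.
  move=> x /= fx; rewrite /B /= leNgt; apply/negP => /f0 fx0.
  by move: fx; rewrite fx0 eqxx.
by move=> x /(closure_subset sB); move/closure_id : cB => <-.
Qed.

(** Products of a test function with a function that is regular only near the
    support of it extend by zero. *)
Lemma Ck_glue k U K f : open U -> closed K -> K `<=` U -> Ck ee k U f ->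
  (forall x, ~ K x -> f x = 0) -> Ck ee k setT f.
Proof.
move=> oU cK KU cf f0.
have -> : [set: 'rV[R]_n] = U `|` ~` K.
  apply/esym/seteqP; split=> // x _; have [/KU|] := pselect (K x); first by left.
  by right.
apply: Ck_setU => //; apply: (Ck_eq (f := fun=> 0)).
- exact: closed_openC.
- by move=> x; rewrite inE => /f0 ->.
- by apply: Ck_cst; exact: closed_openC.
Qed.

Lemma partial_off K f i : closed K -> (forall x, ~ K x -> f x = 0) ->
  forall x, ~ K x -> partial i f x = 0.
Proof.
move=> cK f0 x Kx; apply: partialE.
apply: is_derive_near (is_derive_const 0 x (delta_mx ord0 i)).
near=> y; apply/esym/f0; near: y; apply: open_nbhs_nbhs; split=> //.
exact: closed_openC.
Unshelve. all: end_near. Qed.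

End coordinate_calculus.

(** * Green's formula for divergence-form operators *)

Lemma integral_add_eq0 d (T : measurableType d) (R : realType)
  (m : {measure set T -> \bar R}) (f g : T -> R) :
  m.-integrable setT (EFin \o f) -> m.-integrable setT (EFin \o g) ->
  (\int[m]_y (f y + g y)%:E = 0)%E ->
  (\int[m]_y (f y)%:E = - \int[m]_y (g y)%:E)%E.
Proof.
move=> fi gi.
have D := integralD_EFin measurableT fi gi.
have fe := integrable_fin_num measurableT fi.
have ge := integrable_fin_num measurableT gi.
move=> h0; have /esym : (\int[m]_y (f y)%:E + \int[m]_y (g y)%:E = 0)%E.
  by rewrite -h0; exact: esym D.
move: fe ge; rewrite /comp.
move: (\int[m]_y (f y)%:E)%E (\int[m]_y (g y)%:E)%E => [a| |] [b| |] //= _ _ [].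
by move=> ab; congr EFin; lra.
Qed.

Section green.
Context {R : realType} {n : nat} (A : 'rV[R]_n -> 'M[R]_n).
Hypothesis cA : forall i j, Coo ee setT (fun x => A x i j).
Hypothesis sA : forall x, (A x)^T = A x.
Implicit Types (x y : 'rV[R]_n) (U K : set 'rV[R]_n) (f g u w : 'rV[R]_n -> R).

Definition energy u w y : R :=
  \sum_i \sum_j A y i j * (partial i u y * partial j w y).

Lemma A_sym x i j : A x i j = A x j i.
Proof. by rewrite -{1}[A x]sA mxE. Qed.

Lemma energyC u w y : energy u w y = energy w u y.
Proof.
rewrite /energy exchange_big; apply: eq_bigr => i _; apply: eq_bigr => j _.
by rewrite A_sym [partial j u y * _]mulrC.
Qed.

Lemma Ck_A k U i j : Ck ee k U (fun x => A x i j).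
Proof. exact: Ck_sub (cA i j k). Qed.

Lemma Ck_Apartial k U w i j : open U -> Ck ee k.+1 U w ->
  Ck ee k U (fun z => A z i j * partial j w z).
Proof. by move=> oU cw; apply: Ck_mul => //; [exact: Ck_A|exact: CkP]. Qed.

Lemma Ck_div_op k U w : open U -> Ck ee k.+2 U w -> Ck ee k U (div_op A w).
Proof.
move=> oU cw; apply: Ck_sum => // i; apply: Ck_sum => // j.
by apply: CkP; exact: Ck_Apartial.
Qed.

Lemma Ck_energy k U u w : open U -> Ck ee k.+1 U u -> Ck ee k.+1 U w ->
  Ck ee k U (energy u w).
Proof.
move=> oU cu cw; apply: Ck_sum => // i; apply: Ck_sum => // j.
by apply: Ck_mul; [|exact: Ck_A|apply: Ck_mul => //; exact: CkP].
Qed.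

Lemma div_op_off K w : closed K -> (forall x, ~ K x -> w x = 0) ->
  forall x, ~ K x -> div_op A w x = 0.
Proof.
move=> cK w0 x Kx; rewrite /div_op big1 // => i _; rewrite big1 // => j _.
apply: (partial_off (K := K)) => // y Ky.
by rewrite (partial_off (K := K) (f := w)) // mulr0.
Qed.

Lemma partial_on_open U f g x i : open U -> (forall y, U y -> f y = g y) ->
  U x -> partial i f x = partial i g x.
Proof.
move=> oU fg Ux; apply: near_eq_derive; near=> z; apply: fg; near: z.
exact: open_nbhs_nbhs.
Unshelve. all: end_near. Qed.

Lemma div_op_on_open U f g x : open U -> (forall y, U y -> f y = g y) -> U x ->
  div_op A f x = div_op A g x.
Proof.
move=> oU fg Ux; apply: eq_bigr => i _; apply: eq_bigr => j _.
apply: (partial_on_open _ oU) => // y Uy.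
by congr (_ * _); exact: (partial_on_open _ oU).
Qed.

(** The divergence theorem for the field with components
    [\sum_j u * a_ij * partial_j w]. *)
Lemma integral_div_form U K u w (M : R) :
  open U -> closed K -> K `<=` U -> (forall x, K x -> `|x| <= M) ->
  Ck ee 1 U u -> Ck ee 2 U w ->
  (forall x, ~ K x -> u x = 0) \/ (forall x, ~ K x -> w x = 0) ->
  (\int[lebesgue_rV n]_y (u y * div_op A w y + energy u w y)%:E = 0)%E.
Proof.
move=> oU cK KU KM cu cw uw0.
pose Y i y := \sum_j u y * (A y i j * partial j w y).
have Y0 i x : ~ K x -> Y i x = 0.
  move=> Kx; rewrite /Y big1 // => j _; case: uw0 => [u0|w0].
    by rewrite u0 // mul0r.
  by rewrite (partial_off (K := K) (f := w)) // !mulr0.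
have cY i : Ck ee 1 setT (Y i).
  have cYU : Ck ee 1 U (Y i).
    apply: (Ck_sum (F := fun j y => u y * (A y i j * partial j w y)) _ _ oU) => j.
    exact: (Ck_mul oU cu (Ck_Apartial i j oU cw)).
  exact: (Ck_glue oU cK KU cYU (Y0 i)).
have offM x : M < `|x| -> ~ K x by move=> Mx /KM; rewrite leNgt Mx.
have YM i x : M < `|x| -> Y i x = 0 by move=> /offM; exact: Y0.
have pYM i x : M < `|x| -> partial i (Y i) x = 0.
  by move=> /offM; apply: (partial_off i cK (Y0 i)).
have cpY i : continuous (partial i (Y i)).
  by move=> x; apply: Ck_cont (CkP i (cY i)) _.
have E y : u y * div_op A w y + energy u w y = \sum_i partial i (Y i) y.
  have [Ky|Ky] := pselect (K y).
    have Uy := KU _ Ky.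
    rewrite /div_op /energy mulr_sumr -big_split /=; apply: eq_bigr => i _.
    rewrite mulr_sumr -big_split /=; apply/esym/partialE.
    apply: is_derive_bigsum => j.
    rewrite [X in is_derive _ _ _ X](_ : _ = partial i u y * (A y i j * partial j w y) +
      u y * partial i (fun z => A z i j * partial j w z) y); last by ring.
    exact: is_derive_mul (Ck_partial i cu Uy)
      (Ck_partial i (Ck_Apartial i j oU cw) Uy).
  rewrite big1; last by move=> i _; rewrite (partial_off i cK (Y0 i)).
  case: uw0 => [u0|w0].
    rewrite u0 // mul0r add0r /energy big1 // => i _; rewrite big1 // => j _.
    by rewrite (partial_off (K := K) (f := u)) // mul0r mulr0.
  rewrite (div_op_off cK w0) // mulr0 add0r /energy big1 // => i _; rewrite big1 // => j _.
  by rewrite (partial_off (K := K) (f := w)) // !mulr0.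
under eq_integral => y _ do rewrite E -sumEFin.
rewrite integral_sum //; last first.
  by move=> i; exact: integrable_continuous_supp (cpY i) (pYM i).
apply: big1 => i _; apply: (integral_partial0 _ (cpY i) (YM i)).
by move=> x; exact: Ck_partial i (cY i) _.
Qed.

Lemma Ck0_continuous f : Ck ee 0 setT f -> continuous f.
Proof. by move=> cf x; exact: Ck_cont cf _. Qed.

Lemma integrable_glue U K f (M : R) : open U -> closed K -> K `<=` U ->
  (forall x, K x -> `|x| <= M) -> Ck ee 0 U f -> (forall x, ~ K x -> f x = 0) ->
  (lebesgue_rV n).-integrable setT (EFin \o f).
Proof.
move=> oU cK KU KM cf f0.
apply: (integrable_continuous_supp (M := M)).
  by apply: Ck0_continuous; exact: Ck_glue cf f0.
by move=> x Mx; apply: f0 => /KM; rewrite leNgt Mx.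
Qed.

Lemma integral_div_op0 K w (M : R) : closed K -> (forall x, K x -> `|x| <= M) ->
  Ck ee 2 setT w -> (forall x, ~ K x -> w x = 0) ->
  (\int[lebesgue_rV n]_y (div_op A w y)%:E = 0)%E.
Proof.
move=> cK KM cw w0.
rewrite -[RHS](@integral_div_form setT K (fun=> 1) w M) //; [|exact: openT| |].
- apply: eq_integral => y _; rewrite mul1r /energy big1 ?addr0 // => i _.
  rewrite big1 // => j _; have -> : partial i (fun=> 1 : R) y = 0.
    by apply: partialE; exact: is_derive_const.
  by rewrite mul0r mulr0.
- by apply: Ck_cst; exact: openT.
- by right.
Qed.

(** Both sides are the opposite of the integral of the symmetric form
    [energy]. *)
Lemma green U K g w (M : R) :
  open U -> closed K -> K `<=` U -> (forall x, K x -> `|x| <= M) ->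
  Ck ee 2 U g -> Ck ee 2 setT w -> (forall x, ~ K x -> w x = 0) ->
  (\int[lebesgue_rV n]_y (g y * div_op A w y)%:E =
   \int[lebesgue_rV n]_y (w y * div_op A g y)%:E)%E.
Proof.
move=> oU cK KU KM cg cw w0.
have cwU : Ck ee 2 U w by exact: Ck_sub cw.
have e0 x : ~ K x -> energy g w x = 0.
  move=> Kx; rewrite /energy big1 // => i _; rewrite big1 // => j _.
  by rewrite (partial_off (K := K) (f := w)) // !mulr0.
have ei : (lebesgue_rV n).-integrable setT (EFin \o energy g w).
  by apply: (integrable_glue oU cK KU KM _ e0); apply: Ck_energy => //; exact: CkW.
have i1 : (lebesgue_rV n).-integrable setT (EFin \o (fun y => g y * div_op A w y)).
  apply: (integrable_glue oU cK KU KM).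
    apply: Ck_mul => //; first exact: CkW (CkW cg).
    exact: Ck_div_op.
  by move=> x Kx; rewrite (div_op_off cK w0) // mulr0.
have i2 : (lebesgue_rV n).-integrable setT (EFin \o (fun y => w y * div_op A g y)).
  apply: (integrable_glue oU cK KU KM).
    apply: Ck_mul => //; first exact: CkW (CkW cwU).
    exact: Ck_div_op.
  by move=> x Kx; rewrite w0 // mul0r.
have eig : (lebesgue_rV n).-integrable setT (EFin \o energy w g).
  by rewrite (_ : energy w g = energy g w) //; apply/funext => y; exact: energyC.
have eE : (\int[lebesgue_rV n]_y (energy w g y)%:E =
           \int[lebesgue_rV n]_y (energy g w y)%:E)%E.
  by apply: eq_integral => y _; rewrite energyC.
have h1 := @integral_div_form U K g w M oU cK KU KM (CkW cg) cwU (or_intror w0).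
have h2 := @integral_div_form U K w g M oU cK KU KM (CkW cwU) cg (or_introl w0).
have q1 := integral_add_eq0 i1 ei h1.
have q2 := integral_add_eq0 i2 eig h2.
exact: etrans q1 (etrans (esym (congr1 oppe eE)) (esym q2)).
Qed.

(** The source of the mean value formulas: where [g] is harmonic, only the
    kernel [energy A g g] remains. *)
Lemma div_op_comp U (W : set R) (F : R -> R) g y : open U ->
  Ck ee 2 U g -> Ck1 2 W F -> (forall x, U x -> W (g x)) -> U y ->
  div_op A (F \o g) y =
  'D_1 ('D_1 F) (g y) * energy g g y + 'D_1 F (g y) * div_op A g y.
Proof.
move=> oU cg cF UW Uy.
have dFg z j : U z -> partial j (F \o g) z = 'D_1 F (g z) * partial j g z.
  move=> Uz; apply: partialE; apply: is_derive_chain.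
    exact: (Ck_partial j (CkW cg) Uz).
  exact: (Ck_derive tt cF (UW _ Uz)).
rewrite /div_op /energy !mulr_sumr -big_split /=; apply: eq_bigr => i _.
rewrite !mulr_sumr -big_split /=; apply: eq_bigr => j _.
apply: partialE.
have E : \forall z \near y, 'D_1 F (g z) * (A z i j * partial j g z) =
    A z i j * partial j (F \o g) z.
  near=> z; rewrite dFg; first by ring.
  by near: z; exact: open_nbhs_nbhs.
apply: is_derive_near E _.
rewrite [X in is_derive _ _ _ X](_ : _ = 'D_1 ('D_1 F) (g y) * partial i g y * (A y i j * partial j g y) +
      'D_1 F (g y) * partial i (fun z => A z i j * partial j g z) y); last by ring.
apply: is_derive_mul.
  apply: (is_derive_chain (F := 'D_1 F)); first exact: Ck_partial i (CkW cg) Uy.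
  exact: (Ck_derive tt (CkD tt cF) (UW _ Uy)).
exact: Ck_partial i (Ck_Apartial i j oU cg) Uy.
Unshelve. all: end_near. Qed.

End green.

(** * The fundamental solution off its pole *)

Section pairs_of_vectors.
Context {R : realType} {n : nat}.
Local Notation V := ('rV[R]_n).
Implicit Types (x y : V).

Lemma row_mx_continuous x : continuous (fun y : V => row_mx x y : 'rV[R]_(n + n)).
Proof.
move=> y; apply/(@cvgrPdist_lt _ _ _ (nbhs y) (nbhs_filter y)) => e e0.
apply: filterS (nbhsx_ballx y e e0) => z yz.
have : ball (row_mx x y) e (row_mx x z).
  apply/(ball_rVP _ _ e0) => i; case: (split_ordP i) => j ->.
    by rewrite !row_mxEl subrr normr0.
  by rewrite !row_mxEr; move: j; exact/(ball_rVP _ _ e0).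
by rewrite -ball_normE.
Qed.

Lemma lsubmx_continuous : continuous (fun z : 'rV[R]_(n + n) => lsubmx z).
Proof.
move=> y; apply/(@cvgrPdist_lt _ _ _ (nbhs y) (nbhs_filter y)) => e e0.
apply: filterS (nbhsx_ballx y e e0) => z /(ball_rVP _ _ e0) yz.
have : ball (lsubmx y) e (lsubmx z).
  by apply/(ball_rVP _ _ e0) => i; rewrite !mxE; exact: yz.
by rewrite -ball_normE.
Qed.

Lemma rsubmx_continuous : continuous (fun z : 'rV[R]_(n + n) => rsubmx z).
Proof.
move=> y; apply/(@cvgrPdist_lt _ _ _ (nbhs y) (nbhs_filter y)) => e e0.
apply: filterS (nbhsx_ballx y e e0) => z /(ball_rVP _ _ e0) yz.
have : ball (rsubmx y) e (rsubmx z).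
  by apply/(ball_rVP _ _ e0) => i; rewrite !mxE; exact: yz.
by rewrite -ball_normE.
Qed.

Lemma measurable_row_mx :
  measurable_fun setT (fun p : V * V => row_mx p.1 p.2 : 'rV[R]_(n + n)).
Proof.
apply: measurable_fun_rV => i; case: (split_ordP i) => j ij.
  rewrite [_ \o _](_ : _ = coord_rV j \o fst); last first.
    by apply/funext => p /=; rewrite /coord_rV ij row_mxEl.
  by apply: measurableT_comp => //; exact: measurable_coord_rV.
rewrite [_ \o _](_ : _ = coord_rV j \o snd); last first.
  by apply/funext => p /=; rewrite /coord_rV ij row_mxEr.
by apply: measurableT_comp => //; exact: measurable_coord_rV.
Qed.

Lemma row_mx_shift x y (h : R) j :
  h *: delta_mx ord0 (rshift n j) + row_mx x y =
  row_mx x (h *: delta_mx ord0 j + y) :> 'rV[R]_(n + n).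
Proof.
apply/rowP => i; rewrite [LHS]mxE [X in X + _]mxE [X in _ * X + _]mxE.
case: (split_ordP i) => k ->.
  by rewrite !row_mxEl eq_lrshift /= mulr0 add0r.
by rewrite !row_mxEr !mxE /= (inj_eq (@rshift_inj _ _)).
Qed.

(** Derivatives in [y] are derivatives along the last [n] coordinates of the
    pair. *)
Lemma Ck_slice k (W : set 'rV[R]_(n + n)) (g : 'rV[R]_(n + n) -> R) x :
  open W -> Ck ee k W g ->
  Ck ee k [set y : V | W (row_mx x y)] (fun y => g (row_mx x y)).
Proof.
move=> oW; have oU : open [set y : V | W (row_mx x y)].
  apply: (@open_comp _ _ (fun y : V => row_mx x y)) => // y _.
  exact: row_mx_continuous.
elim: k g => [|k IH] g cg.
  split=> // y Wy; apply: (@continuous_comp _ _ _ (fun y : V => row_mx x y) g).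
    exact: row_mx_continuous.
  exact: Ck_cont cg Wy.
apply: (CkS_intro (g := fun j y => partial (rshift n j) g (row_mx x y))) => //.
- move=> y Wy; apply: (@continuous_comp _ _ _ (fun y : V => row_mx x y) g).
    exact: row_mx_continuous.
  exact: Ck_cont cg Wy.
- move=> j y Wy; apply/is_derive_restr.
  have /is_derive_restr := Ck_partial (rshift n j) cg Wy.
  by congr is_derive; apply/funext => h; rewrite row_mx_shift.
- by move=> j; apply: IH; exact: CkP.
Qed.

Lemma open_offdiag : open [set z : 'rV[R]_(n + n) | lsubmx z != rsubmx z].
Proof.
pose d (z : 'rV[R]_(n + n)) := `|lsubmx z - rsubmx z|.
rewrite (_ : mkset _ = d @^-1` [set r | 0 < r]); last first.
  by apply/seteqP; split => z /=; rewrite /d normr_gt0 subr_eq0.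
apply: open_comp => [z _|]; last exact: open_gt.
apply: continuous_comp; last exact: norm_continuous.
by apply: continuousB; [exact: lsubmx_continuous|exact: rsubmx_continuous].
Qed.

End pairs_of_vectors.

Section fundamental_solution_facts.
Context {R : realType} {n : nat}.
Variables (A : 'rV[R]_n -> 'M[R]_n) (Gamma : 'rV[R]_n -> 'rV[R]_n -> R).
Local Notation V := ('rV[R]_n).
Hypothesis hA : admissible_operator A.
Hypothesis hG : fundamental_solution A Gamma.
Implicit Types (x y z : V).

(** [Gamma] is arbitrary on the diagonal, possibly not measurable there. *)
Definition gam x y : R := if x == y then 0 else Gamma x y.

Lemma gamxx x : gam x x = 0. Proof. by rewrite /gam eqxx. Qed.

Lemma gamE x y : x != y -> gam x y = Gamma x y.
Proof. by move=> /negbTE xy; rewrite /gam xy. Qed.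

Lemma gam_sym x y : gam x y = gam y x.
Proof.
rewrite /gam eq_sym; case: eqVneq => // yx.
by rewrite (fs_sym hG) // eq_sym.
Qed.

Lemma gam_gt0 x y : x != y -> 0 < gam x y.
Proof. by move=> xy; rewrite gamE //; exact: fs_gt0 hG _ _ xy. Qed.

Lemma gam_ge0 x y : 0 <= gam x y.
Proof. by have [->|/gam_gt0/ltW//] := eqVneq x y; rewrite gamxx. Qed.

Lemma open_setC1 x : open (~` [set x]).
Proof.
apply: closed_openC; apply: accessible_closed_set1.
by apply: hausdorff_accessible; exact: norm_hausdorff.
Qed.

Lemma gam_Coo x : Coo ee (~` [set x]) (gam x).
Proof.
move=> k; have /smooth_onP/(_ k) H := fs_smooth hG.
have := Ck_slice x open_offdiag H.
rewrite (_ : [set y | _] = ~` [set x]); last first.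
  by apply/seteqP; split => y /=; rewrite row_mxKl row_mxKr eq_sym => /eqP.
apply: Ck_eq; first exact: open_setC1.
by move=> y; rewrite inE /= => /eqP; rewrite row_mxKl row_mxKr eq_sym => /gamE ->.
Qed.

Lemma gam_continuous x y : x != y -> {for y, continuous (gam x)}.
Proof. by move=> xy; apply: (Ck_cont (gam_Coo x 0)); apply/eqP; rewrite eq_sym. Qed.

Lemma measurable_gam x : measurable_fun setT (gam x).
Proof. by apply: (measurable_fun_off (x0 := x)) => y yx; apply: gam_continuous; rewrite eq_sym. Qed.

Lemma measurable_gam2 : measurable_fun setT (fun p : V * V => gam p.1 p.2).
Proof.
pose g (z : 'rV[R]_(n + n)) := if lsubmx z == rsubmx z then 0 else Gamma (lsubmx z) (rsubmx z).
rewrite (_ : (fun p => _) = g \o (fun p : V * V => row_mx p.1 p.2)); last first.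
  by apply/funext => p; rewrite /g /= row_mxKl row_mxKr.
apply: measurableT_comp measurable_row_mx.
have oO := @open_offdiag R n.
rewrite -(setvU [set z : 'rV[R]_(n + n) | lsubmx z != rsubmx z]); apply/measurable_funU.
- by apply: measurableC; exact: open_measurable_rV.
- exact: open_measurable_rV.
split.
  apply: (eq_measurable_fun (fun=> 0 : measurableTypeR R)); last exact: measurable_cst.
  by move=> z; rewrite inE /g /= => /negP; rewrite negbK => ->.
apply: measurable_fun_open => // z Oz.
have : Ck ee 0 [set z : 'rV[R]_(n + n) | lsubmx z != rsubmx z] g.
  have /smooth_onP/(_ 0%N) := fs_smooth hG.
  by apply: Ck_eq => // w; rewrite inE /= /g => /negbTE ->.
by move/Ck_cont; exact.
Qed.

Lemma dim_gt0 : (0 < n)%N.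
Proof.
have := coef_trace hA 0; rewrite lt0n; case: n A => // B.
by rewrite /mxtrace big_ord0 ltxx.
Qed.

Lemma null_point x : lebesgue_rV n [set x] = 0%E.
Proof. by case: n dim_gt0 x => // m _ x; exact: lebesgue_rV_set1. Qed.

Lemma ae_neq x : \forall y \ae (lebesgue_rV n), x != y.
Proof.
exists [set x]; split; [exact: measurable_set1_rV|exact: null_point|].
by move=> y /= /negP; rewrite negbK => /eqP ->.
Qed.

Lemma gam_infty x (e : R) : 0 < e ->
  exists M : R, forall y, M < `|y| -> gam x y < e.
Proof.
move=> e0; have K1 : compact [set x] by exact: compact_set1.
have K0 : [set x] !=set0 by exists x.
have := fs_infty hG K1 K0.
move=> /(_ [set t | (t < e%:E)%E]) [].
  by apply: open_nbhs_nbhs; split; [exact: open_ereal_lt_ereal|rewrite /= lte_fin].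
move=> M _ HM; exists (Num.max M `|x|) => y; rewrite gt_max => /andP[My xy].
have yx : y != x by apply: contraTneq xy => ->; rewrite ltxx.
have := HM y My; rewrite /= image_set1 ereal_sup1 /Gammabar (negbTE yx) lte_fin.
by rewrite gam_sym gamE.
Qed.

Lemma gam_pole x (C : R) : exists2 d : R, 0 < d &
  forall y, y != x -> `|y - x| < d -> C < gam x y.
Proof.
have /cvgryPgt/(_ C) := fs_pole hG x.
rewrite near_withinE => /nbhs_ballP[d /= d0 H]; exists d => // y yx yd.
rewrite gam_sym gamE //; apply: H => //.
by rewrite -ball_normE /= distrC.
Qed.

Lemma gam_L1 x (K : set V) : compact K ->
  (lebesgue_rV n).-integrable K (EFin \o gam x).
Proof.
move=> cK; have mK : measurable K.
  by apply: closed_measurable_rV; apply: compact_closed cK; exact: norm_hausdorff.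
have /integrableP[mG GI] := fs_L1loc hG x cK.
have mg : measurable_fun K (EFin \o gam x).
  by apply/measurable_EFinP; apply: measurable_funTS; exact: measurable_gam.
apply/integrableP; split=> //.
rewrite (ae_eq_integral (fun y => `|(Gamma x y)%:E|%E)) //.
- exact: measurableT_comp.
- exact: measurableT_comp.
- by apply: filterS (ae_neq x) => y xy _ /=; rewrite gamE.
Qed.

Lemma measurable_Gamma x : measurable_fun setT (Gamma x).
Proof.
apply: (measurable_fun_off (x0 := x)) => y yx.
have xy : x != y by rewrite eq_sym.
apply: continuous_near (gam_continuous xy).
have /open_nbhs_nbhs : open_nbhs y (~` [set x]).
  by split; [exact: open_setC1|exact/eqP].
by apply: filterS => z /= /eqP zx; rewrite gamE // eq_sym.
Qed.

Lemma integral_gam x (h : V -> R) : measurable_fun setT h ->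
  (\int[lebesgue_rV n]_y (Gamma x y * h y)%:E =
   \int[lebesgue_rV n]_y (gam x y * h y)%:E)%E.
Proof.
move=> mh; apply: ae_eq_integral => //.
- by apply/measurable_EFinP; apply: measurable_funM => //; exact: measurable_Gamma.
- by apply/measurable_EFinP; apply: measurable_funM => //; exact: measurable_gam.
- by apply: filterS (ae_neq x) => y xy _ /=; rewrite gamE.
Qed.

Lemma cA i j : Coo ee setT (fun x => A x i j).
Proof. by have /smooth_onP := coef_smooth hA i j. Qed.

Lemma gam_eq x (phi : V -> R) (M : R) : Coo ee setT phi ->
  (forall y, M < `|y| -> phi y = 0) ->
  \int[lebesgue_rV n]_y (gam x y * div_op A phi y) = - phi x.
Proof.
move=> cphi phi0; rewrite -(fs_eq hG x (test_function_intro cphi phi0)).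
rewrite /Rintegral integral_gam //; apply: continuous_measurable_rV.
by apply: Ck0_continuous; apply: Ck_div_op; [exact: cA|exact: openT|exact: cphi].
Qed.

End fundamental_solution_facts.

(** * Harmonicity off the pole *)

Section integration_tools.
Context {R : realType} {n : nat}.
Local Notation V := ('rV[R]_n).

Lemma bounded_le d (T : measurableType d) (D : set T) (h : T -> R) (C : R) :
  (forall x, D x -> `|h x| <= C) -> [bounded h x | x in D].
Proof.
move=> hC; exists C; split; first exact: num_real.
by move=> c Cc x Dx /=; exact: le_trans (hC _ Dx) (ltW Cc).
Qed.

Lemma measurable_norm_le (M : R) : measurable [set x : V | `|x| <= M].
Proof.
apply: closed_measurable_rV; apply: compact_closed (@compact_norm_le R n M).
exact: norm_hausdorff.
Qed.

Lemma integral_gt0 d (T : measurableType d) (m : {measure set T -> \bar R})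
  (O : set T) (h : T -> R) : measurable_fun setT h ->
  (forall y, 0 <= h y) -> measurable O -> (0 < m O)%E ->
  (forall y, O y -> 0 < h y) -> (0 < \int[m]_y (h y)%:E)%E.
Proof.
move=> mh h0 mO O0 hO; rewrite lt_neqAle integral_ge0 ?andbT; last first.
  by move=> y _; rewrite lee_fin.
apply/negP => /eqP I0.
have : (\int[m]_y `|(h y)%:E| = 0)%E.
  by rewrite [RHS]I0; apply: eq_integral => y _; rewrite gee0_abs // lee_fin.
have mEh : measurable_fun setT (EFin \o h) by exact/measurable_EFinP.
move/(ae_eq_integral_abs _ measurableT mEh) => [N [mN N0 sN]].
move: O0; apply/negP; rewrite -leNgt -[leRHS]N0.
apply: le_measure; rewrite ?inE //.
move=> y /hO hy; apply: sN => /= /(_ Logic.I) [] hy0.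
by move: hy; rewrite hy0 ltxx.
Qed.

Lemma integral_gt0_open (O : set V) (h : V -> R) : measurable_fun setT h ->
  (forall y, 0 <= h y) -> open O -> O !=set0 -> (forall y, O y -> 0 < h y) ->
  (0 < \int[lebesgue_rV n]_y (h y)%:E)%E.
Proof.
move=> mh h0 oO O0 hO; apply: integral_gt0 mh h0 _ _ hO.
  exact: open_measurable_rV.
exact: lebesgue_rV_open.
Qed.

End integration_tools.

Section harmonicity.
Context {R : realType} {n : nat}.
Variables (A : 'rV[R]_n -> 'M[R]_n) (Gamma : 'rV[R]_n -> 'rV[R]_n -> R).
Local Notation V := ('rV[R]_n).
Hypothesis hA : admissible_operator A.
Hypothesis hG : fundamental_solution A Gamma.
Implicit Types (x y z : V).
Local Notation gam := (gam Gamma).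

Lemma integrable_gamM x (h : V -> R) (M C : R) : measurable_fun setT h ->
  (forall y, `|h y| <= C) -> (forall y, M < `|y| -> h y = 0) ->
  (lebesgue_rV n).-integrable setT (EFin \o (fun y => gam x y * h y)).
Proof.
move=> mh hC h0; have mK := @measurable_norm_le R n M.
apply: (integrable_supp mK) => [y /negP|].
  by rewrite -ltNge => /h0 ->; rewrite mulr0.
have gi := gam_L1 hA hG x (@compact_norm_le R n M).
have mhK : measurable_fun [set y : V | `|y| <= M] h by exact: measurable_funTS.
have := integrableMl mK gi mhK (bounded_le (fun y _ => hC y)).
by apply: eq_integrable => // y _; rewrite /= EFinM.
Qed.

Lemma gam_eqE x (phi : V -> R) (M : R) : Coo ee setT phi ->
  (forall y, M < `|y| -> phi y = 0) ->
  (\int[lebesgue_rV n]_y (gam x y * div_op A phi y)%:E = (- phi x)%:E)%E.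
Proof.
move=> cphi phi0; rewrite -(gam_eq hA hG x cphi phi0) /Rintegral fineK //.
have cL : continuous (div_op A phi).
  by apply: Ck0_continuous; apply: Ck_div_op; [exact: cA|exact: openT|exact: cphi].
have L0 y : M < `|y| -> div_op A phi y = 0.
  move=> My; apply: (@div_op_off R n A [set y : V | `|y| <= M]) => //.
  - by apply: compact_closed (@compact_norm_le R n M); exact: norm_hausdorff.
  - by move=> z /negP; rewrite -ltNge; exact: phi0.
  - by move=> /=; rewrite leNgt My.
have [|C _ HC] := continuous_bounded_on (f := div_op A phi) (@compact_norm_le R n M).
  exact: continuous_subspaceT.
apply: (integrable_fin_num measurableT).
apply: (integrable_gamM x (M := M) (C := `|C|)) => //.
  exact: continuous_measurable_rV.
move=> y; have [/HC/le_trans|My] := leP `|y| M; first by apply; exact: ler_norm.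
by rewrite L0 // normr0.
Qed.

(** If the image of [gam x] under the operator had a sign near [y], its integral
    against a bump around [y] would be nonzero; but by Green's formula this
    integral is the one of [gam x] against the image of the bump, that is, minus
    the value of the bump at the pole [x]. *)
Lemma gam_harmonic x y : y != x -> div_op A (gam x) y = 0.
Proof.
move=> yx; apply/eqP/negPn/negP => q0; set q := div_op A (gam x).
have oU := @open_setC1 R n x.
have cq : Ck ee 0 (~` [set x]) q.
  by apply: (Ck_div_op (cA hA) oU); exact: gam_Coo hG x 2%N.
pose s : R := Num.sg (q y).
have sq : 0 < s * q y by rewrite /s -normrEsg normr_gt0.
have : \forall z \near y, 0 < s * q z.
  have c : {for y, continuous (fun z => s * q z)}.
    have cqy : {for y, continuous q} by apply: (Ck_cont cq); exact/eqP.
    exact: cvgM (cvg_cst _) cqy.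
  exact: (cvgr_gt _ c).
move=> /nbhs_ballP[d /= d0 dq].
pose e := Num.min d `|y - x|.
have e0 : 0 < e by rewrite lt_min d0 normr_gt0 subr_eq0.
pose phi := ball_bump y (e / 2); have e2 : 0 < e / 2 by rewrite divr_gt0.
pose K := [set z : V | `|z - y| <= e / 2].
have cK : closed K.
  rewrite (_ : K = (fun z : V => `|z - y|) @^-1` [set r | r <= e / 2]) //.
  apply: closed_comp => [z _|]; last exact: closed_le.
  apply: continuous_comp; last exact: norm_continuous.
  by apply: continuousB => //; exact: cst_continuous.
have KU : K `<=` ~` [set x].
  move=> z Kz /= zx; move: Kz; rewrite zx /K /= distrC => Kx.
  have : e <= `|y - x| by rewrite ge_min lexx orbT.
  by move: Kx e0; lra.
have phi0 z : ~ K z -> phi z = 0.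
  by move=> /negP; rewrite -ltNge => Kz; apply: ball_bump_eq0; exact: ltW.
have KM z : K z -> `|z| <= `|y| + e / 2.
  move=> Kz; rewrite -[z](subrK y) addrC.
  by apply: le_trans (ler_normD _ _) _; rewrite lerD2l.
have cphi := Coo_ball_bump y (e / 2).
have phiM z : `|y| + e / 2 < `|z| -> phi z = 0.
  by move=> Mz; apply: phi0 => /KM; rewrite leNgt Mz.
have px : phi x = 0 by apply: phi0 => /KU; exact.
have := gam_eqE x cphi phiM; rewrite -/phi px oppr0.
rewrite (green (cA hA) (coef_symmetric hA) oU cK KU KM
  (gam_Coo hG x 2%N) (cphi 2%N) phi0) => I0.
have iq : (lebesgue_rV n).-integrable setT (EFin \o (fun z => phi z * q z)).
  apply: (integrable_glue oU cK KU KM).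
    by apply: Ck_mul => //; apply: Ck_sub (cphi 0%N).
  by move=> z /phi0 ->; rewrite mul0r.
have mq : measurable_fun setT (fun z => phi z * q z).
  by apply/measurable_EFinP; case/integrableP : iq.
have dK z : K z -> 0 < s * q z.
  move=> Kz; apply: dq; rewrite -ball_normE /= distrC; apply: le_lt_trans Kz _.
  have : e <= d by rewrite ge_min lexx.
  by move: e0; lra.
have := @integral_gt0_open R n [set z | 0 < phi z] (fun z => s * (phi z * q z)).
have -> : (\int[lebesgue_rV n]_z (s * (phi z * q z))%:E = 0)%E.
  by under eq_integral do rewrite EFinM; rewrite integralZl // I0 mule0.
rewrite ltxx => H; suff : false by []; apply: H.
- exact: measurable_funM.
- move=> z; have [Kz|/phi0 ->] := pselect (K z); last by rewrite mul0r mulr0.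
  by rewrite mulrCA; apply: mulr_ge0; [exact: ball_bump_ge0|exact/ltW/dK].
- apply: (@open_comp _ _ phi [set r | 0 < r]); last exact: open_gt.
  by move=> z _; exact: Ck_cont (cphi 0%N) _.
- by exists y; exact: ball_bump_center.
- move=> z pz; rewrite mulrCA; apply: mulr_gt0; [exact: pz|apply: dK].
  apply: contrapT => /phi0 pz0.
  by move: pz; rewrite /= pz0 ltxx.
Qed.

End harmonicity.

(** * Weights and radial profiles *)

Section radial_profiles.
Context {R : realType}.
Local Notation mu := (@lebesgue_measure R).
Implicit Types (t s r : R).

Definition pos_set : set R := [set t | 0 < t].

Lemma open_pos_set : open pos_set.
Proof. exact: open_gt. Qed.

Lemma is_derive_inv t : t != 0 -> is_derive t 1 (fun s : R => s^-1) (- t^-1 ^+ 2).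
Proof.
move=> t0; have := @is_deriveV R id t 1 1 t0 _.
by rewrite [_ *: 1]mulr1 exprVn; apply.
Qed.

Lemma is_derive_continuous (f : R -> R) t d : is_derive t 1 f d -> {for t, continuous f}.
Proof. by case=> df _; apply/differentiable_continuous/derivable1_diffP. Qed.

Lemma Coo_inv : Coo1 pos_set (fun t : R => t^-1).
Proof.
have d t : pos_set t -> is_derive t 1 (fun s : R => s^-1) (- t^-1 ^+ 2).
  by move=> t0; apply: is_derive_inv; rewrite gt_eqF.
elim=> [|k IH]; first by split=> // t /d/is_derive_continuous.
apply: (CkS_intro (g := fun _ t => (-1) * (t^-1 * t^-1))).
- exact: open_pos_set.
- by move=> t /d/is_derive_continuous.
- by move=> i t /d; rewrite mulN1r expr2.
- move=> i; apply: Ck_mul; first exact: open_pos_set.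
    by apply: Ck_cst; exact: open_pos_set.
  by apply: Ck_mul => //; exact: open_pos_set.
Qed.

Lemma Coo_powR (al : R) : Coo1 pos_set (fun t : R => t `^ al).
Proof.
move=> k; elim: k al => [|k IH] al.
  by split=> // t t0; exact: is_derive_continuous (is_derive1_powR al t0).
apply: (CkS_intro (g := fun _ t => al * t `^ (al - 1))).
- exact: open_pos_set.
- by move=> t t0; exact: is_derive_continuous (is_derive1_powR al t0).
- move=> i; exact: (Ck_mul open_pos_set (Ck_cst _ _ al open_pos_set) (IH (al - 1))).
Qed.

Lemma measurable_invr : measurable_fun setT (fun t : R => t^-1).
Proof.
have o0 : open (~` [set (0 : R)]).
  apply: closed_openC; apply: accessible_closed_set1.
  by apply: hausdorff_accessible; exact: (@norm_hausdorff _ R^o).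
rewrite -(setvU [set (0 : R)]); apply/measurable_funU.
- by apply: measurableC; exact: measurable_set1.
- exact: measurable_set1.
split; last exact: measurable_fun_set1.
apply: open_continuous_measurable_fun => // t; rewrite inE /= => /eqP t0.
exact: is_derive_continuous (is_derive_inv t0).
Qed.

Lemma integrable_mu_supp (f : R -> R) (a b C : R) : measurable_fun setT f ->
  (forall t, `|f t| <= C) -> (forall t, ~ `[a, b]%classic t -> f t = 0) ->
  mu.-integrable setT (EFin \o f).
Proof.
move=> mf fC f0; apply: (@integrable_supp _ _ _ mu `[a, b]%classic) => //.
apply: measurable_bounded_integrable => //.
- by rewrite [X in (X < _)%E]lebesgue_measure_itv; case: ifP => _; rewrite ?ltry // -EFinB ltry.
- exact: measurable_funTS.
- by apply: bounded_le => t _; exact: fC.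
Qed.

Lemma Rintegral_supp d (T : measurableType d) (m : {measure set T -> \bar R})
  (B : set T) (f : T -> R) : measurable B -> (forall x, ~ B x -> f x = 0) ->
  \int[m]_x f x = \int[m]_(x in B) f x.
Proof.
move=> mB f0; by rewrite /Rintegral (integral_supp m mB) // => x /f0 ->.
Qed.

(** A primitive on the whole line of a function that vanishes below some
    positive point: on a negative [t] the integral is over the empty set. *)
Definition primitive0 (k : R -> R) t : R := \int[mu]_(s in `[0, t]) k s.

Section primitive.
Variables (k : R -> R) (a b : R).
Hypotheses (a0 : 0 < a) (ck : continuous k).
Hypothesis k0 : forall t, ~ `[a, b]%classic t -> k t = 0.

Lemma primitive_small t : t < a -> primitive0 k t = 0.
Proof.
move=> ta; rewrite /primitive0 /Rintegral integral0_eq // => s /=.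
rewrite in_itv /= => /andP[_ st]; rewrite k0 //= in_itv /= => /andP[] + _.
by rewrite leNgt (le_lt_trans st ta).
Qed.

Lemma continuous_supp_bounded : exists C, forall t, `|k t| <= C.
Proof.
have [M [_ HM]] := compact_bounded (continuous_compact (continuous_subspaceT ck)
  (@segment_compact R a b)).
exists (`|M| + 1) => t; have [abt|/k0 ->] := pselect (`[a, b]%classic t).
  by apply: HM; [rewrite (le_lt_trans (ler_norm M)) // ltrDl|exists t].
by rewrite normr0 addr_ge0.
Qed.

Lemma supp_integrable : mu.-integrable setT (EFin \o k).
Proof.
have [C kC] := continuous_supp_bounded.
by apply: (integrable_mu_supp _ kC k0); exact: continuous_measurable_fun.
Qed.

Lemma is_derive_primitive t : is_derive t 1 (primitive0 k) (k t).
Proof.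
have [t0|t0] := ltP 0 t.
  have t1 : t < t + 1 by rewrite ltrDl.
  have ki : mu.-integrable `[0, t + 1] (EFin \o k).
    by apply: integrableS supp_integrable.
  have [d1 d2] := continuous_FTC1_closed t1 ki t0 (@ck t).
  by split; [exact: d1|rewrite -derive1E; exact: d2].
have ta : t < a by exact: le_lt_trans a0.
rewrite k0; last by rewrite /= in_itv /= leNgt ta.
apply: is_derive_near (is_derive_const 0 t 1).
near=> s; rewrite primitive_small //; near: s; exact: lt_nbhsl.
Unshelve. all: end_near. Qed.

Lemma primitive_large t : b <= t -> primitive0 k t = \int[mu]_s k s.
Proof.
move=> bt; rewrite [RHS](@Rintegral_supp _ _ mu `[0, t]%classic) // => s st.
apply: k0 => /=; rewrite in_itv /= => /andP[as_ sb]; apply: st.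
by rewrite /= in_itv /= (le_trans (ltW a0) as_) (le_trans sb bt).
Qed.

Lemma Coo_primitive : Coo1 setT k -> Coo1 setT (primitive0 k).
Proof.
move=> Ck_k [|j].
  by split=> // t _; exact: is_derive_continuous (is_derive_primitive t).
apply: (CkS_intro (g := fun _ t => k t)); first exact: openT.
- by move=> t _; exact: is_derive_continuous (is_derive_primitive t).
- by move=> i t _; exact: is_derive_primitive.
- by move=> _.
Qed.

End primitive.

(** The weights against which the level sets of the fundamental solution, labelled
    by the size [s] of the ball that they bound, are averaged.  Staying away from
    [s = 0] means staying away from the pole. *)
Record weight (a b : R) (m : R -> R) : Prop := Weight {
  weight_gt0 : 0 < a ;
  weight_Coo : Coo1 setT m ;
  weight_off : forall t, ~ `[a, b]%classic t -> m t = 0 }.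

(** The average with weight [m] of the truncations of [t] at the heights
    [1/s]. *)
Definition min_transform (m : R -> R) t : R :=
  \int[mu]_s (Num.min t s^-1 * m s).

Section profile.
Variables (m : R -> R) (a b : R).
Hypothesis wm : weight a b m.

Let a0 := weight_gt0 wm.
Let m0 := weight_off wm.

Lemma weight_continuous : continuous m.
Proof. by move=> t; exact: Ck_cont (weight_Coo wm 0%N) _. Qed.

Let cm := weight_continuous.

Lemma weight_le t : t < a -> m t = 0.
Proof. by move=> ta; apply: m0; rewrite /= in_itv /= leNgt ta. Qed.

Lemma weight_ge t : b < t -> m t = 0.
Proof. by move=> bt; apply: m0; rewrite /= in_itv /= [t <= b]leNgt bt andbF. Qed.

Let mV s : R := m s * s^-1.

Let mV0 s : ~ `[a, b]%classic s -> mV s = 0.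
Proof. by move=> /m0; rewrite /mV => ->; rewrite mul0r. Qed.

Let cmV : continuous mV.
Proof.
move=> t; have [ta|at_] := ltP t a.
  apply: (@continuous_near _ _ (fun=> 0)); last exact: cst_continuous.
  near=> s; rewrite /mV weight_le ?mul0r //; near: s; exact: lt_nbhsl.
apply: cvgM; first exact: cm.
by apply: cvgV; [rewrite gt_eqF // (lt_le_trans a0)|exact: cvg_id].
Unshelve. all: end_near. Qed.

(** A closed form of [min_transform m] on the positive half-line, found by
    splitting the integral at [s = 1/t]; it is smooth, and its second derivative
    is [- m (1/t) / t^2]. *)
Definition profile t : R :=
  (primitive0 mV b - primitive0 mV t^-1) + t * primitive0 m t^-1.

Lemma is_derive_profile t : 0 < t -> is_derive t 1 profile (primitive0 m t^-1).
Proof.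
move=> t0; have tn : t != 0 by rewrite gt_eqF.
have dv := is_derive_inv tn.
have d1 := is_derive_chain dv (is_derive_primitive a0 cmV mV0 t^-1).
have d2 := is_derive_chain dv (is_derive_primitive a0 cm m0 t^-1).
have := is_derive_add (is_derive_add (is_derive_const (primitive0 mV b) t 1)
  (is_derive_mul (is_derive_const (-1) t 1) d1)) (is_derive_mul (is_derive_id t 1) d2).
rewrite (_ : _ + _ + _ = primitive0 m t^-1); last first.
  by rewrite /mV /=; field.
by apply: is_derive_ext => s; rewrite /profile /= mulN1r.
Qed.

Lemma Coo_profile : Coo1 pos_set profile.
Proof.
move=> [|k].
  by split=> // t t0; exact: is_derive_continuous (is_derive_profile t0).
apply: (CkS_intro (g := fun _ t => primitive0 m t^-1)); first exact: open_pos_set.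
- by move=> t t0; exact: is_derive_continuous (is_derive_profile t0).
- by move=> i t t0; exact: is_derive_profile.
move=> _; apply: (Ck_comp open_pos_set (W := setT) (F := primitive0 m) (f := fun t : R => t^-1)) => //.
  exact: Coo_primitive a0 cm m0 (weight_Coo wm) k.
exact: Coo_inv.
Qed.

Lemma profile_derive2 t : 0 < t -> 'D_1 ('D_1 profile) t = - (m t^-1 * t^-1 ^+ 2).
Proof.
move=> t0; have tn : t != 0 by rewrite gt_eqF.
have d2 := is_derive_chain (is_derive_inv tn) (is_derive_primitive a0 cm m0 t^-1).
rewrite mulrN in d2.
suff : is_derive t 1 ('D_1 profile) (- (m t^-1 * t^-1 ^+ 2)) by case.
apply: is_derive_near d2; near=> s.
have s0 : 0 < s by near: s; exact: lt_nbhsr.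
by case: (is_derive_profile s0) => _ ->.
Unshelve. all: end_near. Qed.

Lemma min_weight_integrable t : 0 < t ->
  mu.-integrable setT (EFin \o (fun s => Num.min t s^-1 * m s)).
Proof.
move=> t0; apply: (@le_integrable _ _ _ mu setT measurableT _ (EFin \o (fun s => t * m s))).
- apply/measurable_EFinP; apply: measurable_funM.
    exact: measurable_minr (measurable_cst _) measurable_invr.
  exact: continuous_measurable_fun.
- move=> s _; rewrite lee_fin !normrM.
  have [sa|as_] := ltP s a; first by rewrite weight_le // normr0 !mulr0.
  have sp : 0 < s^-1 by rewrite invr_gt0 (lt_le_trans a0 as_).
  rewrite ler_wpM2r // !ger0_norm ?ge_min ?lexx //; first exact: ltW.
  by rewrite le_min !ltW.
- have mi := supp_integrable cm m0.
  have := integrableZl measurableT t mi.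
  by apply: eq_integrable => // s _; rewrite /= EFinM.
Qed.

Hypothesis ab : a <= b.
Hypothesis I0 : \int[mu]_s m s = 0.

Lemma profile_small t : 0 < t -> t < b^-1 -> profile t = 0.
Proof.
move=> t0 tb; have b0 : 0 < b := lt_le_trans a0 ab.
have bt : b <= t^-1 by rewrite -[b]invrK lef_pV2 ?posrE ?invr_gt0 // ltW.
rewrite /profile !(primitive_large a0 mV0) // (primitive_large a0 m0) // I0.
by rewrite subrr mulr0 addr0.
Qed.

Lemma profile_large t : a^-1 < t -> profile t = primitive0 mV b.
Proof.
move=> ta; have a1 : 0 < a^-1 by rewrite invr_gt0.
have t1 : t^-1 < a by rewrite -[a]invrK ltf_pV2 ?posrE // (lt_trans a1).
by rewrite /profile (primitive_small mV0 t1) (primitive_small m0 t1) subr0 mulr0 addr0.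
Qed.

Lemma profileE t : 0 < t -> profile t = min_transform m t.
Proof.
move=> t0; have b0 : 0 < b := lt_le_trans a0 ab.
pose B := t^-1 + b; have ti : 0 < t^-1 by rewrite invr_gt0.
rewrite /min_transform (@Rintegral_supp _ _ mu `[0, B]%classic) //; last first.
  move=> s sB; rewrite m0 ?mulr0 //= in_itv /= => /andP[as_ sb]; apply: sB.
  rewrite /= in_itv /= (le_trans (ltW a0) as_) /= (le_trans sb) //.
  by rewrite /B lerDr ltW.
have E1 s : 0 <= s -> s <= t^-1 -> Num.min t s^-1 * m s = t * m s.
  move=> s0 st; have [sa|as_] := ltP s a; first by rewrite weight_le // !mulr0.
  have sp := lt_le_trans a0 as_.
  by rewrite min_l // -[t]invrK lef_pV2 ?posrE.
have E2 s : t^-1 <= s -> Num.min t s^-1 * m s = mV s.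
  move=> ts; have sp := lt_le_trans ti ts.
  rewrite min_r; first by rewrite /mV mulrC.
  by rewrite -[t]invrK lef_pV2 ?posrE.
have U : `[0, B]%classic = `[0, t^-1]%classic `|` `]t^-1, B]%classic.
  have tB : t^-1 <= B by rewrite /B lerDl ltW.
  by rewrite (@itv_bndbnd_setU _ _ (BLeft 0) (BRight t^-1) (BRight B)) // bnd_simp // ltW.
have mi := supp_integrable cm m0.
have mVi := supp_integrable cmV mV0.
have Ii : mu.-integrable `[0, B] (EFin \o (fun s => Num.min t s^-1 * m s)).
  by apply: integrableS (min_weight_integrable t0).
rewrite U Rintegral_setU //; last 2 first.
- by rewrite -U.
- rewrite disj_set2E; apply/eqP/seteqP; split=> // s [] /=.
  by rewrite !in_itv /= => /andP[_ st] /andP[ts _]; move: (lt_le_trans ts st); rewrite ltxx.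
rewrite (@eq_Rintegral _ _ _ mu _ (fun s => t * m s)); last first.
  by move=> s; rewrite inE /= in_itv /= => /andP[s0 st]; rewrite E1.
rewrite (@eq_Rintegral _ _ _ mu `]t^-1, B]%classic mV); last first.
  by move=> s; rewrite inE /= in_itv /= => /andP[ts sB]; rewrite E2 // ltW.
rewrite RintegralZl //; last exact: integrableS mi.
rewrite -(Rintegral_itvB (a := BLeft 0)) //; last 3 first.
- exact: integrableS mVi.
- by rewrite bnd_simp ltW.
- by rewrite bnd_simp /B lerDl ltW.
rewrite /profile addrC; congr (_ + (_ - _)).
rewrite (primitive_large a0 mV0) // -(primitive_large a0 mV0 (t := B)) //.
by rewrite /B lerDr ltW.
Qed.

End profile.
End radial_profiles.

(** * Averages over level sets for weights of integral zero *)

Section level_sets.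
Context {R : realType} {n : nat}.
Variables (A : 'rV[R]_n -> 'M[R]_n) (Gamma : 'rV[R]_n -> 'rV[R]_n -> R).
Local Notation V := ('rV[R]_n).
Hypothesis hA : admissible_operator A.
Hypothesis hG : fundamental_solution A Gamma.
Implicit Types (x y z : V).
Local Notation gam := (gam Gamma).
Local Notation mu := (@lebesgue_measure R).

Lemma closed_dist_ge x (d : R) : closed [set y | d <= `|y - x|].
Proof.
rewrite (_ : mkset _ = (fun y : V => `|y - x|) @^-1` [set r | d <= r]) //.
apply: closed_comp => [z _|]; last exact: closed_ge.
apply: continuous_comp; last exact: norm_continuous.
by apply: continuousB => //; exact: cst_continuous.
Qed.

Lemma compact_shell x (d M : R) :
  compact [set y | `|y| <= M /\ d <= `|y - x|].
Proof.
rewrite (_ : mkset _ = [set y | `|y| <= M] `&` [set y | d <= `|y - x|]) //.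
by apply: compact_closedI; [exact: compact_norm_le|exact: closed_dist_ge].
Qed.

Lemma shell_neq x y (d : R) : 0 < d -> d <= `|y - x| -> y != x.
Proof. by move=> d0; apply: contraTneq => ->; rewrite subrr normr0 -ltNge. Qed.

Lemma gam_upper x (d : R) : 0 < d ->
  exists C : R, forall y, d <= `|y - x| -> gam x y <= C.
Proof.
move=> d0; have [M HM] := gam_infty hG x ltr01.
have [|C C0 HC] := @continuous_bounded_on R n _ (gam x) (@compact_shell x d M).
  apply: continuous_in_subspaceT => y; rewrite inE /= => -[_ dy].
  by apply: (gam_continuous hG); rewrite eq_sym; exact: shell_neq dy.
exists (Num.max 1 C) => y dy; rewrite le_max; have [My|My] := leP `|y| M.
  by rewrite (le_trans (ler_norm _) (HC y _)) ?orbT.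
by rewrite ltW // HM.
Qed.

Lemma gam_lower x (M : R) :
  exists2 c : R, 0 < c & forall y, y != x -> `|y| <= M -> c <= gam x y.
Proof.
have [d d0 Hd] := gam_pole hG x 1.
have [|C C0 HC] := @continuous_bounded_on R n _ (fun y => (gam x y)^-1) (@compact_shell x d M).
  apply: continuous_in_subspaceT => y; rewrite inE /= => -[_ dy].
  have xy : x != y by rewrite eq_sym; exact: shell_neq dy.
  exact: (cvgV (lt0r_neq0 (gam_gt0 hG xy)) (gam_continuous hG xy)).
exists (Num.min 1 C^-1); first by rewrite lt_min ltr01 invr_gt0.
move=> y yx My; rewrite ge_min; have [dy|dy] := leP d `|y - x|; last first.
  by rewrite ltW ?Hd.
have g0 : 0 < gam x y by rewrite (gam_gt0 hG) // eq_sym.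
apply/orP; right; rewrite -[leRHS]invrK lef_pV2 ?posrE ?invr_gt0 //.
exact: le_trans (ler_norm _) (HC y (conj My dy)).
Qed.

(** The [r] for which [y] lies on the level set that bounds [Omega r x].  It is
    0 at [y = x], in agreement with its limit there. *)
Definition level_radius x y : R := (gam x y)^-1.

Lemma level_radiusxx x : level_radius x x = 0.
Proof. by rewrite /level_radius gamxx invr0. Qed.

Lemma level_radius_gt0 x y : y != x -> 0 < level_radius x y.
Proof. by move=> yx; rewrite invr_gt0 (gam_gt0 hG) // eq_sym. Qed.

Lemma level_radius_continuous x y : y != x -> {for y, continuous (level_radius x)}.
Proof.
move=> yx; have xy : x != y by rewrite eq_sym.
exact: (cvgV (lt0r_neq0 (gam_gt0 hG xy)) (gam_continuous hG xy)).
Qed.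

Lemma level_radius_small x (a : R) : 0 < a ->
  exists2 d : R, 0 < d & forall y, `|y - x| < d -> level_radius x y < a.
Proof.
move=> a0; have [d d0 Hd] := gam_pole hG x a^-1; exists d => // y yd.
have [->|yx] := eqVneq y x; first by rewrite level_radiusxx.
have h := Hd y yx yd; have ia0 : 0 < a^-1 by rewrite invr_gt0.
by rewrite /level_radius -[a]invrK ltf_pV2 ?posrE // (lt_trans ia0).
Qed.

Lemma level_radius_proper x (b : R) :
  exists M : R, forall y, level_radius x y <= b -> `|y| <= M.
Proof.
have b0 : 0 < `|b| + 1 by rewrite ltr_wpDl.
have e0 : 0 < (`|b| + 1)^-1 by rewrite invr_gt0.
have [M HM] := gam_infty hG x e0; exists (Num.max M `|x|) => y yb.
rewrite leNgt gt_max; apply/negP => /andP[My xy].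
have yx : y != x by apply: contraTneq xy => ->; rewrite ltxx.
have g0 : 0 < gam x y by rewrite (gam_gt0 hG) // eq_sym.
have := HM y My; rewrite -[ltLHS]invrK ltf_pV2 ?posrE ?invr_gt0 // => h.
have := lt_le_trans h yb; rewrite ltNge => /negP; apply.
by rewrite (le_trans (ler_norm b)) // lerDl.
Qed.

Lemma energy_ge0 (f : V -> R) y : 0 <= energy A f f y.
Proof.
have -> : energy A f f y = (((grad f y)^T *m A y) *m grad f y) ord0 ord0.
  rewrite /energy mxE exchange_big; apply: eq_bigr => j _.
  rewrite mxE mulr_suml; apply: eq_bigr => i _.
  by rewrite !mxE; ring.
exact: coef_nonneg.
Qed.

Lemma energyE (f : V -> R) y :
  ((A y *m grad f y)^T *m grad f y) ord0 ord0 = energy A f f y.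
Proof.
rewrite /energy mxE; apply: eq_bigr => i _.
rewrite !mxE mulr_suml; apply: eq_bigr => j _.
by rewrite !mxE; ring.
Qed.

(** Minus the image under the operator of [profile m \o gam x]: the second
    derivative of the profile contributes [m r * r ^+ 2], with [r] the level
    radius of [y]. *)
Definition density (m : R -> R) x y : R :=
  m (level_radius x y) * level_radius x y ^+ 2 * energy A (gam x) (gam x) y.

Section one_weight.
Variables (x : V) (m : R -> R) (a b : R).
Hypothesis wm : weight a b m.

Lemma density_off y : b < level_radius x y -> density m x y = 0.
Proof. by move=> yb; rewrite /density (weight_ge wm) // !mul0r. Qed.

Lemma density_near y : level_radius x y < a -> density m x y = 0.
Proof. by move=> ya; rewrite /density (weight_le wm) // !mul0r. Qed.

Lemma ball_near : exists2 d : R, 0 < d & forall y, ball x d y -> level_radius x y < a.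
Proof.
have [d d0 Hd] := level_radius_small x (weight_gt0 wm); exists d => // y.
by rewrite -ball_normE /= distrC; exact: Hd.
Qed.

Lemma setT_punctured (d : R) : 0 < d -> [set: V] = ~` [set x] `|` ball x d.
Proof.
move=> d0; apply/esym/seteqP; split=> // y _.
have [->|yx] := eqVneq y x; first by right; exact: ballxx.
by left; apply/eqP.
Qed.

Lemma Ck_density : Ck ee 0 setT (density m x).
Proof.
have [d d0 Hd] := ball_near; rewrite (setT_punctured d0); apply: Ck_setU.
  have oU := @open_setC1 R n x.
  have cr : Ck ee 0 (~` [set x]) (level_radius x).
    by split=> // y /eqP yx; exact: level_radius_continuous.
  apply: (Ck_mul oU); last first.
    by apply: (Ck_energy (cA hA) oU); exact: gam_Coo hG x 1%N.
  apply: (Ck_mul oU); last by apply: (Ck_mul oU).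
  exact: (Ck_comp oU (W := setT) (fun _ _ => Logic.I) (weight_Coo wm 0%N) cr).
apply: (Ck_eq (f := fun=> 0)); first exact: ball_open.
  by move=> y; rewrite inE => /Hd/density_near.
by apply: Ck_cst; exact: ball_open.
Qed.

Lemma density_continuous : continuous (density m x).
Proof. exact: Ck0_continuous Ck_density. Qed.

Lemma density_supp : exists M : R, forall y, M < `|y| -> density m x y = 0.
Proof.
have [M HM] := level_radius_proper x b; exists M => y My; apply: density_off.
by rewrite ltNge; apply/negP => /HM; rewrite leNgt My.
Qed.

Lemma density_bounded : exists C, forall y, `|density m x y| <= C.
Proof.
have [M HM] := density_supp.
have [|C C0 HC] := continuous_bounded_on (f := density m x) (@compact_norm_le R n M).
  exact: continuous_subspaceT density_continuous.
exists C => y; have [/HC//|/HM ->] := leP `|y| M.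
by rewrite normr0 ltW.
Qed.

Lemma integrable_density : (lebesgue_rV n).-integrable setT (EFin \o density m x).
Proof.
have [M HM] := density_supp.
exact: integrable_continuous_supp density_continuous HM.
Qed.

Lemma integrable_gam_density z :
  (lebesgue_rV n).-integrable setT (EFin \o (fun y => gam z y * density m x y)).
Proof.
have [M HM] := density_supp; have [C HC] := density_bounded.
apply: (integrable_gamM hA hG z _ HC HM).
exact: continuous_measurable_rV density_continuous.
Qed.

Lemma density_ge0 : (forall t, 0 <= m t) -> forall y, 0 <= density m x y.
Proof.
move=> m0 y; apply: mulr_ge0; last exact: energy_ge0.
by apply: mulr_ge0; [exact: m0|exact: sqr_ge0].
Qed.

Section null_weight.
Hypotheses (ab : a <= b) (I0 : \int[mu]_s m s = 0).

Let c := primitive0 (fun s => m s * s^-1) b.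
Let phi y := if y == x then c else profile m b (gam x y).

Let phi_near y : level_radius x y < a -> phi y = c.
Proof.
rewrite /phi; case: eqVneq => // yx ya; apply: (profile_large wm).
have r0 := level_radius_gt0 yx; rewrite -[ltRHS]invrK ltf_pV2 ?posrE //.
exact: weight_gt0 wm.
Qed.

Let phi_off y : b < level_radius x y -> phi y = 0.
Proof.
move=> yb; have b0 : 0 < b := lt_le_trans (weight_gt0 wm) ab.
have yx : y != x by apply: contraTneq yb => ->; rewrite level_radiusxx -leNgt ltW.
have g0 : 0 < gam x y by rewrite (gam_gt0 hG) // eq_sym.
rewrite /phi (negbTE yx) (profile_small wm ab I0) //.
by rewrite -[ltLHS]invrK ltf_pV2 ?posrE // invr_gt0.
Qed.

Let phi_comp y : (~` [set x]) y -> phi y = (profile m b \o gam x) y.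
Proof. by move=> /eqP /negbTE yx; rewrite /phi yx. Qed.

Let phi_Coo : Coo ee setT phi.
Proof.
move=> k; have [d d0 Hd] := ball_near; rewrite (setT_punctured d0); apply: Ck_setU.
  have oU := @open_setC1 R n x.
  apply: (Ck_eq (f := profile m b \o gam x)) => //.
    by move=> y; rewrite inE => /phi_comp.
  apply: (Ck_comp oU _ (Coo_profile wm k) (gam_Coo hG x k)) => y /eqP yx.
  by rewrite /pos_set /= (gam_gt0 hG) // eq_sym.
apply: (Ck_eq (f := fun=> c)); first exact: ball_open.
  by move=> y; rewrite inE => /Hd/phi_near.
by apply: Ck_cst; exact: ball_open.
Qed.

Let div_phi y : div_op A phi y = - density m x y.
Proof.
have [d d0 Hd] := ball_near; have [->|yx] := eqVneq y x.
  rewrite density_near ?oppr0; last by apply: Hd; exact: ballxx.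
  rewrite (@div_op_on_open _ _ A (ball x d) phi (fun=> c)); last 3 first.
  - exact: ball_open.
  - by move=> z /Hd/phi_near.
  - exact: ballxx.
  have p0 i : partial i (fun _ : V => c) = fun=> 0.
    by apply/funext => z; apply: partialE; exact: is_derive_const.
  rewrite /div_op big1 // => i _; rewrite big1 // => j _.
  by apply: partialE; rewrite p0; under eq_fun do rewrite mulr0; exact: is_derive_const.
have oU := @open_setC1 R n x; have Uy : (~` [set x]) y by exact/eqP.
have g0 : 0 < gam x y by rewrite (gam_gt0 hG) // eq_sym.
rewrite (div_op_on_open A oU phi_comp Uy).
rewrite (div_op_comp (cA hA) oU (gam_Coo hG x 2%N) (Coo_profile wm 2%N) _ Uy); last first.
  by move=> z /eqP zx; rewrite /pos_set /= (gam_gt0 hG) // eq_sym.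
by rewrite (gam_harmonic hA hG yx) mulr0 addr0 (profile_derive2 wm g0) mulNr.
Qed.

(** For a weight of integral 0, [profile m \o gam x] vanishes far away and is
    constant near the pole, so that it is a test function. *)
Lemma integral_null_density :
  (\int[lebesgue_rV n]_y (density m x y)%:E = 0)%E.
Proof.
have [M HM] := level_radius_proper x b.
have phiM y : M < `|y| -> phi y = 0.
  by move=> My; apply: phi_off; rewrite ltNge; apply/negP => /HM; rewrite leNgt My.
have cK : closed [set y : V | `|y| <= M].
  by apply: compact_closed (@compact_norm_le R n M); exact: norm_hausdorff.
have := integral_div_op0 (cA hA) cK (fun y h => h) (phi_Coo 2%N).
have phiK y : ~ [set y : V | `|y| <= M] y -> phi y = 0.
  by move=> /negP; rewrite -ltNge => /phiM.
move=> /(_ phiK).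
under eq_integral do rewrite div_phi EFinN.
rewrite integralN /=; last by exact: integrable_add_def integrable_density.
by move=> /eqP; rewrite oppe_eq0 => /eqP.
Qed.

(** The same test function in the equation satisfied by the fundamental solution
    with pole [z]. *)
Lemma integral_gam_null_density z : z != x ->
  (\int[lebesgue_rV n]_y (gam z y * density m x y)%:E =
   (min_transform m (gam x z))%:E)%E.
Proof.
move=> zx; have [M HM] := level_radius_proper x b.
have phiM y : M < `|y| -> phi y = 0.
  by move=> My; apply: phi_off; rewrite ltNge; apply/negP => /HM; rewrite leNgt My.
have := gam_eqE hA hG z phi_Coo phiM.
under eq_integral do rewrite div_phi mulrN EFinN.
rewrite integralN /=; last exact: integrable_add_def (integrable_gam_density z).
rewrite EFinN => /eqP; rewrite eqe_opp => /eqP ->.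
have g0 : 0 < gam x z by rewrite (gam_gt0 hG) // eq_sym.
by rewrite /phi (negbTE zx) (profileE wm).
Qed.

End null_weight.
End one_weight.
End level_sets.

(** * Averages over level sets for nonnegative weights *)

Lemma monotone_cvg_real d (T : measurableType d) (R : realType)
  (m : {measure set T -> \bar R}) (g : nat -> T -> R) (h : T -> R) :
  (forall k, measurable_fun setT (g k)) -> (forall k x, 0 <= g k x) ->
  (forall x, {homo g^~ x : i j / (i <= j)%N >-> i <= j}) ->
  (forall x, g k x @[k --> \oo] --> h x) ->
  (\int[m]_x (g k x)%:E @[k --> \oo] --> \int[m]_x (h x)%:E)%E.
Proof.
move=> mg g0 ndg gh.
have H := @cvg_monotone_convergence _ T R m setT measurableT
  (fun k x => (g k x)%:E) _ _ _.
rewrite [X in _ --> X](_ : _ = (\int[m]_x limn (fun k => (g k x)%:E))%E).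
  apply: H.
  - by move=> k; exact/measurable_EFinP.
  - by move=> k x _; rewrite lee_fin.
  - by move=> x _ i j ij; rewrite lee_fin; exact: ndg.
apply: eq_integral => x _; apply/esym/cvg_lim => //.
by apply/fine_cvgP; split; [exact: nearW|exact: gh].
Qed.

Section weights.
Context {R : realType}.
Local Notation mu := (@lebesgue_measure R).

Lemma weight_comb (a b a' b' c : R) (m m' : R -> R) : weight a b m ->
  weight a' b' m' ->
  weight (Num.min a a') (Num.max b b') (fun s => m s + c * m' s).
Proof.
move=> w w'; split.
- by rewrite lt_min (weight_gt0 w) (weight_gt0 w').
- move=> k; apply: Ck_add; [exact: openT|exact: weight_Coo w k|].
  apply: Ck_mul; [exact: openT| |exact: weight_Coo w' k].
  by apply: Ck_cst; exact: openT.
- move=> t tab; rewrite (weight_off w) ?(weight_off w') ?mulr0 ?addr0 //.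
    move=> /=; rewrite in_itv /= => /andP[h1 h2]; apply: tab.
    by rewrite /= in_itv /= ge_min le_max h1 h2 !orbT.
  move=> /=; rewrite in_itv /= => /andP[h1 h2]; apply: tab.
  by rewrite /= in_itv /= ge_min le_max h1 h2.
Qed.

Lemma weight_scale (a b c : R) (m : R -> R) : weight a b m ->
  weight a b (fun s => c * m s).
Proof.
move=> w; split; first exact: weight_gt0 w.
- move=> k; apply: Ck_mul; [exact: openT| |exact: weight_Coo w k].
  by apply: Ck_cst; exact: openT.
- by move=> t /(weight_off w) ->; rewrite mulr0.
Qed.

Lemma weight_integrable (a b : R) (m : R -> R) : weight a b m ->
  mu.-integrable setT (EFin \o m).
Proof.
by move=> w; apply: (supp_integrable (weight_continuous w) (weight_off w)).
Qed.

Lemma flat0_affine (c d : R) : Coo1 setT (fun s => flat0 (c * s + d)).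
Proof.
move=> k; apply: (Ck_comp (@openT R) (W := setT) (F := flat0)
  (f := fun s : R => c * s + d) (fun _ _ => Logic.I) (@flat_Coo R k)).
apply: Ck_add; [exact: openT| |by apply: Ck_cst; exact: openT].
apply: Ck_mul; [exact: openT|by apply: Ck_cst; exact: openT|].
case: k => [|k]; first by split=> // t _; exact: cvg_id.
apply: (CkS_intro (g := fun _ _ => 1)); first exact: openT.
- by move=> t _; exact: cvg_id.
- by move=> i; apply: Ck_cst; exact: openT.
Qed.

(** A smooth bump on the interval from [r] to [r + 1]. *)
Definition hump r s : R := flat0 (s - r) * flat0 (r + 1 - s).

Lemma weight_hump r : 0 < r -> weight r (r + 1) (hump r).
Proof.
move=> r0; split=> //.
- move=> k; have -> : hump r =
      (fun s => flat0 (1 * s + (- r)) * flat0 ((-1) * s + (r + 1))).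
    by apply/funext => s; rewrite /hump mul1r mulN1r [- s + _]addrC.
  by apply: Ck_mul; [exact: openT|exact: flat0_affine|exact: flat0_affine].
- move=> t /= tr; rewrite /hump; have [h1|h1] := leP t r.
    by rewrite flat0_le0 ?mul0r // subr_le0.
  rewrite [X in _ * X]flat0_le0 ?mulr0 // subr_le0 leNgt; apply/negP => h2.
  by apply: tr; rewrite in_itv /= !ltW.
Qed.

Lemma hump_ge0 r s : 0 <= hump r s.
Proof. by apply: mulr_ge0; exact: flat0_ge0. Qed.

Lemma hump_integral_gt0 r : 0 < r -> 0 < \int[mu]_s hump r s.
Proof.
move=> r0; have hi := weight_integrable (weight_hump r0).
apply: fine_gt0; apply/andP; split; last first.
  by rewrite ltey_eq (integrable_fin_num measurableT hi).
apply: (@integral_gt0 R _ _ mu `]r, (r + 1)[%classic) => //.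
- by apply/measurable_EFinP; case/integrableP : hi.
- exact: hump_ge0.
- rewrite [X in (_ < X)%E]lebesgue_measure_itv /= lte_fin ltrDl ltr01.
  by rewrite -EFinB lte_fin; lra.
- by move=> s /=; rewrite in_itv /= => /andP[h1 h2]; rewrite mulr_gt0 // flat0_gt0 // subr_gt0.
Qed.

Definition unit_hump r s : R := (\int[mu]_s hump r s)^-1 * hump r s.

Lemma weight_unit_hump r : 0 < r -> weight r (r + 1) (unit_hump r).
Proof. by move=> /weight_hump; exact: weight_scale. Qed.

Lemma unit_hump_ge0 r s : 0 < r -> 0 <= unit_hump r s.
Proof.
move=> r0; apply: mulr_ge0; last exact: hump_ge0.
by rewrite invr_ge0 ltW // hump_integral_gt0.
Qed.

Lemma integral_unit_hump r : 0 < r -> \int[mu]_s unit_hump r s = 1.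
Proof.
move=> r0; rewrite RintegralZl //; last exact: weight_integrable (weight_hump r0).
by rewrite mulVf // gt_eqF // hump_integral_gt0.
Qed.

End weights.

(** The two integrals [p] and [j] to be compared for a weight of mass [i]: the
    weight is made null by [i] times a unit hump, whose integrals [p'] and [j']
    are small. *)
Lemma exchange_dist (R : realFieldType) (i p j p' j' e c : R) :
  p + (- i) * p' = j + (- i) * j' -> 0 <= i -> 0 <= j' -> j' <= e ->
  0 <= p' -> p' <= e * c -> 0 <= e * c -> `|p - j| <= i * (e * (c + 1)).
Proof.
move=> E i0 j0 je p0 pe ec; have -> : p - j = i * (p' - j') by lra.
rewrite normrM (ger0_norm i0); apply: ler_wpM2l => //.
by rewrite ler_norml; lra.
Qed.

Section nonnegative_weights.
Context {R : realType} {n : nat}.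
Variables (A : 'rV[R]_n -> 'M[R]_n) (Gamma : 'rV[R]_n -> 'rV[R]_n -> R).
Local Notation V := ('rV[R]_n).
Hypothesis hA : admissible_operator A.
Hypothesis hG : fundamental_solution A Gamma.
Implicit Types (x y z : V).
Local Notation gam := (gam Gamma).
Local Notation mu := (@lebesgue_measure R).
Variables (x z : V).
Hypothesis zx : z != x.

Let D (m : R -> R) : R := \int[lebesgue_rV n]_y density A Gamma m x y.
Let P (m : R -> R) : R := \int[lebesgue_rV n]_y (gam z y * density A Gamma m x y).
Let J (m : R -> R) : R := min_transform m (gam x z).
Let I (m : R -> R) : R := \int[mu]_s m s.

Let g0 : 0 < gam x z.
Proof. by rewrite (gam_gt0 hG) // eq_sym. Qed.

Let density_comb (m m' : R -> R) c y :
  density A Gamma (fun s => m s + c * m' s) x y =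
  density A Gamma m x y + c * density A Gamma m' x y.
Proof. by rewrite /density; ring. Qed.

Let I_comb a b m a' b' m' c : weight a b m -> weight a' b' m' ->
  I (fun s => m s + c * m' s) = I m + c * I m'.
Proof.
move=> w w'; have i := weight_integrable w; have i' := weight_integrable w'.
rewrite /I RintegralD //; first by rewrite RintegralZl.
exact: weight_integrable (weight_scale c w').
Qed.

Let D_comb a b m a' b' m' c : weight a b m -> weight a' b' m' ->
  D (fun s => m s + c * m' s) = D m + c * D m'.
Proof.
move=> w w'; have i := integrable_density hA hG x w.
have i' := integrable_density hA hG x w'.
rewrite /D (eq_Rintegral _ (g := fun y => density A Gamma m x y +
  c * density A Gamma m' x y)); last by move=> y _; exact: density_comb.
rewrite RintegralD //; first by rewrite RintegralZl.
have := integrableZl measurableT c i'.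
by apply: eq_integrable => // y _; rewrite /= EFinM.
Qed.

Let P_comb a b m a' b' m' c : weight a b m -> weight a' b' m' ->
  P (fun s => m s + c * m' s) = P m + c * P m'.
Proof.
move=> w w'; have i := integrable_gam_density hA hG x w z.
have i' := integrable_gam_density hA hG x w' z.
rewrite /P (eq_Rintegral _ (g := fun y => gam z y * density A Gamma m x y +
  c * (gam z y * density A Gamma m' x y))); last first.
  by move=> y _; rewrite density_comb; ring.
rewrite RintegralD //; first by rewrite RintegralZl.
have := integrableZl measurableT c i'.
by apply: eq_integrable => // y _; rewrite /= EFinM.
Qed.

Let J_comb a b m a' b' m' c : weight a b m -> weight a' b' m' ->
  J (fun s => m s + c * m' s) = J m + c * J m'.
Proof.
move=> w w'; have i := min_weight_integrable w g0.
have i' := min_weight_integrable w' g0.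
rewrite /J /min_transform (eq_Rintegral mu (g := fun s : R => Num.min (gam x z) s^-1 * m s +
  c * (Num.min (gam x z) s^-1 * m' s))); last by move=> s _; ring.
rewrite RintegralD //; first by rewrite RintegralZl.
have := integrableZl measurableT c i'.
by apply: eq_integrable => // y _; rewrite /= EFinM.
Qed.

Let null_weight a b m a' b' m' c : weight a b m -> weight a' b' m' -> a <= b ->
  I m + c * I m' = 0 -> (D m + c * D m' = 0) /\ (P m + c * P m' = J m + c * J m').
Proof.
move=> w w' ab I0; have W := weight_comb c w w'.
rewrite -(I_comb c w w') in I0.
have AB : Num.min a a' <= Num.max b b' by rewrite ge_min !le_max ab.
rewrite -(D_comb c w w') -(P_comb c w w') -(J_comb c w w'); split.
  by rewrite /D /Rintegral (integral_null_density hA hG x W AB I0).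
by rewrite /P /Rintegral (integral_gam_null_density hA hG W AB I0 zx).
Qed.

(** A hump moved out to infinity turns any weight into a null one, and its own
    contribution vanishes in the limit: its total mass does not depend on its
    position, and [Gamma z] tends to 0 at infinity. *)
Let far_hump e : 0 < e -> exists2 r : R, 0 < r &
  [/\ 0 <= J (unit_hump r), J (unit_hump r) <= e, 0 <= P (unit_hump r) &
      P (unit_hump r) <= e * D (unit_hump r)].
Proof.
move=> e0; have [M HM] := gam_infty hG z e0.
have [c c0 Hc] := gam_lower hG x M.
have ie : 0 < e^-1 by rewrite invr_gt0.
have ic : 0 < c^-1 by rewrite invr_gt0.
pose r := e^-1 + c^-1; have r0 : 0 < r by rewrite addr_gt0.
exists r => //; have w := weight_unit_hump r0.
have h0 s := unit_hump_ge0 s r0.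
have small s : s <= r -> unit_hump r s = 0.
  by move=> sr; rewrite /unit_hump /hump flat0_le0 ?mul0r ?mulr0 // subr_le0.
have iJ := min_weight_integrable w g0.
have iP := integrable_gam_density hA hG x w z.
have iD := integrable_density hA hG x w.
have iI := weight_integrable w.
split.
- apply: Rintegral_ge0 => s _; have [/small ->|rs] := leP s r; first by rewrite mulr0.
  apply: mulr_ge0 => //; rewrite le_min (ltW g0) invr_ge0 ltW //.
  exact: lt_trans rs.
- rewrite -[e]mulr1 -(integral_unit_hump r0) -RintegralZl //.
  apply: le_Rintegral => //.
    have := integrableZl measurableT e iI.
    by apply: eq_integrable => // y _; rewrite /= EFinM.
  move=> s _; have [/small ->|rs] := leP s r; first by rewrite !mulr0.
  apply: ler_wpM2r => //; rewrite ge_min; apply/orP; right.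
  rewrite -[e]invrK lef_pV2 ?posrE //; last exact: lt_trans rs.
  by apply: le_trans (ltW rs); rewrite /r lerDl ltW.
- apply: Rintegral_ge0 => y _; apply: mulr_ge0; first exact: gam_ge0 hG z y.
  exact: density_ge0.
- rewrite -RintegralZl //; apply: le_Rintegral => //.
    have := integrableZl measurableT e iD.
    by apply: eq_integrable => // y _; rewrite /= EFinM.
  move=> y _; have [yr|yr] := leP (level_radius Gamma x y) r.
    by rewrite /density small // !mul0r !mulr0.
  apply: ler_wpM2r; first exact: density_ge0.
  apply/ltW/HM; rewrite ltNge; apply/negP => yM.
  have yx : y != x.
    by apply: contraTneq yr => ->; rewrite level_radiusxx -leNgt ltW.
  have := Hc y yx yM; apply/negP; rewrite -ltNge.
  rewrite -[c]invrK -[ltLHS]invrK ltf_pV2 ?posrE ?(level_radius_gt0 hG) //.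
  by apply: le_lt_trans yr; rewrite /r lerDr ltW.
Qed.

(** For a weight [m] of integral [I], subtract [I] times a unit hump far out and
    let it go to infinity. *)
Lemma integral_gam_density a b m : weight a b m -> a <= b ->
  (forall s, 0 <= m s) ->
  (\int[lebesgue_rV n]_y (gam z y * density A Gamma m x y)%:E =
   \int[mu]_s (Num.min (gam x z) s^-1 * m s)%:E)%E.
Proof.
move=> w ab m0.
suff PJ : P m = J m.
  have fP := integrable_fin_num measurableT (integrable_gam_density hA hG x w z).
  have fJ := integrable_fin_num measurableT (min_weight_integrable w g0).
  by rewrite -[LHS](fineK fP) -[RHS](fineK fJ); congr EFin.
have I0 : 0 <= I m by apply: Rintegral_ge0 => s _; exact: m0.
set C := D (unit_hump 1).
have w1 := weight_unit_hump (@ltr01 R).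
have C0 : 0 <= C.
  by apply: Rintegral_ge0 => y _; apply: density_ge0 => // s; exact: unit_hump_ge0.
suff H e : 0 < e -> `|P m - J m| <= I m * (e * (C + 1)).
  apply/eqP; rewrite -subr_eq0 -normr_le0; apply/ler_addgt0Pr => e e0; rewrite add0r.
  have k0 : 0 < I m * (C + 1) + 1 by rewrite ltr_wpDl // mulr_ge0 // addr_ge0.
  apply: le_trans (H (e / (I m * (C + 1) + 1)) _) _; first by rewrite divr_gt0.
  rewrite mulrCA mulrAC ler_pdivrMr //; apply: ler_wpM2l; first exact: ltW.
  by rewrite lerDl.
move=> e0; have [r r0 [J0 Je P0 Pe]] := far_hump e0.
have wr := weight_unit_hump r0.
have rr : r <= r + 1 by rewrite lerDl.
have I1 := integral_unit_hump r0; rewrite -/(I _) in I1.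
have I1' := integral_unit_hump (@ltr01 R); rewrite -/(I _) in I1'.
have c1 : I (unit_hump r) + (-1) * I (unit_hump 1) = 0.
  by rewrite I1 I1' mulN1r subrr.
have c2 : I m + (- I m) * I (unit_hump r) = 0 by rewrite I1 mulr1 subrr.
have [DC _] := null_weight wr w1 rr c1.
have [_ E] := null_weight w wr ab c2.
rewrite -/C in DC; clearbody C.
have DE : D (unit_hump r) = C by move/eqP: DC; rewrite mulN1r subr_eq0 => /eqP.
rewrite DE in Pe; apply: (exchange_dist E) => //.
by rewrite mulr_ge0 // ltW.
Qed.

End nonnegative_weights.

(** * Averages of the fundamental solution over the balls *)

Section power_weight.
Context {R : realType}.
Variables (al r : R).
Hypothesis r0 : 0 < r.
Local Notation mu := (@lebesgue_measure R).

(** Up to a constant, the weight for which the density of the average is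
    [kernelK] on the ball of size [r]. *)
Definition power_weight s : R := if 0 < s < r then s `^ al else 0.

(** Smooth truncations of the power weight away from 0 and [r].  They increase
    with [k] because [flat0] increases, to 1 at infinity. *)
Definition trunc_weight (k : nat) s : R :=
  s `^ al * (flat0 (k.+1%:R * s + - 1) * flat0 (- k.+1%:R * s + k.+1%:R * r)).

Lemma trunc_weight_le k s : s <= k.+1%:R^-1 -> trunc_weight k s = 0.
Proof.
move=> sk; rewrite /trunc_weight (flat0_le0 (t := _ * s + - 1)) ?mul0r ?mulr0 //.
have k0 : 0 < k.+1%:R :> R by rewrite ltr0n.
by rewrite subr_le0 mulrC -ler_pdivlMr // div1r.
Qed.

Lemma trunc_weight_ge k s : r <= s -> trunc_weight k s = 0.
Proof.
move=> rs; rewrite /trunc_weight [X in _ * (_ * X)]flat0_le0 ?mulr0 //.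
by rewrite mulNr addrC subr_le0 ler_pM2l // ltr0n.
Qed.

Lemma weight_trunc k : weight k.+1%:R^-1 (r + 1) (trunc_weight k).
Proof.
have k0 : 0 < k.+1%:R^-1 :> R by rewrite invr_gt0 ltr0n.
split=> //.
- move=> j; pose U := [set s : R | s < k.+1%:R^-1].
  have oU : open U by exact: open_lt.
  have -> : [set: R] = pos_set `|` U.
    apply/esym/seteqP; split=> // s _; have [s0|s0] := ltP 0 s; first by left.
    by right; exact: le_lt_trans k0.
  apply: Ck_setU.
    apply: Ck_mul; [exact: open_pos_set|exact: Coo_powR|].
    by apply: Ck_mul; [exact: open_pos_set| |];
      apply: Ck_sub (@flat0_affine R _ _ j).
  apply: (Ck_eq oU _ (Ck_cst _ j 0 oU)) => s; rewrite inE /U /= => sk.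
  by rewrite trunc_weight_le // ltW.
- move=> t tr; have [h1|h1] := leP t k.+1%:R^-1; first exact: trunc_weight_le.
  rewrite trunc_weight_ge // leNgt; apply/negP => h2; apply: tr.
  by rewrite /= in_itv /= (ltW h1) (le_trans (ltW h2)) // lerDl.
Qed.

Lemma trunc_weight_ge0 k s : 0 <= trunc_weight k s.
Proof.
by apply: mulr_ge0; [exact: powR_ge0|apply: mulr_ge0; exact: flat0_ge0].
Qed.

Lemma trunc_weight_mono s :
  {homo trunc_weight^~ s : i j / (i <= j)%N >-> i <= j}.
Proof.
move=> i j ij; have [s0|s0] := leP s 0.
  by rewrite !trunc_weight_le // (le_trans s0).
have [rs|sr] := leP r s; first by rewrite !trunc_weight_ge.
have ijR : i.+1%:R <= j.+1%:R :> R by rewrite ler_nat.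
apply: ler_wpM2l; first exact: powR_ge0.
apply: ler_pM; rewrite ?flat0_ge0 //; apply: flat0_mono.
  by rewrite lerD2r ler_pM2r.
by rewrite !mulNr ![- _ + _]addrC -!mulrBr ler_pM2r // subr_gt0.
Qed.

Lemma flat0_affine_cvg (c d : R) : 0 < c ->
  flat0 (k.+1%:R * c + d) @[k --> \oo] --> (1 : R).
Proof.
move=> c0; apply: (cvg_comp (fun k : nat => k.+1%:R * c + d) flat0); last exact: flat0_cvg1.
apply/cvgryPgt => B; near=> k.
rewrite -ltrBlDr -ltr_pdivrMr //; apply: (@lt_trans _ _ k%:R); last by rewrite ltr_nat.
near: k; exact: nbhs_infty_gtr.
Unshelve. all: end_near. Qed.

Lemma trunc_weight_cvg s : trunc_weight k s @[k --> \oo] --> power_weight s.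
Proof.
rewrite /power_weight; have [s0|s0] /= := ltP 0 s; last first.
  rewrite (_ : trunc_weight^~ s = fun=> 0); first exact: cvg_cst.
  by apply/funext => k; rewrite trunc_weight_le // (le_trans s0).
have [sr|rs] := ltP s r; last first.
  rewrite (_ : trunc_weight^~ s = fun=> 0); first exact: cvg_cst.
  by apply/funext => k; rewrite trunc_weight_ge.
rewrite -[X in _ --> X]mulr1; apply: cvgM; first exact: cvg_cst.
rewrite -[X in _ --> X]mulr1; apply: cvgM; first exact: flat0_affine_cvg.
rewrite (_ : (fun k => _) = (fun k => flat0 (k.+1%:R * (r - s) + 0))); last first.
  by apply/funext => k; rewrite addr0 mulNr addrC -mulrBr.
by apply: flat0_affine_cvg; rewrite subr_gt0.
Qed.

Lemma power_weight_ge0 s : 0 <= power_weight s.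
Proof. by rewrite /power_weight; case: ifP => // _; exact: powR_ge0. Qed.

End power_weight.

Section averaged_fundamental_solution.
Context {R : realType} {n : nat}.
Variables (A : 'rV[R]_n -> 'M[R]_n) (Gamma : 'rV[R]_n -> 'rV[R]_n -> R).
Local Notation V := ('rV[R]_n).
Hypothesis hA : admissible_operator A.
Hypothesis hG : fundamental_solution A Gamma.
Local Notation gam := (gam Gamma).
Local Notation mu := (@lebesgue_measure R).

Lemma integral_gam_power_density (al r : R) (x z : V) : 0 < r -> z != x ->
  (\int[lebesgue_rV n]_y (gam z y * density A Gamma (power_weight al r) x y)%:E =
   \int[mu]_s (Num.min (gam x z) s^-1 * power_weight al r s)%:E)%E.
Proof.
move=> r0 zx; have g0 : 0 < gam x z by rewrite (gam_gt0 hG) // eq_sym.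
have w k := weight_trunc al r k.
have ab k : k.+1%:R^-1 <= r + 1.
  rewrite (@le_trans _ _ 1) //; last by rewrite lerDr ltW.
  by rewrite invf_le1 ?ler1n ?ltr0n.
have L : (\int[lebesgue_rV n]_y (gam z y * density A Gamma (trunc_weight al r k) x y)%:E
    @[k --> \oo] -->
    \int[lebesgue_rV n]_y (gam z y * density A Gamma (power_weight al r) x y)%:E)%E.
  apply: monotone_cvg_real.
  - move=> k; apply: measurable_funM; first exact: measurable_gam hG z.
    apply: continuous_measurable_rV; exact: density_continuous hA hG x _ _ _ (w k).
  - move=> k y; apply: mulr_ge0; first exact: gam_ge0 hG z y.
    by apply: (density_ge0 Gamma hA) => s; exact: trunc_weight_ge0.
  - move=> y i j ij; apply: ler_wpM2l; first exact: gam_ge0 hG z y.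
    rewrite /density; apply: ler_wpM2r; first exact: (energy_ge0 hA).
    apply: ler_wpM2r; first exact: sqr_ge0.
    exact: trunc_weight_mono.
  - move=> y; apply: cvgM; first exact: cvg_cst.
    apply: cvgM; last exact: cvg_cst.
    apply: cvgM; last exact: cvg_cst.
    exact: trunc_weight_cvg.
have M : (\int[mu]_s (Num.min (gam x z) s^-1 * trunc_weight al r k s)%:E
    @[k --> \oo] -->
    \int[mu]_s (Num.min (gam x z) s^-1 * power_weight al r s)%:E)%E.
  have m0 k s : 0 <= Num.min (gam x z) s^-1 * trunc_weight al r k s.
    have [s0|s0] := leP s 0.
      by rewrite trunc_weight_le ?mulr0 // (le_trans s0).
    apply: mulr_ge0; last exact: trunc_weight_ge0.
    by rewrite le_min (ltW g0) invr_ge0 ltW.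
  apply: monotone_cvg_real => //.
  - move=> k; apply/measurable_EFinP.
    by case/integrableP : (min_weight_integrable (w k) g0).
  - move=> s i j ij; have [s0|s0] := leP s 0.
      by rewrite !trunc_weight_le ?mulr0 // (le_trans s0).
    apply: ler_wpM2l; last exact: trunc_weight_mono.
    by rewrite le_min (ltW g0) invr_ge0 ltW.
  - by move=> s; apply: cvgM; [exact: cvg_cst|exact: trunc_weight_cvg].
apply: (cvg_unique _ L); first exact: ereal_hausdorff.
rewrite (_ : (fun k => _) = (fun k =>
  \int[mu]_s (Num.min (gam x z) s^-1 * trunc_weight al r k s)%:E)%E) //.
apply/funext => k.
by rewrite (integral_gam_density hA hG zx (w k) (ab k)) // => s; exact: trunc_weight_ge0.
Qed.

End averaged_fundamental_solution.

(** * Convergence in mean *)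

Section mean_convergence.
Context d {T : measurableType d} {R : realType} (m : {measure set T -> \bar R}).
Implicit Types (D : set T).

Lemma dominated_mean_cvg D (F : nat -> T -> R) (f g : T -> R) : measurable D ->
  (forall k, measurable_fun D (F k)) -> measurable_fun D f ->
  (\forall x \ae m, D x -> F k x @[k --> \oo] --> f x) ->
  m.-integrable D (EFin \o g) ->
  (forall k x, D x -> `|F k x| <= g x) ->
  \int[m]_(x in D) `|F k x - f x| @[k --> \oo] --> (0 : R).
Proof.
move=> mD mF mf Ff gi Fg.
have [] := @dominated_convergence _ _ _ m D mD (fun k x => (F k x)%:E) (EFin \o f) (EFin \o g).
- by move=> k; exact/measurable_EFinP.
- exact/measurable_EFinP.
- apply: filterS Ff => x H Dx; apply/fine_cvgP.
  by split; [exact: nearW|exact: H].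
- exact: gi.
- by apply: aeW => x k Dx; rewrite /= lee_fin Fg.
by move=> _ + _ => /fine_cvg.
Qed.

(** Scheffe's lemma: the positive part of [h - H k] is dominated by [h], and
    adding twice this part to [H k - h] gives the absolute value. *)
Lemma scheffe D (H : nat -> T -> R) (h : T -> R) : measurable D ->
  (forall k, m.-integrable D (EFin \o H k)) -> m.-integrable D (EFin \o h) ->
  (forall k x, D x -> 0 <= H k x) -> (forall x, D x -> 0 <= h x) ->
  (\forall x \ae m, D x -> H k x @[k --> \oo] --> h x) ->
  \int[m]_(x in D) H k x @[k --> \oo] --> \int[m]_(x in D) h x ->
  \int[m]_(x in D) `|H k x - h x| @[k --> \oo] --> (0 : R).
Proof.
move=> mD Hi hi H0 h0 Hh IH.
pose P k x := Num.max (h x - H k x) 0.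
have mh : measurable_fun D h by apply/measurable_EFinP; case/integrableP : hi.
have mH k : measurable_fun D (H k).
  by apply/measurable_EFinP; case/integrableP : (Hi k).
have mP k : measurable_fun D (P k).
  by apply: measurable_maxr => //; exact: measurable_funB.
have P0 k x : 0 <= P k x by rewrite /P le_max lexx orbT.
have Ph k x : D x -> `|P k x| <= h x.
  move=> Dx; rewrite ger0_norm // /P ge_max h0 // andbT.
  by have := H0 k x Dx; lra.
have Pi k : m.-integrable D (EFin \o P k).
  apply: (le_integrable mD _ _ hi); first exact/measurable_EFinP.
  by move=> x Dx; rewrite lee_fin [leRHS]ger0_norm ?h0 // Ph.
have PL : \int[m]_(x in D) `|P k x - 0| @[k --> \oo] --> (0 : R).
  apply: (dominated_mean_cvg mD mP _ _ hi Ph); first exact: measurable_cst.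
  apply: filterS Hh => x Hx Dx.
  have c1 : h x - H k x @[k --> \oo] --> (0 : R).
    by rewrite -(subrr (h x)); apply: cvgB; [exact: cvg_cst|exact: Hx].
  apply: (@squeeze_cvgr _ _ _ _ (fun=> 0) (fun k => `|h x - H k x|)).
  - by apply: nearW => k; rewrite P0 /= /P ge_max ler_norm normr_ge0.
  - exact: cvg_cst.
  - by rewrite -[X in _ --> X](@normr0 _ R); exact: cvg_norm c1.
have E k : \int[m]_(x in D) `|H k x - h x| =
    (\int[m]_(x in D) H k x - \int[m]_(x in D) h x) + 2 * \int[m]_(x in D) `|P k x - 0|.
  have i1 : m.-integrable D (EFin \o (fun x => H k x - h x)).
    have := integrableB mD (Hi k) hi.
    by apply: eq_integrable => // x _; rewrite /= EFinB.
  have i2 : m.-integrable D (EFin \o (fun x => 2 * P k x)).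
    have := integrableZl mD 2 (Pi k).
    by apply: eq_integrable => // x _; rewrite /= EFinM.
  rewrite -RintegralB //.
  have -> : \int[m]_(x in D) `|P k x - 0| = \int[m]_(x in D) P k x.
    by apply: eq_Rintegral => x _; rewrite subr0 ger0_norm.
  rewrite -RintegralZl // -RintegralD //; apply: eq_Rintegral => x _.
  by rewrite /P; case: (leP (h x - H k x) 0) => hH;
    [rewrite ger0_norm; lra|rewrite ltr0_norm; lra].
have L : (\int[m]_(x in D) H k x - \int[m]_(x in D) h x) +
    2 * \int[m]_(x in D) `|P k x - 0| @[k --> \oo] -->
    (\int[m]_(x in D) h x - \int[m]_(x in D) h x) + 2 * (0 : R).
  apply: cvgD; first by apply: cvgB; [exact: IH|exact: cvg_cst].
  by apply: cvgM; [exact: cvg_cst|exact: PL].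
rewrite subrr mulr0 addr0 in L.
by under eq_fun do rewrite E.
Qed.

Lemma cvg_dominated_dist (a b : nat -> R) (l C : R) :
  (forall k, `|a k - l| <= C * b k) -> b k @[k --> \oo] --> (0 : R) ->
  a k @[k --> \oo] --> l.
Proof.
move=> ab b0; have Cb : C * b k @[k --> \oo] --> (0 : R).
  by rewrite -(mulr0 C); apply: cvgM; [exact: cvg_cst|exact: b0].
apply/cvgrPdistC_lt => e e0; have /cvgrPdistC_lt/(_ e e0) := Cb.
apply: filterS => k; rewrite subr0 => h.
by apply: le_lt_trans (ab k) _; exact: le_lt_trans (ler_norm _) h.
Qed.

Lemma Rintegral_subset D E (f : T -> R) : measurable D -> measurable E ->
  D `<=` E -> m.-integrable E (EFin \o f) -> (forall x, E x -> 0 <= f x) ->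
  \int[m]_(x in D) f x <= \int[m]_(x in E) f x.
Proof.
move=> mD mE DE fi f0; apply: fine_le.
- by apply: integrable_fin_num => //; exact: integrableS fi.
- exact: integrable_fin_num.
- by apply: ge0_subset_integral => //; case/integrableP : fi.
Qed.

Lemma integrable_dist D (g h : T -> R) : measurable D ->
  m.-integrable D (EFin \o g) -> m.-integrable D (EFin \o h) ->
  m.-integrable D (EFin \o (fun x => `|g x - h x|)).
Proof.
move=> mD gi hi; have := integrable_norm (integrableB mD gi hi).
by apply: eq_integrable.
Qed.

(** Mean convergence is stable under bounded factors, and implies convergence of
    the integrals. *)
Lemma mean_cvgM D (G : nat -> T -> R) (g h : T -> R) (C : R) : measurable D ->
  (forall k, m.-integrable D (EFin \o G k)) -> m.-integrable D (EFin \o g) ->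
  measurable_fun D h -> (forall x, D x -> `|h x| <= C) ->
  \int[m]_(x in D) `|G k x - g x| @[k --> \oo] --> (0 : R) ->
  \int[m]_(x in D) (G k x * h x) @[k --> \oo] --> \int[m]_(x in D) (g x * h x).
Proof.
move=> mD Gi gi mh hC; apply: (cvg_dominated_dist (C := C)) => k.
have hi (F : T -> R) : m.-integrable D (EFin \o F) ->
    m.-integrable D (EFin \o (fun x => F x * h x)).
  move=> Fi; have := integrableMl mD Fi mh (bounded_le hC).
  by apply: eq_integrable => // x _; rewrite /= EFinM.
have di := integrable_dist mD (Gi k) gi.
have dhi : m.-integrable D (EFin \o (fun x => G k x * h x - g x * h x)).
  have := integrableB mD (hi _ (Gi k)) (hi _ gi).
  by apply: eq_integrable => // x _; rewrite /= EFinB.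
rewrite -RintegralB //; try exact: hi.
apply: le_trans (le_normr_Rintegral mD dhi) _.
rewrite -RintegralZl //; apply: le_Rintegral => //.
- have := integrable_norm dhi.
  by apply: eq_integrable.
- have := integrableZl mD C di.
  by apply: eq_integrable => // x _; rewrite /= EFinM.
- by move=> x Dx; rewrite -mulrBl normrM mulrC; apply: ler_wpM2r; [|exact: hC].
Qed.

End mean_convergence.

Section vector_topology.
Context {R : realType} {n : nat}.
Local Notation V := ('rV[R]_n).

Lemma norm_rV_le (x : V) (C : R) : 0 <= C -> (forall i, `|x ord0 i| <= C) -> `|x| <= C.
Proof.
move=> C0 xC; apply/ler_addgt0Pr => e e0.
have Ce : 0 < C + e by rewrite ltr_wpDl.
have : ball (0 : V) (C + e) x.
  apply/(ball_rVP _ _ Ce) => i; rewrite mxE sub0r normrN.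
  by apply: le_lt_trans (xC i) _; rewrite ltrDl.
by rewrite -ball_normE /= sub0r normrN => /ltW.
Qed.

Lemma continuous_by_seq (u : V -> R) (x0 : V) (eta : R) : 0 < eta ->
  (forall s : nat -> V, (forall k, `|s k - x0| <= eta) ->
     s k @[k --> \oo] --> x0 -> u (s k) @[k --> \oo] --> u x0) ->
  {for x0, continuous u}.
Proof.
move=> eta0 H; apply: contrapT => ncu.
have [e e0 He] : exists2 e, 0 < e &
    forall d, 0 < d -> exists x, `|x - x0| < d /\ e <= `|u x0 - u x|.
  apply: contrapT => H2; apply: ncu.
  apply/(@cvgrPdist_lt _ _ _ (nbhs x0) (nbhs_filter x0)) => e e0.
  apply: contrapT => H3; apply: H2; exists e => // d d0.
  apply: contrapT => H4; apply: H3; apply: filterS (nbhsx_ballx x0 d d0) => x.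
  rewrite -ball_normE /= distrC => xd; rewrite ltNge; apply/negP => ux.
  by apply: H4; exists x.
have dk k : 0 < Num.min eta k.+1%:R^-1 by rewrite lt_min eta0 invr_gt0 ltr0n.
pose s k := sval (cid (He _ (dk k))).
have s1 k : `|s k - x0| < Num.min eta k.+1%:R^-1 by rewrite /s; case: cid => ? [].
have s2 k : e <= `|u x0 - u (s k)| by rewrite /s; case: cid => ? [].
have /cvgrPdist_lt/(_ e e0) : u (s k) @[k --> \oo] --> u x0.
  apply: H => [k|].
    by apply: le_trans (ltW (s1 k)) _; rewrite ge_min lexx.
  apply/cvgrPdist_lt => d d0; near=> k; rewrite distrC; apply: lt_trans (s1 k) _.
  rewrite gt_min; apply/orP; right; near: k.
  have := @cvg_harmonic R => /cvgrPdist_lt/(_ d d0).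
  by apply: filterS => k; rewrite /harmonic sub0r normrN ger0_norm // invr_ge0.
by move=> [N _ HN]; have := HN N (leqnn N); rewrite /= ltNge s2.
Unshelve. all: end_near. Qed.

End vector_topology.

(** * Continuity of potentials *)

Section local_mean_continuity.
Context {R : realType} {n : nat}.
Variables (A : 'rV[R]_n -> 'M[R]_n) (Gamma : 'rV[R]_n -> 'rV[R]_n -> R).
Local Notation V := ('rV[R]_n).
Hypothesis hA : admissible_operator A.
Hypothesis hG : fundamental_solution A Gamma.
Implicit Types (x y z : V).
Local Notation gam := (gam Gamma).
Local Notation lam := (lebesgue_rV n).

(** The pairs in question form a compact set off the diagonal, where the
    fundamental solution is jointly continuous. *)
Lemma gam_bounded_apart x0 (d M : R) : 0 < d -> exists C : R,
  forall x y, `|x - x0| <= d / 2 -> `|y| <= M -> d <= `|y - x0| -> gam x y <= C.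
Proof.
move=> d0; pose Z := [set z : 'rV[R]_(n + n) |
  [/\ `|lsubmx z - x0| <= d / 2, `|rsubmx z| <= M & d <= `|rsubmx z - x0|]].
have cl : continuous (fun z : 'rV[R]_(n + n) => `|lsubmx z - x0|).
  move=> z; apply: continuous_comp; last exact: norm_continuous.
  by apply: continuousB; [exact: lsubmx_continuous|exact: cst_continuous].
have cr : continuous (fun z : 'rV[R]_(n + n) => `|rsubmx z|).
  move=> z; apply: continuous_comp; last exact: norm_continuous.
  exact: rsubmx_continuous.
have crx : continuous (fun z : 'rV[R]_(n + n) => `|rsubmx z - x0|).
  move=> z; apply: continuous_comp; last exact: norm_continuous.
  by apply: continuousB; [exact: rsubmx_continuous|exact: cst_continuous].
have cZ : compact Z.
  apply: bounded_closed_compact.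
    exists (Num.max (`|x0| + d / 2) M); split; first exact: num_real.
    move=> c; rewrite gt_max => /andP[c1 c2] z [z1 z2 z3] /=.
    have c0 : 0 <= c.
      by apply: le_trans (ltW c1); rewrite addr_ge0 // divr_ge0 // ltW.
    apply: norm_rV_le => // i; case: (split_ordP i) => j ->.
      have := norm_rV_coord (lsubmx z) j; rewrite mxE => /le_trans; apply.
      rewrite -[lsubmx z](subrK x0); apply: le_trans (ler_normD _ _) _.
      by rewrite addrC; apply: le_trans (ltW c1); rewrite lerD2l.
    have := norm_rV_coord (rsubmx z) j; rewrite mxE => /le_trans; apply.
    exact: le_trans (ltW c2).
  rewrite (_ : Z = (fun z : 'rV[R]_(n + n) => `|lsubmx z - x0|) @^-1` [set r | r <= d / 2] `&`
    ((fun z : 'rV[R]_(n + n) => `|rsubmx z|) @^-1` [set r | r <= M] `&`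
    (fun z : 'rV[R]_(n + n) => `|rsubmx z - x0|) @^-1` [set r | d <= r])); last first.
    by apply/seteqP; split=> z; [case|move=> [? []]].
  apply: closedI; first by apply: closed_comp => [z _|]; [exact: cl|exact: closed_le].
  apply: closedI; first by apply: closed_comp => [z _|]; [exact: cr|exact: closed_le].
  by apply: closed_comp => [z _|]; [exact: crx|exact: closed_ge].
have off (z : 'rV[R]_(n + n)) : Z z -> lsubmx z != rsubmx z.
  move=> [z1 _ z3]; apply/eqP => E; move: z1; rewrite E => z1.
  by have := le_trans z3 z1; rewrite leNgt; apply/negP/negPn; lra.
have [|C C0 HC] := @continuous_bounded_on R _ Z
    (fun z : 'rV[R]_(n + n) => Gamma (lsubmx z) (rsubmx z)) cZ.
  apply: continuous_in_subspaceT => z; rewrite inE => /off oz.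
  have /smooth_onP H0 := fs_smooth hG; exact: Ck_cont (H0 0%N) oz.
exists C => x y xd yM yd; have Zxy : Z (row_mx x y).
  by rewrite /Z /= row_mxKl row_mxKr.
have := HC _ Zxy; rewrite row_mxKl row_mxKr; apply: le_trans.
by have := off _ Zxy; rewrite row_mxKl row_mxKr => /gamE ->; exact: ler_norm.
Qed.

(** At the centre of a bump the gradient of the bump vanishes, and its second
    derivatives form a negative multiple of the identity: only the trace of [A]
    remains. *)
Lemma positive_source x0 : exists (phi : V -> R) (M : R),
  [/\ Coo ee setT phi, (forall y, M < `|y| -> phi y = 0) & div_op A phi x0 < 0].
Proof.
pose h : R -> R := fun s => flat0 (1 - s).
pose phi : V -> R := ball_bump x0 1.
have phiE y : phi y = h (sqdist x0 y) by rewrite /phi /ball_bump expr1n.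
have ch : Coo1 setT h.
  move=> k; have := @flat0_affine R (-1) 1 k.
  by rewrite (_ : (fun s => flat0 (-1 * s + 1)) = h) //; apply/funext => s;
    rewrite /h mulN1r addrC.
have cp : Coo ee setT phi := Coo_ball_bump x0 1.
exists phi, (`|x0| + 1); split=> //.
  move=> y My; apply: ball_bump_eq0 => //.
  have := ler_normD (y - x0) x0; rewrite subrK => H.
  by rewrite -(lerD2r `|x0|); apply: le_trans H; rewrite addrC ltW.
have -> : phi = h \o sqdist x0 by apply/funext => y; exact: phiE.
rewrite (div_op_comp (cA hA) (@openT V) (Coo_sqdist x0 2%N) (ch 2%N)) //.
have pE i : partial i (sqdist x0) = fun y => 2 * (y ord0 i - x0 ord0 i).
  by apply/funext => y; apply: partialE; exact: is_derive_sqdist.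
have -> : energy A (sqdist x0) (sqdist x0) x0 = 0.
  rewrite /energy big1 // => i _; rewrite big1 // => j _.
  by rewrite !pE !subrr !mulr0.
have -> : div_op A (sqdist x0) x0 = 2 * \tr (A x0).
  rewrite /div_op /mxtrace mulr_sumr; apply: eq_bigr => i _.
  rewrite (bigD1 i) //= big1 ?addr0.
    apply: partialE.
    have a1 := Ck_partial i (cA hA i i 1%N) (Logic.I : [set: V] x0).
    have a2 := Ck_partial i (CkP i (Coo_sqdist x0 2%N)) (Logic.I : [set: V] x0).
    have := is_derive_mul a1 a2; congr is_derive.
    rewrite !pE subrr !mulr0 add0r mulrC; congr (_ * _).
    apply: partialE.
    have := is_derive_mul (is_derive_const (2 : R) x0 (delta_mx ord0 i : V))
      (is_derive_add (is_derive_coord i i x0) (is_derive_const (- x0 ord0 i) x0 (delta_mx ord0 i : V))).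
    by rewrite mul0r add0r eqxx addr0 mulr1.
  move=> j ji; apply: partialE.
  have a1 := Ck_partial i (cA hA i j 1%N) (Logic.I : [set: V] x0).
  have a2 : is_derive x0 (delta_mx ord0 i : V) (partial j (sqdist x0)) 0.
    rewrite pE.
    have := is_derive_mul (is_derive_const (2 : R) x0 (delta_mx ord0 i : V))
      (is_derive_add (is_derive_coord i j x0) (is_derive_const (- x0 ord0 j) x0 (delta_mx ord0 i : V))).
    by rewrite mul0r add0r eq_sym (negbTE ji) addr0 mulr0.
  have := is_derive_mul a1 a2; congr is_derive.
  by rewrite pE subrr !mulr0 addr0.
rewrite mulr0 add0r sqdistxx.
have dh : is_derive (0 : R) 1 h (- ((1 - 0) ^- 2 * expR (- (1 - 0)^-1))).
  have d1 : is_derive (0 : R) 1 (fun s : R => 1 - s) (-1).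
    have := is_derive_add (is_derive_const (1 : R) (0 : R) (1 : R))
      (is_derive_mul (is_derive_const (-1 : R) (0 : R) (1 : R)) (is_derive_id (0 : R) (1 : R))).
    by rewrite mul0r !add0r mulr1; apply: is_derive_ext => s; rewrite mulN1r.
  have p1 : 0 < 1 - 0 :> R by rewrite subr0.
  by have := is_derive_chain d1 (is_derive_flat0 p1); rewrite mulrN1.
have -> : 'D_1 h 0 = - ((1 - 0) ^- 2 * expR (- (1 - 0)^-1)) by case: dh.
rewrite mulNr oppr_lt0 subr0 expr1n invr1 mul1r.
by rewrite mulr_gt0 ?expR_gt0 // mulr_gt0 // coef_trace.
Qed.

Lemma integrable_gam_on x (h : V -> R) (M C : R) (D : set V) : measurable D ->
  (forall y, D y -> `|y| <= M) -> measurable_fun setT h ->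
  (forall y, D y -> `|h y| <= C) ->
  lam.-integrable D (EFin \o (fun y => gam x y * h y)).
Proof.
move=> mD DM mh hC.
have gi : lam.-integrable D (EFin \o gam x).
  apply: integrableS (gam_L1 hA hG x (@compact_norm_le R n M)) => //.
  exact: measurable_norm_le.
have := integrableMl mD gi (measurable_funTS mh) (bounded_le hC).
by apply: eq_integrable => // y _; rewrite /= EFinM.
Qed.

Lemma gam_cvg_ae (s : nat -> V) x0 : s k @[k --> \oo] --> x0 ->
  \forall y \ae lam, gam (s k) y @[k --> \oo] --> gam x0 y.
Proof.
move=> sx; apply: filterS (ae_neq hA x0) => y xy.
have yx : y != x0 by rewrite eq_sym.
have c := gam_continuous hG yx.
rewrite (gam_sym hG); under eq_fun do rewrite (gam_sym hG).
exact: (cvg_comp s (gam y) sx c).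
Qed.

(** Away from [x0], bounded convergence applies.  Near [x0] there is no uniform
    bound; but some [q] that is positive near [x0] has a test function as
    potential, hence a continuous one, and Scheffe's lemma turns the convergence
    of the integrals of [gam (s k) y * q y] into mean convergence. *)
Lemma gam_mean_continuous x0 : exists2 eta : R, 0 < eta &
  forall (M : R) (s : nat -> V), (forall k, `|s k - x0| <= eta) ->
    s k @[k --> \oo] --> x0 ->
    \int[lam]_(y in [set y : V | `|y| <= M]) `|gam (s k) y - gam x0 y|
      @[k --> \oo] --> (0 : R).
Proof.
have [phi [M0 [cphi phi0 q0]]] := positive_source x0.
pose q y := - div_op A phi y.
have cq : continuous q.
  have cL : continuous (div_op A phi).
    apply: Ck0_continuous.
    by apply: (Ck_div_op (cA hA)); [exact: openT|exact: cphi 2%N].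
  by move=> y; exact: cvgN (cL y).
have qM y : M0 < `|y| -> q y = 0.
  move=> My; rewrite /q (@div_op_off R n A [set y : V | `|y| <= M0]) ?oppr0 //.
  - by apply: compact_closed (@compact_norm_le R n M0); exact: norm_hausdorff.
  - by move=> z /negP; rewrite -ltNge; exact: phi0.
  - by move=> /=; rewrite leNgt My.
have mq := continuous_measurable_rV cq.
have qx0 : 0 < q x0 by rewrite oppr_gt0.
pose c := q x0 / 2; have c0 : 0 < c by rewrite divr_gt0.
have : \forall y \near x0, c < q y.
  by apply: (cvgr_gt _ (cq x0)); rewrite /c; lra.
move=> /nbhs_ballP[d /= d0 Hd].
exists (d / 2) => [|M1 s sx0 sx]; first by rewrite divr_gt0.
pose M := Num.max (Num.max M0 M1) (`|x0| + d).
have M0M : M0 <= M by rewrite !le_max lexx.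
have M1M : M1 <= M by rewrite !le_max lexx orbT.
have xdM : `|x0| + d <= M by rewrite !le_max lexx orbT.
pose K := [set y : V | `|y| <= M]; pose B := ball x0 d; pose S := K `\` B.
have mK : measurable K := measurable_norm_le M.
have mB : measurable B by exact: measurable_ball_rV.
have mS : measurable S by exact: measurableD.
have BK : B `<=` K.
  move=> y; rewrite /B -ball_normE /= distrC => yx; rewrite /K /=.
  apply: le_trans xdM; rewrite -[y](subrK x0) addrC.
  by apply: le_trans (ler_normD _ _) _; rewrite lerD2l ltW.
have KBS : K = B `|` S by rewrite setDUK.
have BS : [disjoint B & S] by apply/disj_setPS => y [By []].
have [|Q Q0 HQ] := continuous_bounded_on (f := q) (@compact_norm_le R n M).
  exact: continuous_subspaceT.
have SK y : S y -> `|y| <= M by case.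
have gi x D : measurable D -> (forall y, D y -> `|y| <= M) ->
    lam.-integrable D (EFin \o gam x).
  move=> mD DM; apply: integrableS (gam_L1 hA hG x (@compact_norm_le R n M)) => //.
have gqi x D : measurable D -> (forall y, D y -> `|y| <= M) ->
    lam.-integrable D (EFin \o (fun y => gam x y * q y)).
  by move=> mD DM; apply: (integrable_gam_on x mD DM mq) => y /DM; exact: HQ.
have mgam x D : measurable_fun D (gam x).
  by apply: measurable_funTS; exact: measurable_gam hG x.
have gae := gam_cvg_ae sx.
have LS : \int[lam]_(y in S) `|gam (s k) y - gam x0 y| @[k --> \oo] --> (0 : R).
  have [C HC] := gam_bounded_apart x0 M d0.
  apply: (dominated_mean_cvg (g := fun=> C) mS) => //.
  - by apply: filterS gae => y H _.
  - apply: (integrable_bounded (M := M) (C := `|C|)) => //.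
  - move=> k y [yM yB]; rewrite ger0_norm; last exact: gam_ge0 hG _ _.
    apply: HC => //; rewrite leNgt; apply/negP => yd; apply: yB.
    by rewrite /B -ball_normE /= distrC.
have potK x : \int[lam]_(y in K) (gam x y * q y) = phi x.
  rewrite -[phi x]opprK -(gam_eq hA hG x cphi phi0).
  have E : \int[lam]_y (gam x y * div_op A phi y) =
      \int[lam]_(y in K) (gam x y * div_op A phi y).
    apply: Rintegral_supp => // y /negP; rewrite -ltNge => My.
    have := qM y (le_lt_trans M0M My); rewrite /q => /eqP; rewrite oppr_eq0 => /eqP ->.
    by rewrite mulr0.
  rewrite E -mulN1r -RintegralZl //.
    by apply: eq_Rintegral => y _; rewrite /q; ring.
  have := integrableZl mK (-1) (gqi x K mK (fun y h => h)).
  by apply: eq_integrable => // y _; rewrite -EFinM /q /=; congr EFin; ring.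
have splitK x : \int[lam]_(y in K) (gam x y * q y) =
    \int[lam]_(y in B) (gam x y * q y) + \int[lam]_(y in S) (gam x y * q y).
  by rewrite KBS Rintegral_setU // -KBS; exact: gqi.
have LSq : \int[lam]_(y in S) (gam (s k) y * q y) @[k --> \oo] -->
    \int[lam]_(y in S) (gam x0 y * q y).
  apply: (mean_cvgM mS (fun k => gi (s k) S mS SK) (gi x0 S mS SK) (C := Q) _ _ LS).
    exact: measurable_funTS.
  by move=> y /SK; exact: HQ.
have LBq : \int[lam]_(y in B) (gam (s k) y * q y) @[k --> \oo] -->
    \int[lam]_(y in B) (gam x0 y * q y).
  have E x : \int[lam]_(y in B) (gam x y * q y) =
      phi x - \int[lam]_(y in S) (gam x y * q y).
    by rewrite -potK splitK addrK.
  rewrite E; under eq_fun do rewrite E.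
  apply: cvgB; last exact: LSq.
  have cphi0 : continuous phi := Ck0_continuous (cphi 0%N).
  have cx : phi y @[y --> x0] --> phi x0 := cphi0 x0.
  apply: cvg_comp.
    exact: sx.
  exact: cx.
have qB y : B y -> c < q y by exact: Hd.
have q0B y : B y -> 0 <= q y by move=> /qB cqy; exact: ltW (lt_trans c0 cqy).
have gq0 x y : B y -> 0 <= gam x y * q y.
  by move=> By; apply: mulr_ge0; [exact: gam_ge0 hG x y|exact: q0B].
have LB : \int[lam]_(y in B) `|gam (s k) y * q y - gam x0 y * q y|
    @[k --> \oo] --> (0 : R).
  apply: (scheffe mB _ _ (fun k => gq0 (s k)) (gq0 x0) _ LBq).
  - by move=> k; exact: (gqi _ B mB BK).
  - exact: (gqi _ B mB BK).
  - apply: filterS gae => y Hy _.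
    by apply: cvgM; [exact: Hy|exact: cvg_cst].
have mK1 := @measurable_norm_le R n M1.
have K1K : [set y : V | `|y| <= M1] `<=` K by move=> y /le_trans; apply.
apply: (cvg_dominated_dist (C := 1)
  (b := fun k => c^-1 * \int[lam]_(y in B) `|gam (s k) y * q y - gam x0 y * q y| +
    \int[lam]_(y in S) `|gam (s k) y - gam x0 y|)); last first.
  have L : c^-1 * \int[lam]_(y in B) `|gam (s k) y * q y - gam x0 y * q y| +
    \int[lam]_(y in S) `|gam (s k) y - gam x0 y| @[k --> \oo] --> c^-1 * 0 + 0.
    by apply: cvgD; [apply: cvgM; [exact: cvg_cst|exact: LB]|exact: LS].
  by rewrite mulr0 addr0 in L.
move=> k; rewrite subr0 mul1r ger0_norm; last by apply: Rintegral_ge0.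
have dK := integrable_dist mK (gi (s k) K mK (fun y h => h)) (gi x0 K mK (fun y h => h)).
apply: le_trans (Rintegral_subset mK1 mK K1K dK _) _ => //.
rewrite [X in \int[_]_(_ in X) _ <= _]KBS Rintegral_setU //; last by rewrite -KBS.
rewrite lerD2r.
have dBq := integrable_dist mB (gqi (s k) B mB BK) (gqi x0 B mB BK).
rewrite -RintegralZl //; apply: le_Rintegral => //.
- exact: integrable_dist mB (gi (s k) B mB BK) (gi x0 B mB BK).
- have := integrableZl mB c^-1 dBq.
  by apply: eq_integrable => // x _; rewrite /= EFinM.
- move=> y By; rewrite -mulrBl normrM mulrCA ler_peMr //.
  rewrite (ger0_norm (q0B y By)) -[leLHS](mulVf (lt0r_neq0 c0)).
  by apply: ler_wpM2l; [rewrite invr_ge0; exact: ltW|exact/ltW/qB].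
Qed.

Lemma potentialE x (f : V -> R) : continuous f ->
  potential Gamma f x = \int[lam]_y (gam x y * f y).
Proof.
move=> cf; rewrite /potential /Rintegral (integral_gam hA hG) //.
exact: continuous_measurable_rV.
Qed.

Lemma supp_bound (f : V -> R) : compact (supp f) ->
  exists M : R, forall y, M < `|y| -> f y = 0.
Proof.
move=> /compact_bounded[M [_ HM]]; exists (`|M| + 1) => y My.
apply/eqP/negPn/negP => fy.
have sy : supp f y by exact: subset_closure.
have M1 : M < `|M| + 1 by rewrite (le_lt_trans (ler_norm M)) // ltrDl.
by have := HM _ M1 y sy; rewrite /= leNgt My.
Qed.

Lemma potential_continuous (f : V -> R) : continuous f -> compact (supp f) ->
  continuous (potential Gamma f).
Proof.
move=> cf /supp_bound[M fM] x0; have [eta eta0 H] := gam_mean_continuous x0.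
have mK := @measurable_norm_le R n M.
have [|C C0 HC] := continuous_bounded_on (f := f) (@compact_norm_le R n M).
  exact: continuous_subspaceT.
have E x : potential Gamma f x = \int[lam]_(y in [set y : V | `|y| <= M]) (gam x y * f y).
  rewrite potentialE //; apply: Rintegral_supp => // y /negP; rewrite -ltNge => /fM ->.
  by rewrite mulr0.
apply: (continuous_by_seq eta0) => s s1 s2; rewrite E; under eq_fun do rewrite E.
have gi x := gam_L1 hA hG x (@compact_norm_le R n M).
apply: (mean_cvgM mK (fun k => gi (s k)) (gi x0) _ HC (H M s s1 s2)).
by apply: measurable_funTS; exact: continuous_measurable_rV.
Qed.

End local_mean_continuity.

(** * Mass of the power weight *)

Section power_integral.
Context {R : realType}.
Variables (al r : R).
Hypotheses (r0 : 0 < r) (al1 : 0 < al + 1).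
Local Notation mu := (@lebesgue_measure R).

Lemma measurable_power_weight : measurable_fun setT (power_weight al r).
Proof.
have -> : power_weight al r = (fun s => \1_(`]0, r[%classic : set R) s * s `^ al).
  apply/funext => s; rewrite /power_weight indicE.
  by rewrite mem_setE in_itv /=; case: ifP => _; rewrite ?mul1r ?mul0r.
by apply: measurable_funM; [exact: measurable_indic|exact: measurable_powR].
Qed.

Lemma integral_power_seg (e : R) : 0 < e -> e < r ->
  (\int[mu]_(s in `[e, r]) (s `^ al)%:E =
   ((r `^ (al + 1) - e `^ (al + 1)) / (al + 1))%:E)%E.
Proof.
move=> e0 er; pose F s := (al + 1)^-1 * s `^ (al + 1).
have dF (s : R) : 0 < s -> is_derive s 1 F (s `^ al).
  move=> s0; have := is_derive_mul (is_derive_const (al + 1)^-1 s (1 : R))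
    (is_derive1_powR (al + 1) s0).
  by rewrite mul0r add0r addrK mulrA mulVf ?mul1r // gt_eqF.
have cF (s : R) : 0 < s -> {for s, continuous F} by move=> /dF/is_derive_continuous.
rewrite (@continuous_FTC2 _ _ F) //.
- by rewrite /F -EFinB; congr EFin; ring.
- apply: continuous_in_subspaceT => s; rewrite inE /= in_itv /= => /andP[es _].
  exact: is_derive_continuous (is_derive1_powR al (lt_le_trans e0 es)).
- split.
  + by move=> s; rewrite in_itv /= => /andP[es _]; case: (dF s (lt_trans e0 es)).
  + by apply: cvg_at_right_filter; exact: cF.
  + by apply: cvg_at_left_filter; apply: cF; exact: lt_trans er.
- move=> s; rewrite in_itv /= => /andP[es _]; rewrite derive1E.
  by case: (dF s (lt_trans e0 es)).
Qed.

Lemma integral_power_weight :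
  (\int[mu]_s (power_weight al r s)%:E = (r `^ (al + 1) / (al + 1))%:E)%E.
Proof.
(* The exponent may be negative: integrate from [e k] > 0 and let it tend to 0. *)
pose e (k : nat) : R := r / k.+2%:R.
have e0 k : 0 < e k by rewrite divr_gt0 // ltr0n.
have er k : e k < r by rewrite /e ltr_pdivrMr ?ltr0n // ltr_pMr // ltr1n.
have eL : e k @[k --> \oo] --> (0 : R).
  rewrite -(mulr0 r); apply: cvgM; first exact: cvg_cst.
  have := @cvg_harmonic R; rewrite -(cvg_shiftn 1%N) /=.
  by under eq_fun do rewrite /harmonic addn1.
pose g k s : R := power_weight al r s * \1_(`[e k, r[%classic : set R) s.
have L : (\int[mu]_s (g k s)%:E @[k --> \oo] --> \int[mu]_s (power_weight al r s)%:E)%E.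
  apply: monotone_cvg_real.
  - move=> k; apply: measurable_funM; first exact: measurable_power_weight.
    exact: measurable_indic.
  - by move=> k s; apply: mulr_ge0; [exact: power_weight_ge0|rewrite indicE].
  - move=> s i j ij; apply: ler_wpM2l; first exact: power_weight_ge0.
    rewrite !indicE !mem_setE !in_itv /=; case: (ltP s r); rewrite ?andbF // !andbT => _.
    have eij : e j <= e i.
      by rewrite /e ler_wpM2l ?(ltW r0) // lef_pV2 ?posrE ?ltr0n // ler_nat !ltnS.
    have [ei|//] := leP (e i) s.
    by rewrite (le_trans eij ei).
  - move=> s; have [/andP[s0 sr]|h] := boolP (0 < s < r); last first.
      rewrite /g /power_weight (negbTE h); under eq_fun do rewrite mul0r.
      exact: cvg_cst.
    apply: cvg_near_cst; near=> k.
    have es : e k <= s by apply: ltW; near: k; exact: (cvgr_lt _ eL).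
    by rewrite /g indicE mem_setE in_itv /= es sr mulr1.
have E k : (\int[mu]_s (g k s)%:E = ((r `^ (al + 1) - e k `^ (al + 1)) / (al + 1))%:E)%E.
  rewrite -integral_power_seg // -integral_itv_bndo_bndc; last first.
    apply/measurable_EFinP; apply: measurable_funTS; exact: measurable_powR.
  rewrite (@integral_supp _ _ _ mu `[e k, r[%classic) //; last first.
    by move=> s sn; rewrite /g indicE memNset // mulr0.
  apply: eq_integral => s; rewrite inE /= in_itv /= => /andP[es sr].
  rewrite /g indicE mem_setE in_itv /= es sr mulr1 /power_weight sr.
  by rewrite (lt_le_trans (e0 k) es).
have L2 : ((r `^ (al + 1) - e k `^ (al + 1)) / (al + 1))%:E @[k --> \oo] -->
    (r `^ (al + 1) / (al + 1))%:E.
  apply/fine_cvgP; split; first exact: nearW.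
  have L3 : (r `^ (al + 1) - e k `^ (al + 1)) / (al + 1) @[k --> \oo] -->
      (r `^ (al + 1) - 0) / (al + 1).
    apply: cvgM; last exact: cvg_cst.
    apply: cvgB; first exact: cvg_cst.
    have H : e k @[k --> \oo] --> 0^'+.
      move=> P /eL HP.
      apply: (@filterS _ \oo _ (fun k => 0 < e k -> P (e k))) => // k; apply.
      exact: e0.
    exact: (cvg_comp _ _ H (powR_cvg0 al1)).
  by rewrite subr0 in L3.
move: L; rewrite (_ : (fun k => _) = (fun k =>
  ((r `^ (al + 1) - e k `^ (al + 1)) / (al + 1))%:E)); last by apply/funext => k; exact: E.
by move=> L; apply: (cvg_unique _ L L2); exact: ereal_hausdorff.
Unshelve. all: end_near. Qed.

End power_integral.

(** * Truncated values and the average *)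

Section mean_value_formula.
Context {R : realType} {n : nat}.
Variables (A : 'rV[R]_n -> 'M[R]_n) (Gamma : 'rV[R]_n -> 'rV[R]_n -> R).
Local Notation V := ('rV[R]_n).
Hypothesis hA : admissible_operator A.
Hypothesis hG : fundamental_solution A Gamma.
Implicit Types (y z : V) (s t : R).
Local Notation gam := (gam Gamma).
Local Notation lam := (lebesgue_rV n).
Local Notation mu := (@lebesgue_measure R).
Variables (al : R) (x : V) (r : R).
Hypotheses (al1 : -1 < al) (r0 : 0 < r).

Let al0 : 0 < al + 1.
Proof. by rewrite -ltrBlDr sub0r. Qed.

Let pw := power_weight al r.

Definition total_weight : R := r `^ (al + 1) / (al + 1).
Local Notation kap := total_weight.

Lemma total_weight_gt0 : 0 < kap.
Proof. by rewrite divr_gt0 // powR_gt0. Qed.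

Lemma total_weightV : (al + 1) / r `^ (al + 1) = kap^-1.
Proof. by rewrite /total_weight invf_div. Qed.

Lemma power_weight_le0 s : s <= 0 -> pw s = 0.
Proof. by move=> s0; rewrite /pw /power_weight ltNge s0. Qed.

Lemma integrable_power_weight : mu.-integrable setT (EFin \o pw).
Proof.
apply/integrableP; split.
  by apply/measurable_EFinP; exact: measurable_power_weight.
under eq_integral do rewrite /= ger0_norm ?power_weight_ge0 //.
by rewrite (integral_power_weight r0 al0) ltry.
Qed.

Lemma Rintegral_power_weight : \int[mu]_s pw s = kap.
Proof. by rewrite /Rintegral (integral_power_weight r0 al0). Qed.

(** Where the fundamental solution has the value [t], the positive part of
    [t - 1/s] is the integrand that defines [Qavg] on the ball of size [s]. *)
Definition excess t s : R := Num.max (t - s^-1) 0 * pw s.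

Lemma excess_ge0 t s : 0 <= excess t s.
Proof. by apply: mulr_ge0; [rewrite le_max lexx orbT|exact: power_weight_ge0]. Qed.

Lemma measurable_min_power t : measurable_fun setT (fun s => Num.min t s^-1 * pw s).
Proof.
apply: measurable_funM; last exact: measurable_power_weight.
by apply: measurable_minr; [exact: measurable_cst|exact: measurable_invr].
Qed.

Lemma min_power_ge0 t s : 0 <= t -> 0 <= Num.min t s^-1 * pw s.
Proof.
move=> t0; have [s0|s0] := leP s 0; first by rewrite power_weight_le0 // mulr0.
apply: mulr_ge0; last exact: power_weight_ge0.
by rewrite le_min t0 invr_ge0 ltW.
Qed.

Lemma integrable_min_power t : 0 <= t ->
  mu.-integrable setT (EFin \o (fun s => Num.min t s^-1 * pw s)).
Proof.
move=> t0; apply: (@le_integrable _ _ _ mu setT measurableT _ (EFin \o (fun s => t * pw s))).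
- by apply/measurable_EFinP; exact: measurable_min_power.
- move=> s _; rewrite lee_fin ger0_norm ?min_power_ge0 //.
  apply: le_trans (ler_norm _); apply: ler_wpM2r; first exact: power_weight_ge0.
  by rewrite ge_min lexx.
- have := integrableZl measurableT t integrable_power_weight.
  by apply: eq_integrable => // s _; rewrite /= EFinM.
Qed.

(** Averaging replaces the value [t] of the fundamental solution by [kept t] and
    decreases it by [lost t], both up to the factor [total_weight]. *)
Definition kept t : R := \int[mu]_s (Num.min t s^-1 * pw s).

Lemma keptE t : 0 <= t ->
  (\int[mu]_s (Num.min t s^-1 * pw s)%:E = (kept t)%:E)%E.
Proof.
move=> t0; rewrite /kept /Rintegral fineK //.
exact: integrable_fin_num (integrable_min_power t0).
Qed.

Lemma kept_ge0 t : 0 <= t -> 0 <= kept t.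
Proof. by move=> t0; apply: Rintegral_ge0 => s _; exact: min_power_ge0. Qed.

Lemma excessE t s : t * pw s - Num.min t s^-1 * pw s = excess t s.
Proof.
rewrite /excess -mulrBl; congr (_ * _).
by case: (leP t s^-1) => h; [rewrite subrr max_r // subr_le0|rewrite max_l // subr_ge0 ltW].
Qed.

Lemma integrable_excess t : 0 <= t -> mu.-integrable setT (EFin \o excess t).
Proof.
move=> t0; have i1 := integrableZl measurableT t integrable_power_weight.
have := integrableB measurableT i1 (integrable_min_power t0).
by apply: eq_integrable => // s _; rewrite /= -EFinM -EFinB excessE.
Qed.

Definition lost t : R := \int[mu]_s excess t s.

Lemma lostE t : 0 <= t -> lost t = t * kap - kept t.
Proof.
move=> t0; rewrite /lost /kept -Rintegral_power_weight -RintegralZl //; last first.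
  exact: integrable_power_weight.
rewrite -RintegralB //; first by apply: eq_Rintegral => s _; rewrite excessE.
  have := integrableZl measurableT t integrable_power_weight.
  by apply: eq_integrable => // s _; rewrite /= EFinM.
exact: integrable_min_power.
Qed.

Lemma lost_ge0 t : 0 <= lost t.
Proof. by apply: Rintegral_ge0 => s _; exact: excess_ge0. Qed.

Lemma lost_le t : 0 <= t -> lost t <= t * kap.
Proof. by move=> t0; rewrite lostE // gerBl kept_ge0. Qed.

Lemma kept_le t : 0 <= t -> kept t <= t * kap.
Proof. by move=> t0; have := lost_ge0 t; rewrite lostE // subr_ge0. Qed.

Lemma lost_eq0 t : 0 <= t -> t <= r^-1 -> lost t = 0.
Proof.
move=> t0 tr; rewrite /lost /Rintegral integral0_eq // => s _.
rewrite /excess /pw /power_weight; case: ifPn => [/andP[s0 sr]|_]; last by rewrite mulr0.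
rewrite max_r ?mul0r // subr_le0 (le_trans tr) // lef_pV2 ?posrE //; exact: ltW.
Qed.

Lemma lost_gt0 t : r^-1 < t -> 0 < lost t.
Proof.
move=> tr; have t0 : 0 < t by apply: lt_trans tr; rewrite invr_gt0.
have ti : 0 < t^-1 by rewrite invr_gt0.
have tir : t^-1 < r by rewrite -[ltRHS]invrK ltf_pV2 ?posrE ?invr_gt0.
have ei := integrable_excess (ltW t0).
apply: fine_gt0; apply/andP; split; last first.
  by rewrite ltey_eq (integrable_fin_num measurableT ei).
apply: (@integral_gt0 R _ _ mu `]t^-1, r[%classic) => //.
- by apply/measurable_EFinP; case/integrableP : ei.
- exact: excess_ge0.
- by rewrite [X in (_ < X)%E]lebesgue_measure_itv /= lte_fin tir -EFinB lte_fin subr_gt0.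
- move=> s /=; rewrite in_itv /= => /andP[ts sr]; have s0 := lt_trans ti ts.
  rewrite /excess /pw /power_weight s0 sr; apply: mulr_gt0; last exact: powR_gt0.
  by rewrite lt_max subr_gt0 -[ltRHS]invrK ltf_pV2 ?posrE ?ts.
Qed.

Let D y := density A Gamma pw x y.

Lemma measurable_level_radius : measurable_fun setT (level_radius Gamma x).
Proof. by apply: (measurable_fun_off (x0 := x)) => y; exact: (level_radius_continuous hG). Qed.

Lemma measurable_power_density : measurable_fun setT D.
Proof.
have mr := measurable_level_radius.
apply: measurable_funM; first apply: measurable_funM.
- exact: measurableT_comp (measurable_power_weight al r) mr.
- by rewrite (_ : (fun y => _) = (fun y => level_radius Gamma x y * level_radius Gamma x y));
    [exact: measurable_funM|apply/funext => y; rewrite expr2].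
- apply: (measurable_fun_off (x0 := x)) => y /eqP yx.
  have c := Ck_energy (cA hA) (@open_setC1 R n x) (gam_Coo hG x 1%N) (gam_Coo hG x 1%N).
  exact: Ck_cont c yx.
Qed.

Lemma power_density_ge0 y : 0 <= D y.
Proof. by apply: density_ge0 => // s; exact: power_weight_ge0. Qed.

Lemma OmegaE (rho : R) : 0 < rho ->
  Omega Gamma rho x = [set y | level_radius Gamma x y < rho].
Proof.
move=> rho0; apply/seteqP; split => y; rewrite /Omega /Gammabar /=.
  case: eqVneq => [<-|xy]; first by rewrite level_radiusxx.
  rewrite lte_fin -(gamE Gamma xy) => h; have g0 := gam_gt0 hG xy.
  by rewrite /level_radius -[rho]invrK ltf_pV2 ?posrE ?invr_gt0.
case: eqVneq => [<-|xy]; first by rewrite ltry.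
rewrite /level_radius lte_fin -(gamE Gamma xy) => h; have g0 := gam_gt0 hG xy.
by rewrite -[X in _ < X]invrK ltf_pV2 ?posrE ?invr_gt0.
Qed.

Lemma measurable_Omega (rho : R) : 0 < rho -> measurable (Omega Gamma rho x).
Proof.
move=> rho0; rewrite OmegaE //.
rewrite (_ : mkset _ = setT `&` level_radius Gamma x @^-1` `]-oo, rho[%classic).
  by apply: measurable_level_radius => //; exact: measurable_itv.
by rewrite setTI; apply/seteqP; split => y /=; rewrite in_itv.
Qed.

Let ktilde y := gam x y `^ (- (al + 2)) * energy A (gam x) (gam x) y.

Lemma kernelK_gam y : y != x -> kernelK al A Gamma x y = ktilde y.
Proof.
move=> yx; have xy : x != y by rewrite eq_sym.
have gE : grad (Gamma x) y = grad (gam x) y.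
  apply/colP => i; rewrite !mxE; apply: (partial_on_open i (@open_setC1 R n x)).
    by move=> z /eqP zx; rewrite gamE // eq_sym.
  exact/eqP.
by rewrite /kernelK gE energyE // -(gamE Gamma xy) mulrC /ktilde powRN.
Qed.

Lemma measurable_kernelK : measurable_fun setT (kernelK al A Gamma x).
Proof.
have oU := @open_setC1 R n x.
apply: (measurable_fun_off (x0 := x)) => y yx.
have ck : Ck ee 0 (~` [set x]) ktilde.
  apply: (Ck_mul oU).
    apply: (Ck_comp oU (W := pos_set) (F := fun t : R => t `^ (- (al + 2)))).
    - by move=> z /eqP zx; rewrite /pos_set /= (gam_gt0 hG) // eq_sym.
    - exact: Coo_powR.
    - exact: gam_Coo hG x 0%N.
  exact: (Ck_energy (cA hA) oU (gam_Coo hG x 1%N) (gam_Coo hG x 1%N)).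
have Uy : (~` [set x]) y by exact/eqP.
apply: continuous_near (Ck_cont ck Uy).
apply: filterS (open_nbhs_nbhs (conj oU Uy)) => z /eqP zx.
by rewrite kernelK_gam.
Qed.

(** The powers of the level radius add up to the exponent [alpha + 2] of the
    kernel. *)
Lemma kernelK_density y : y != x -> level_radius Gamma x y < r ->
  kernelK al A Gamma x y = D y.
Proof.
move=> yx yr; rewrite kernelK_gam // /ktilde /D /density; congr (_ * _).
have v0 := level_radius_gt0 hG yx; have xy : x != y by rewrite eq_sym.
have g0 := gam_gt0 hG xy.
rewrite /pw /power_weight v0 yr /= -powR_mulrn ?(ltW v0) //.
rewrite /level_radius -powR_inv1 ?(ltW g0) // -!powRrM -powRD; last first.
  by apply/implyP => _; rewrite gt_eqF.
by congr (_ `^ _); ring.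
Qed.

Lemma averageE (u : V -> R) : continuous u ->
  average al A Gamma r u x = kap^-1 * \int[lam]_y (u y * D y).
Proof.
move=> cu; have mu' := continuous_measurable_rV cu.
rewrite /average total_weightV; congr (_ * _).
have mO := measurable_Omega r0.
rewrite (Rintegral_supp lam mO); last first.
  move=> y; rewrite OmegaE //= => /negP; rewrite -leNgt => ry.
  by rewrite /D /density /pw /power_weight [_ < r]ltNge ry andbF !mul0r mulr0.
congr fine; apply: ae_eq_integral => //.
- apply/measurable_EFinP; apply: measurable_funTS; apply: measurable_funM => //.
  exact: measurable_kernelK.
- apply/measurable_EFinP; apply: measurable_funTS; apply: measurable_funM => //.
  exact: measurable_power_density.
- apply: filterS (ae_neq hA x) => y xy; rewrite OmegaE //= => yr.
  by rewrite kernelK_density // eq_sym.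
Qed.

Lemma integral_gam_D z : z != x ->
  (\int[lam]_y (gam z y * D y)%:E = (kept (gam x z))%:E)%E.
Proof.
move=> zx; rewrite (integral_gam_power_density hA hG al r0 zx) keptE //.
exact: gam_ge0 hG x z.
Qed.

End mean_value_formula.

(** * Averages of potentials *)

Section averages_of_potentials.
Context {R : realType} {n : nat}.
Variables (A : 'rV[R]_n -> 'M[R]_n) (Gamma : 'rV[R]_n -> 'rV[R]_n -> R).
Local Notation V := ('rV[R]_n).
Hypothesis hA : admissible_operator A.
Hypothesis hG : fundamental_solution A Gamma.
Implicit Types (y z : V) (s t : R).
Local Notation gam := (gam Gamma).
Local Notation lam := (lebesgue_rV n).
Local Notation mu := (@lebesgue_measure R).
Variables (al : R) (x : V) (r : R).
Hypotheses (al1 : -1 < al) (r0 : 0 < r).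
Local Notation kap := (total_weight al r).
Local Notation D := (density A Gamma (power_weight al r) x).

Let g0 y : 0 <= gam x y := gam_ge0 hG x y.

Lemma measurable_excess2 :
  measurable_fun setT (fun p : V * measurableTypeR R => excess al r (gam x p.1) p.2).
Proof.
have m2 : measurable_fun setT (fun p : V * measurableTypeR R => (p.2)^-1 : R).
  exact: measurableT_comp (@measurable_invr R) measurable_snd.
have m1 : measurable_fun setT (fun p : V * measurableTypeR R => gam x p.1).
  exact: measurableT_comp (measurable_gam hG x) measurable_fst.
apply: measurable_funM.
  by apply: measurable_maxr; [exact: measurable_funB|exact: measurable_cst].
exact: measurableT_comp (measurable_power_weight al r) measurable_snd.
Qed.

Lemma integral_excess z :
  (\int[mu]_s (excess al r (gam x z) s)%:E = (lost al r (gam x z))%:E)%E.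
Proof.
rewrite /lost /Rintegral fineK //.
exact: integrable_fin_num (integrable_excess al1 r0 (g0 z)).
Qed.

Lemma measurable_lost : measurable_fun setT (fun z => lost al r (gam x z)).
Proof.
apply/measurable_EFinP.
rewrite (_ : EFin \o _ = fubini_F mu (fun p : V * measurableTypeR R =>
  (excess al r (gam x p.1) p.2)%:E)); last first.
  by apply/funext => z; rewrite /fubini_F /= integral_excess.
apply: measurable_fun_fubini_tonelli_F.
  by apply/measurable_EFinP; exact: measurable_excess2.
by move=> p; rewrite lee_fin excess_ge0.
Qed.

Lemma lost_off z : r <= level_radius Gamma x z -> lost al r (gam x z) = 0.
Proof.
move=> rz; apply: (lost_eq0 al r0 (g0 z)); have := g0 z; rewrite le_eqVlt.
case/orP => [/eqP <-|gz]; first by rewrite invr_ge0 ltW.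
by rewrite -[leLHS]invrK lef_pV2 ?posrE ?invr_gt0.
Qed.

Lemma integrable_lost : lam.-integrable setT (EFin \o (fun z => lost al r (gam x z))).
Proof.
have [M HM] := level_radius_proper hG x r.
have mK := @measurable_norm_le R n M.
apply: (integrable_supp mK) => [z /negP|].
  rewrite -ltNge => Mz; apply: lost_off; rewrite leNgt; apply/negP => /ltW/HM.
  by rewrite leNgt Mz.
have gi := gam_L1 hA hG x (@compact_norm_le R n M).
apply: (@le_integrable _ _ _ lam _ mK _ (EFin \o (fun z => kap * gam x z))).
- by apply/measurable_EFinP; apply: measurable_funTS; exact: measurable_lost.
- move=> z _; rewrite lee_fin ger0_norm ?lost_ge0 //.
  by apply: le_trans (ler_norm _); rewrite mulrC lost_le.
- have := integrableZl mK kap gi.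
  by apply: eq_integrable => // z _; rewrite /= EFinM.
Qed.

Lemma Rintegral_lost_gt0 : 0 < \int[lam]_z lost al r (gam x z).
Proof.
have il := integrable_lost.
apply: fine_gt0; apply/andP; split; last first.
  by rewrite ltey_eq (integrable_fin_num measurableT il).
have [d d0 Hd] := gam_pole hG x r^-1.
pose i0 : 'I_n := Ordinal (dim_gt0 hA).
pose h : V := (d / 2) *: delta_mx ord0 i0.
have hn : h != 0.
  apply/eqP => /matrixP/(_ ord0 i0); rewrite !mxE !eqxx mulr1 => h0.
  by have : 0 < d / 2; [rewrite divr_gt0|rewrite h0 ltxx].
have hd : `|h| < d.
  apply: (@le_lt_trans _ _ (d / 2)); last by lra.
  apply: norm_rV_le => [|i]; first by rewrite divr_ge0 // ltW.
  rewrite !mxE eqxx /=; case: (i == i0); rewrite ?mulr0 ?normr0 ?mulr1.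
    by rewrite ger0_norm // divr_ge0 // ltW.
  by rewrite divr_ge0 // ltW.
apply: (@integral_gt0_open R n ((~` [set x]) `&` ball x d)).
- exact: measurable_lost.
- by move=> z; exact: lost_ge0.
- by apply: openI; [exact: open_setC1|exact: ball_open].
- exists (x + h); split.
    by move=> /= /eqP; rewrite -subr_eq0 [x + h]addrC addrK; exact/negP.
  by rewrite -ball_normE /= opprD addNKr normrN.
- move=> z [/eqP zx]; rewrite -ball_normE /= distrC => zd.
  by apply: lost_gt0 => //; exact: Hd.
Qed.

Lemma integrable_height s : 0 < s ->
  lam.-integrable setT (EFin \o (fun y => Num.max (gam x y - s^-1) 0)).
Proof.
move=> s0; have [M HM] := level_radius_proper hG x s.
have mK := @measurable_norm_le R n M.
have si : 0 < s^-1 by rewrite invr_gt0.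
apply: (integrable_supp mK) => [y /negP|].
  rewrite -ltNge => My; apply: max_r; rewrite subr_le0 leNgt; apply/negP => h.
  have g1 := lt_trans si h.
  have : level_radius Gamma x y <= s.
    by rewrite /level_radius -[leRHS]invrK lef_pV2 ?posrE // ltW.
  by move=> /HM; rewrite leNgt My.
apply: (@le_integrable _ _ _ lam _ mK _ (EFin \o gam x)).
- apply/measurable_EFinP; apply: measurable_funTS; apply: measurable_maxr.
    by apply: measurable_funB; [exact: measurable_gam hG x|exact: measurable_cst].
  exact: measurable_cst.
- move=> y _; rewrite lee_fin !ger0_norm ?le_max ?lexx ?orbT //.
  by rewrite ge_max g0 gerBl ltW.
- exact: gam_L1 hA hG x _ (@compact_norm_le R n M).
Qed.

Lemma integral_Omega_height s : 0 < s ->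
  \int[lam]_(y in Omega Gamma s x) (Gamma x y - s^-1) =
  \int[lam]_y Num.max (gam x y - s^-1) 0.
Proof.
move=> s0; have mO := measurable_Omega hG x s0.
have si : 0 < s^-1 by rewrite invr_gt0.
rewrite [RHS](Rintegral_supp lam mO); last first.
  move=> y; rewrite (OmegaE hG x s0) /= => /negP; rewrite -leNgt => sy.
  have g1 : 0 < gam x y by rewrite -invr_gt0; exact: lt_le_trans sy.
  by apply: max_r; rewrite subr_le0 -[leLHS]invrK lef_pV2 ?posrE ?invr_gt0.
congr fine; apply: ae_eq_integral => //.
- apply/measurable_EFinP; apply: measurable_funTS; apply: measurable_funB.
    exact: measurable_Gamma hG x.
  exact: measurable_cst.
- have := integrable_height s0; move=> /integrableP[/measurable_EFinP + _] => m.
  by apply/measurable_EFinP; exact: measurable_funTS.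
- apply: filterS (ae_neq hA x) => y xy; rewrite (OmegaE hG x s0) /= => ys.
  rewrite -(gamE Gamma xy) max_l // subr_ge0.
  have g1 := gam_gt0 hG xy.
  by rewrite -[leRHS]invrK lef_pV2 ?posrE ?invr_gt0 // ltW.
Qed.

(** Tonelli: the iterated integral that defines [Qavg] is the one of [lost],
    taken in the other order. *)
Lemma QavgE : Qavg al Gamma r x = kap^-1 * \int[lam]_z lost al r (gam x z).
Proof.
rewrite /Qavg total_weightV; congr (_ * _).
have ei s : lam.-integrable setT (EFin \o (fun y => excess al r (gam x y) s)).
  have [s0|s0] := leP s 0.
    rewrite (_ : EFin \o _ = cst 0%E); first exact: integrable0.
    by apply/funext => y /=; rewrite /excess power_weight_le0 // mulr0.
  have := integrableZl measurableT (power_weight al r s) (integrable_height s0).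
  by apply: eq_integrable => // y _; rewrite /= /excess mulrC EFinM.
pose e s := \int[lam]_y excess al r (gam x y) s.
transitivity (\int[mu]_(s in `]0, r[) e s).
  apply: eq_Rintegral => s; rewrite inE /= in_itv /= => /andP[s0 sr].
  rewrite integral_Omega_height // -RintegralZl //; last exact: integrable_height.
  by apply: eq_Rintegral => y _; rewrite /excess /power_weight s0 sr mulrC.
rewrite -(@Rintegral_supp _ _ _ mu `]0, r[%classic) //; last first.
  move=> s sr; rewrite /e /Rintegral integral0_eq // => y _.
  rewrite /excess /power_weight ifN ?mulr0 //; apply/negP => h; apply: sr.
  by rewrite /= in_itv.
rewrite /Rintegral; congr fine.
transitivity (\int[mu]_s \int[lam]_y (excess al r (gam x y) s)%:E)%E.
  apply: eq_integral => s _; rewrite /e /Rintegral fineK //.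
  exact: integrable_fin_num (ei s).
transitivity (\int[lam]_y \int[mu]_s (excess al r (gam x y) s)%:E)%E.
  apply/esym; apply: (@fubini_tonelli _ _ _ _ _ lam mu
    (fun p : V * measurableTypeR R => (excess al r (gam x p.1) p.2)%:E)).
    by apply/measurable_EFinP; exact: measurable_excess2.
  by move=> p; rewrite lee_fin excess_ge0.
by apply: eq_integral => y _; rewrite integral_excess.
Qed.

Variable f : V -> R.
Hypotheses (cf : continuous f) (sf : compact (supp f)).

Let fM : exists M : R, forall y, M < `|y| -> f y = 0 := supp_bound sf.

Let fC : exists2 C, 0 < C & forall y, `|f y| <= C.
Proof.
have [M HM] := fM.
have [|C C0 HC] := continuous_bounded_on (f := f) (@compact_norm_le R n M).
  exact: continuous_subspaceT.
exists C => // y; have [/HC//|/HM ->] := leP `|y| M.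
by rewrite normr0 ltW.
Qed.

Let mf : measurable_fun setT f := continuous_measurable_rV cf.

Lemma measurable_kept : measurable_fun setT (fun z => kept al r (gam x z)).
Proof.
rewrite (_ : (fun z => _) = (fun z => gam x z * kap - lost al r (gam x z))); last first.
  by apply/funext => z; rewrite (lostE al1 r0 (g0 z)) subKr.
apply: measurable_funB; last exact: measurable_lost.
by apply: measurable_funM; [exact: measurable_gam hG x|exact: measurable_cst].
Qed.

Lemma integrable_gam_f y : lam.-integrable setT (EFin \o (fun z => gam y z * f z)).
Proof.
by have [M HM] := fM; have [C _ HC] := fC; exact: (integrable_gamM hA hG y mf HC HM).
Qed.

Lemma integrable_kept_f :
  lam.-integrable setT (EFin \o (fun z => f z * kept al r (gam x z))).
Proof.
apply: (@le_integrable _ _ _ lam _ measurableT _ (EFin \o (fun z => kap * (gam x z * f z)))).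
- by apply/measurable_EFinP; apply: measurable_funM => //; exact: measurable_kept.
- move=> z _; rewrite lee_fin mulrA normrM [leRHS]normrM mulrC.
  apply: ler_wpM2r => //; rewrite ger0_norm ?kept_ge0 //.
  by apply: le_trans (ler_norm _); rewrite mulrC kept_le.
- have := integrableZl measurableT kap (integrable_gam_f x).
  by apply: eq_integrable => // z _; rewrite /= EFinM.
Qed.

(** Fubini.  The value of [f] at [x] is replaced by 0 because the average of
    [Gamma z] need not be finite at [z = x]. *)
Lemma integral_potential_density :
  \int[lam]_y (potential Gamma f y * D y) =
  \int[lam]_z (f z * kept al r (gam x z)).
Proof.
pose f' z := if z == x then 0 else f z.
have mf' : measurable_fun setT f'.
  apply: (measurable_fun_off (x0 := x)) => z zx.
  have cfz : {for (z : V), continuous f} by exact: cf.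
  apply: continuous_near cfz.
  apply: filterS (open_nbhs_nbhs (conj (@open_setC1 R n x) (_ : (~` [set x]) z))); last exact/eqP.
  by move=> w /eqP /negbTE wx; rewrite /f' wx.
have kx : kept al r (gam x x) = 0.
  apply/eqP; rewrite eq_le kept_ge0 ?gamxx // andbT.
  by have := kept_le al1 r0 (lexx 0); rewrite mul0r.
have ff' z : f' z * kept al r (gam x z) = f z * kept al r (gam x z).
  by rewrite /f'; case: eqVneq => // ->; rewrite kx !mulr0.
have mD := measurable_power_density hA hG al x r.
have D0 := power_density_ge0 Gamma hA al x r.
pose F (p : V * V) := gam p.1 p.2 * f' p.2 * D p.1.
have mF : measurable_fun setT (EFin \o F).
  apply/measurable_EFinP; apply: measurable_funM; last first.
    exact: measurableT_comp mD measurable_fst.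
  apply: measurable_funM; first exact: measurable_gam2 hG.
  exact: measurableT_comp mf' measurable_snd.
have inner z (c : R) : z != x ->
    (\int[lam]_y (c * (gam z y * D y))%:E = (c * kept al r (gam x z))%:E)%E.
  move=> zx; have I := integral_gam_D hA hG al1 r0 zx.
  have gi : lam.-integrable setT (EFin \o (fun y => gam z y * D y)).
    apply/integrableP; split.
      apply/measurable_EFinP; apply: measurable_funM; last exact: mD.
      exact: (measurable_gam hG z).
    rewrite (_ : (\int[lam]_y _)%E = (\int[lam]_y (gam z y * D y)%:E)%E).
      by rewrite I ltry.
    apply: eq_integral => y _; rewrite gee0_abs // lee_fin.
    by apply: mulr_ge0; [exact: (gam_ge0 hG)|exact: D0].
  under eq_integral do rewrite EFinM.
  by rewrite integralZl // I EFinM.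
have fx : f' x = 0 by rewrite /f' eqxx.
have inner3 z : (\int[lam]_y (gam y z * f' z * D y)%:E =
    (f' z * kept al r (gam x z))%:E)%E.
  have [->|zx] := eqVneq z x.
    rewrite fx mul0r; apply: integral0_eq => y _.
    by rewrite mulr0 mul0r.
  rewrite -(inner z (f' z) zx); apply: eq_integral => y _; congr EFin.
  by rewrite (gam_sym hG y) mulrAC mulrC.
have inner4 z : (\int[lam]_y (`|gam y z * f' z * D y|)%:E =
    (`|f' z| * kept al r (gam x z))%:E)%E.
  have [->|zx] := eqVneq z x.
    rewrite fx normr0 mul0r; apply: integral0_eq => y _.
    by rewrite mulr0 mul0r normr0.
  rewrite -(inner z (`|f' z|) zx); apply: eq_integral => y _; congr EFin.
  rewrite normrM (ger0_norm (D0 y)) normrM (ger0_norm (gam_ge0 hG y z)).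
  by rewrite (gam_sym hG y) mulrAC mulrC.
have iF : (lam \x lam)%E.-integrable setT (EFin \o F).
  apply/(integrable21ltyP lam lam mF).
  rewrite (_ : (\int[lam]_z _)%E = (\int[lam]_z (`|f z * kept al r (gam x z)|)%:E)%E).
    by have /integrableP[_ fk] := integrable_kept_f; exact: fk.
  apply: eq_integral => z _; apply: etrans (inner4 z) _.
  by rewrite -ff' normrM (ger0_norm (kept_ge0 _ _ (g0 z))).
have inner2 y : (\int[lam]_z (gam y z * f' z * D y)%:E =
    (potential Gamma f y * D y)%:E)%E.
  have i1 := integrable_gam_f y.
  have -> : potential Gamma f y = fine (\int[lam]_z (gam y z * f z)%:E)%E.
    exact: (potentialE hA hG y cf).
  rewrite EFinM fineK ?(integrable_fin_num measurableT i1) // muleC.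
  rewrite -integralZl //; apply: ae_eq_integral.
  - exact: measurableT.
  - apply/measurable_EFinP; apply: measurable_funM; last exact: measurable_cst.
    by apply: measurable_funM; [exact: measurable_gam hG y|exact: mf'].
  - apply: measurable_funeM; apply/measurable_EFinP; apply: measurable_funM; last exact: mf.
    exact: measurable_gam hG y.
  - apply: filterS (ae_neq hA x) => z xz _; rewrite /f' eq_sym (negbTE xz) -EFinM.
    by congr EFin; rewrite mulrC.
have FE := Fubini iF.
rewrite /Rintegral; congr fine.
transitivity (\int[lam]_y \int[lam]_z (EFin \o F) (y, z))%E.
  by apply: eq_integral => y _; exact: esym (inner2 y).
apply: etrans FE _; apply: eq_integral => z _.
by apply: etrans (inner3 z) _; rewrite ff'.
Qed.

Lemma average_potential :
  average al A Gamma r (potential Gamma f) x - potential Gamma f x =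
  - (kap^-1 * \int[lam]_z (f z * lost al r (gam x z))).
Proof.
have k0 := total_weight_gt0 al1 r0.
rewrite (averageE hA hG al x r0) ?integral_potential_density; last first.
  exact: (potential_continuous hA hG cf sf).
have -> : potential Gamma f x = kap^-1 * \int[lam]_z (kap * (gam x z * f z)).
  rewrite RintegralZl //; last exact: integrable_gam_f.
  by rewrite mulrA (mulVf (lt0r_neq0 k0)) mul1r; exact: (potentialE hA hG x cf).
rewrite -mulrBr -mulrN; congr (_ * _).
have i1 : lam.-integrable setT (EFin \o (fun z => kap * (gam x z * f z))).
  have := integrableZl measurableT kap (integrable_gam_f x).
  by apply: eq_integrable => // z _; rewrite /= EFinM.
rewrite -opprB -RintegralB //; last exact: integrable_kept_f.
congr (- _); apply: eq_Rintegral => z _; rewrite (lostE al1 r0 (g0 z)); ring.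
Qed.

(** Up to sign the quotient is the mean of [f] with weight [lost], which is
    carried by [Omega r x]. *)
Lemma average_quotient_dist (e : R) :
  (forall z, level_radius Gamma x z < r -> `|f z - f x| <= e) ->
  `|average_quotient al A Gamma (potential Gamma f) x r - (- f x)| <= e.
Proof.
move=> He; have k0 := total_weight_gt0 al1 r0; have q0 := Rintegral_lost_gt0.
have il := integrable_lost.
set q := \int[lam]_z _ in q0.
have il2 c : lam.-integrable setT (EFin \o (fun z => c * lost al r (gam x z))).
  have := integrableZl measurableT c il.
  by apply: eq_integrable => // z _; rewrite /= EFinM.
have [C _ HC] := fC.
have ifl : lam.-integrable setT (EFin \o (fun z => f z * lost al r (gam x z))).
  have := integrableMl measurableT il mf (bounded_le (fun y _ => HC y)).
  by apply: eq_integrable => // z _; rewrite /= muleC EFinM.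
have -> : average_quotient al A Gamma (potential Gamma f) x r - (- f x) =
    - (q^-1 * (\int[lam]_z (f z * lost al r (gam x z)) - f x * q)).
  rewrite /average_quotient average_potential QavgE -/q.
  by field; rewrite !gt_eqF.
rewrite normrN normrM gtr0_norm ?invr_gt0 // ler_pdivrMl //.
rewrite /q -RintegralZl // -RintegralB //.
have i3 : lam.-integrable setT (EFin \o (fun z =>
    f z * lost al r (gam x z) - f x * lost al r (gam x z))).
  have := integrableB measurableT ifl (il2 (f x)).
  by apply: eq_integrable => // z _; rewrite /= EFinB.
apply: le_trans (le_normr_Rintegral measurableT i3) _.
rewrite mulrC -RintegralZl //; apply: le_Rintegral => //.
  have := integrable_norm i3.
  by apply: eq_integrable.
move=> z _; rewrite -mulrBl normrM (ger0_norm (lost_ge0 _ _ _)).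
have [rz|zr] := leP r (level_radius Gamma x z); first by rewrite lost_off // !mulr0.
by apply: ler_wpM2r; [exact: lost_ge0|exact: He].
Qed.

End averages_of_potentials.

Theorem theorem1p5 (R : realType) (n : nat)
    (A : 'rV[R]_n -> 'M[R]_n) (Gamma : 'rV[R]_n -> 'rV[R]_n -> R) (alpha : R)
    (f : 'rV[R]_n -> R) :
  admissible_operator A ->
  fundamental_solution A Gamma ->
  -1 < alpha ->
  continuous f -> compact (supp f) ->
  asymptotic_class alpha A Gamma (potential Gamma f) /\
  forall x : 'rV[R]_n,
    asymptotic_op alpha A Gamma (potential Gamma f) x = - f x.
Proof.
move=> hA hG al1 cf sf.
have L x : average_quotient alpha A Gamma (potential Gamma f) x r
    @[r --> 0^'+] --> - f x.
  apply/cvgrPdistC_le => e e0.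
  have /(cvgrPdistC_le _ _)/(_ e e0) := cf x; move=> /nbhs_ballP[d /= d0 Hd].
  have [C HC] := gam_upper hG x d0.
  have C1 : 0 < `|C| + 1 by rewrite ltr_wpDl.
  near=> r.
  have r0 : 0 < r by near: r; exact: nbhs_right_gt.
  have rC : r < (`|C| + 1)^-1.
    by near: r; apply: nbhs_right_lt; rewrite invr_gt0.
  apply: (average_quotient_dist hA hG al1 r0 cf sf) => z zr.
  apply: Hd; rewrite -ball_normE /= distrC ltNge; apply/negP => dz.
  have zx : z != x by exact: shell_neq d0 dz.
  have g0 : 0 < gam Gamma x z by rewrite (gam_gt0 hG) // eq_sym.
  have := lt_trans zr rC; rewrite /level_radius ltf_pV2 ?posrE // ltNge => /negP; apply.
  by apply: le_trans (HC z dz) _; rewrite (le_trans (ler_norm C)) // lerDl.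
split; first split.
- exact: (potential_continuous hA hG cf sf).
- by move=> x; apply/cvg_ex; exists (- f x); exact: L.
- by move=> x; rewrite /asymptotic_op; apply: cvg_lim; [exact: norm_hausdorff|exact: L].
Unshelve. all: end_near. Qed.
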